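(* Let $T>0$, let $n,d\ge 1$ be integers, let $f\in C_b^2(\mathbb{R}^n;\mathcal{L}(\mathbb{R}^d;\mathbb{R}^n))$, and let $q\in[1,2)$ and $p\in[q,\infty)$ satisfy $1/p+1/q>1$. Let $y\in\mathbb{R}^n$, $A\in D^q([0,T];\mathbb{R}^d)$, $X\in D^p([0,T];\mathbb{R}^n)$ and $L\in D^p([0,T];\mathbb{R}^n)$ be such that $y\ge L_0$ (componentwise). Then there exists a unique solution $(Y,K)$ to the reflected Young differential equation $$Y_t=y+\int_0^t f(Y_s)\,\mathrm{d}A_s+X_t+K_t,\qquad t\in[0,T],$$ driven by $A$ and $X$ with reflecting lower barrier $L$.
   Context: For $r\ge1$, $D^r([0,T];\mathbb{R}^m)$ denotes the space of càdlàg (right-continuous with left limits) paths $Z:[0,T]\to\mathbb{R}^m$ with finite $r$-variation $\|Z\|_{r,[0,T]}<\infty$, where $\|Z\|_{r,[s,t]}:=\big(\sup_{\mathcal{P}}\sum_{[u,v]\in\mathcal{P}}|Z_v-Z_u|^r\big)^{1/r}$, the supremum being over all finite partitions $\mathcal{P}$ of $[s,t]$, and $|\cdot|$ is the Euclidean norm. $\mathcal{L}(\mathbb{R}^d;\mathbb{R}^n)$ is the space of linear maps $\mathbb{R}^d\to\mathbb{R}^n$. $C_b^k(\mathbb{R}^n;\mathcal{L}(\mathbb{R}^d;\mathbb{R}^n))$ is the space of $k$-times Fréchet differentiable functions which, together with all derivatives up to order $k$, are continuous and bounded. Young integral: for a càdlàg path $H$ of finite $p$-variation with values in $\mathcal{L}(\mathbb{R}^d;\mathbb{R}^n)$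 and $A\in D^q([0,T];\mathbb{R}^d)$ with $1/p+1/q>1$, $\int_s^tH_r\,\mathrm{d}A_r:=\lim_{|\mathcal{P}|\to0}\sum_{[u,v]\in\mathcal{P}}H_u(A_v-A_u)$ (left-point Riemann sums, limit over partitions of $[s,t]$ with mesh tending to $0$). Solution: a pair $(Y,K)$ is a solution of the reflected Young differential equation if $Y,K\in D^p([0,T];\mathbb{R}^n)$ satisfy the displayed equation for all $t\in[0,T]$ and, for every $i=1,\dots,n$: (a) $Y^i_t\ge L^i_t$ for all $t\in[0,T]$; (b) $K^i:[0,T]\to\mathbb{R}$ is a non-decreasing function with $K^i_0=0$ and $\int_0^t(Y^i_s-L^i_s)\,\mathrm{d}K^i_s=0$ for all $t\in[0,T]$, where this last integral is a Lebesgue–Stieltjes integral. (Since $K$ is componentwise monotone, it then also belongs to $D^1([0,T];\mathbb{R}^n)$.)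
   Formalization: The formal theorem adds the componentwise assumption L_0 ≤ y + X_0: the equation at t=0 gives Y_0 = y + X_0, so without it no solution can stay above L (e.g. y=0, L=0, X=-1); if X_0=0 it is the stated y ≥ L_0. *)

(* Defs.v *)
From HB Require Import structures.
From mathcomp Require Import all_boot all_order all_algebra.
From mathcomp Require Import all_classical all_reals all_analysis.

Set Implicit Arguments.
Unset Strict Implicit.
Unset Printing Implicit Defensive.

Import Order.TTheory GRing.Theory Num.Theory.
Import numFieldNormedType.Exports.

Local Open Scope classical_set_scope.
Local Open Scope ring_scope.

(* R^m is 'cV[R]_m and L(R^d; R^n) is 'M[R]_(n, d), acting by A |-> H *m A.
   Paths on [0, T] are functions on R of which only the values on [0, T]
   are ever used. *)

(* The norm carried by the library's matrices is the max norm, so the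
   Euclidean norm is spelled out. *)
Definition eucl_norm (R : realType) (m : nat) (v : 'cV[R]_m) : R :=
  Num.sqrt (\sum_(i < m) v i ord0 ^+ 2).

(* A partition s = u_0 < u_1 < ... < u_N = t is encoded, as in realfun, by
   P = [:: u_1; ...; u_N] with itv_partition s t P; partition_pt s t P k is
   u_k for k <= N. *)
Definition partition_pt (R : realType) (s t : R) (P : seq R) (k : nat) : R :=
  nth t (s :: P) k.

Definition pvariation_sum (R : realType) (m : nat) (r : R) (Z : R -> 'cV[R]_m)
    (s t : R) (P : seq R) : R :=
  \sum_(0 <= k < size P)
    eucl_norm (Z (partition_pt s t P k.+1) - Z (partition_pt s t P k)) `^ r.

Definition pvariation (R : realType) (m : nat) (r : R) (Z : R -> 'cV[R]_m)
    (s t : R) : \bar R :=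
  poweR (ereal_sup [set (pvariation_sum r Z s t P)%:E | P in itv_partition s t])
        r^-1.

Definition cadlag (R : realType) (m : nat) (T : R) (Z : R -> 'cV[R]_m) : Prop :=
  (forall t, 0 <= t < T -> Z u @[u --> t^'+] --> Z t) /\
  (forall t, 0 < t <= T -> cvg (Z u @[u --> t^'-])).

Definition Dspace (R : realType) (r T : R) (m : nat) : set (R -> 'cV[R]_m) :=
  [set Z | cadlag T Z /\ (pvariation r Z 0 T < +oo)%E].

(* The Frechet derivative 'd f x : 'M_(a, b) -> 'M_(m, n) is turned by lin_mx
   into an element of the normed space 'M_(a * b, m * n), which represents the
   space of linear maps; the higher derivatives are obtained by iterating. *)
Fixpoint Cb (R : realType) (k : nat) (a b m n : nat)
    (f : 'M[R]_(a, b) -> 'M[R]_(m, n)) {struct k} : Prop :=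
  [/\ continuous f,
      bounded_fun f &
      if k is k'.+1 then
        (forall x, differentiable f x) /\ Cb k' (fun x => lin_mx ('d f x))
      else True].

Definition mesh (R : realType) (s t : R) (P : seq R) : R :=
  \big[Num.max/0]_(0 <= k < size P)
    (partition_pt s t P k.+1 - partition_pt s t P k).

Definition mesh_to0 (R : realType) (s t : R) : set_system (seq R) :=
  [set S | exists2 delta : R, 0 < delta &
     forall P, itv_partition s t P -> mesh s t P < delta -> S P].

Definition riemann_sum (R : realType) (n d : nat) (H : R -> 'M[R]_(n, d))
    (A : R -> 'cV[R]_d) (s t : R) (P : seq R) : 'cV[R]_n :=
  \sum_(0 <= k < size P)
    H (partition_pt s t P k) *m
      (A (partition_pt s t P k.+1) - A (partition_pt s t P k)).

Definition is_young_integral (R : realType) (n d : nat) (H : R -> 'M[R]_(n, d))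
    (A : R -> 'cV[R]_d) (s t : R) (I : 'cV[R]_n) : Prop :=
  riemann_sum H A s t P @[P --> mesh_to0 s t] --> I.

(* The library's Lebesgue-Stieltjes measures live on the whole line, so a path
   on [0, T] is extended by its values at 0 and T.  The extension is constant
   to the left of 0, hence its measure has no atom at 0. *)
Definition extend (R : realType) (T : R) (g : R -> R) (t : R) : R :=
  g (Num.max 0 (Num.min t T)).

(* int_0^t (g s) dk_s = 0 for all t in [0, T].  The cumulative function c
   exists as soon as k is nondecreasing and right-continuous on [0, T], and is
   then unique. *)
Definition stieltjes_integral_vanishes (R : realType) (T : R) (g k : R -> R)
    : Prop :=
  exists2 c : cumulative R R, (c : R -> R) =1 extend T k &
    forall t, 0 <= t <= T ->
      (\int[lebesgue_stieltjes_measure c]_(s in `[0%R, t]) (g s)%:E = 0)%E.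

Record reflected_solution (R : realType) (n d : nat) (T p : R)
    (f : 'cV[R]_n -> 'M[R]_(n, d)) (y : 'cV[R]_n) (A : R -> 'cV[R]_d)
    (X L Y K : R -> 'cV[R]_n) : Prop := ReflectedSolution {
  solution_Y : Dspace p T Y ;
  solution_K : Dspace p T K ;
  solution_eq : forall t : R, 0 <= t <= T ->
    exists2 I, is_young_integral (f \o Y) A 0 t I & Y t = y + I + X t + K t ;
  solution_barrier : forall i (t : R), 0 <= t <= T -> L t i ord0 <= Y t i ord0 ;
  solution_K_nondecreasing : forall i (s t : R), 0 <= s -> s <= t -> t <= T ->
    K s i ord0 <= K t i ord0 ;
  solution_K0 : forall i, K 0 i ord0 = 0 ;
  solution_minimal : forall i, stieltjes_integral_vanishes T
    (fun s => Y s i ord0 - L s i ord0) (fun s => K s i ord0)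
}.

(* Main.v *)
Require Import Defs.
From HB Require Import structures.
From mathcomp Require Import all_boot all_order all_algebra.
From mathcomp Require Import all_classical all_reals all_analysis.
From mathcomp Require Import measurable_realfun.
From mathcomp Require Import ring lra.

Set Implicit Arguments.
Unset Strict Implicit.
Unset Printing Implicit Defensive.

Import Order.TTheory GRing.Theory Num.Theory.
Import numFieldNormedType.Exports.

Local Open Scope classical_set_scope.
Local Open Scope ring_scope.

(** The equation is a fixed-point problem.  In dimension one, the Skorokhod problem
    for a path Z and a barrier L is solved by the running maximum
    K_t = max (0, sup_(s <= t) (L_s - Z_s)), and the minimality condition
    int (Y - L) dK = 0 singles out this K (reflection_minimal, minimal_reflection).
    Hence (Y, K) is a solution exactly when Y is a fixed point of the map that sends
    Y to Z + K with Z = y + int f(Y) dA + X, componentwise.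

    This map contracts the p-variation of a difference of two paths that agree up to
    time s, on intervals [s, v] where A has small q-variation
    (solution_map_contraction).  Three facts combine.
    - Composition with f is Lipschitz on sets of bounded p-variation, thanks to the
      two bounded derivatives (Cb2_increments).
    - Young's inequality bounds the p-variation of the integral by the variation of
      the integrand times a power of the q-variation of A (yint_var_le).  It comes
      from a maximal inequality for Riemann sums (young_maximal), which, applied with
      a slightly smaller exponent, also shows that left-point sums converge as the
      mesh tends to 0 in spite of common jumps (young_rsum_uniform).
    - Reflection is 1-Lipschitz for the p-variation (reflection_var_le): a difference
      of two running maxima only moves towards values currently taken by the
      difference of the two paths (var_le_tracking).

    As f is bounded, the variation of an image on [s, v] is at most a constant that
    depends on X and L only plus a term that is small with A (solution_map_growth).
    So Picard iteration extends a fixed point beyond any time s over a step whose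
    length is governed by the q-variation of A alone (picard_extension).  The
    variation of A over [s, t[ is small when s and t are close on either side, but a
    jump of A at t may be large.  It is inserted by hand: left-point integrals up to t
    do not see the value of the integrand at t, so the value of the fixed point at t
    is an explicit function of its past.  Induction along the time axis
    (real_induction, small_variation_induction) then gives existence and uniqueness on
    [0, T].

    Throughout, p-variations are measured by sums of p-th powers in the max norm; the
    Euclidean p-variation norm returns at the end (Dspace_Dpath, Dpath_Dspace). *)

(** * Real powers *)

Section PowR.
Variable R : realType.
Implicit Types (x y z p e : R).

Lemma powR_le p x y : 0 <= p -> 0 <= x -> x <= y -> x `^ p <= y `^ p.
Proof.
by move=> p0 x0 xy; apply: ge0_ler_powR => //; rewrite nnegrE// (le_trans x0).
Qed.

Lemma powR_add_ge p x y : 1 <= p -> 0 <= x -> 0 <= y ->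
  x `^ p + y `^ p <= (x + y) `^ p.
Proof.
move=> p1 x0 y0; have p0 : 0 < p by apply: lt_le_trans p1.
rewrite -(mulr_powRB1 x0 p0) -(mulr_powRB1 y0 p0) -(mulr_powRB1 (addr_ge0 x0 y0) p0).
rewrite mulrDl lerD// ler_wpM2l// powR_le// ?subr_ge0//; lra.
Qed.

(** All estimates are made on p-th powers, where this quasi-triangle inequality
    takes the place of Minkowski's: the constant 2^p is harmless. *)
Lemma powR_add_le p x y : 0 <= p -> 0 <= x -> 0 <= y ->
  (x + y) `^ p <= 2 `^ p * (x `^ p + y `^ p).
Proof.
move=> p0 x0 y0; wlog xy : x y x0 y0 / x <= y.
  by move=> h; case: (leP x y) => [|/ltW] ?; [|rewrite addrC [X in _ * X]addrC]; apply: h.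
have -> : 2 `^ p * (x `^ p + y `^ p) = 2 `^ p * x `^ p + (2 * y) `^ p.
  by rewrite mulrDr powRM.
rewrite -[leLHS]add0r lerD ?mulr_ge0 ?powR_ge0//.
by apply: powR_le => //; [exact: addr_ge0|lra].
Qed.

Lemma powRK p x : p != 0 -> 0 <= x -> (x `^ p) `^ p^-1 = x.
Proof. by move=> p0 x0; rewrite -powRrM divff// powRr1. Qed.

Lemma powRVK p x : p != 0 -> 0 <= x -> (x `^ p^-1) `^ p = x.
Proof. by move=> p0 x0; rewrite -powRrM mulVf// powRr1. Qed.

Lemma powR_le_inv p x y : 0 < p -> 0 <= x -> 0 <= y -> x `^ p <= y -> x <= y `^ p^-1.
Proof.
move=> p0 x0 y0 h; rewrite -[leLHS](@powRK p) ?gt_eqF//.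
by apply: powR_le => //; [rewrite invr_ge0 ltW|exact: powR_ge0].
Qed.

Lemma powR_cont p x e : 0 < p -> 0 <= x -> 0 < e ->
  exists2 d : R, 0 < d & forall y, 0 <= y -> `|y - x| < d -> `|y `^ p - x `^ p| < e.
Proof.
move=> p0; rewrite le_eqVlt => /predU1P[<-|x0] e0.
  exists (e `^ p^-1) => [|y y0]; first exact: powR_gt0.
  rewrite subr0 powR0 ?gt_eqF// subr0 ger0_norm// ger0_norm ?powR_ge0// => yd.
  by rewrite -[ltRHS](@powRVK p) ?gt_eqF ?ltW// gt0_ltr_powR// nnegrE ?powR_ge0.
have : {for x, continuous (fun a : R => a `^ p)}.
  apply: differentiable_continuous; apply/derivable1_diffP.
  by apply: derivable_powR; rewrite in_itv/= x0.
move=> /cvgrPdist_lt/(_ _ e0)/nbhs_ballP[d /= d0 h]; exists d => // y y0 yd.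
by rewrite distrC; apply: h; rewrite /ball/= distrC.
Qed.

Lemma powR_interp x y z be : 0 <= be -> be <= 1 -> 0 <= x -> x <= y -> x <= z ->
  x <= y `^ (1 - be) * z `^ be.
Proof.
move=> b0 b1 x0 xy xz; have {1}-> : x = x `^ (1 - be) * x `^ be.
  rewrite -powRD ?subrK ?powRr1//; first by apply/implyP; rewrite oner_eq0.
by apply: ler_pM; rewrite ?powR_ge0//; apply: powR_le => //; rewrite subr_ge0.
Qed.

Lemma geometric_small (c la : R) e : 0 <= la -> la < 1 -> 0 < e ->
  exists k : nat, forall j, (k <= j)%N -> c * la ^+ j < e.
Proof.
move=> la0 la1 e0.
have : (fun j => c * la ^+ j) @ \oo --> c * 0.
  by apply: cvgMr; apply: cvg_expr; rewrite ger0_norm.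
rewrite mulr0 => /cvgrPdist_lt/(_ e e0)[k _ h]; exists k => j kj.
by have := h j kj; rewrite /= sub0r normrN; apply: le_lt_trans; exact: ler_norm.
Qed.

End PowR.

(** * Sums of powers of increments *)

Lemma subrACA (V : zmodType) (a b c d : V) : (a - b) - (c - d) = (a - c) - (b - d).
Proof. by rewrite opprD opprK addrACA [in RHS]opprD opprK. Qed.

Lemma addrBACA (V : zmodType) (a b c e : V) : (a - c) + (b - e) = (a + b) - (c + e).
Proof. by rewrite opprD addrACA. Qed.

Section Variation.
Variables (R : realType) (V : normedZmodType R).
Implicit Types (p a b c x y M : R) (s : seq R) (g h : R -> V).

(** The sum runs over a chain x :: s placed anywhere in [a, b], not over a
    partition: completing a chain only adds non-negative terms, and chains, unlike
    partitions, can be restricted and concatenated freely. *)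
Fixpoint vsum p g x s : R :=
  if s is y :: s' then `|g y - g x| `^ p + vsum p g y s' else 0.

(** Bounds are kept apart from the supremum: most estimates transport a bound,
    and a bound carries its own finiteness. *)
Definition var_le p g a b M := forall x s,
  a <= x -> path <%R x s -> last x s <= b -> vsum p g x s <= M.

Definition var p g a b : R :=
  sup [set r | exists x s, [/\ a <= x, path <%R x s, last x s <= b & r = vsum p g x s]].

Definition finvar p g a b := exists M, var_le p g a b M.

Lemma path_le_last x s : path <%R x s -> x <= last x s.
Proof.
elim: s x => //= y s ih x /andP[xy /ih]; apply: le_trans; exact: ltW.
Qed.

Lemma path_mem_le x s z : path <%R x s -> z \in x :: s -> x <= z <= last x s.
Proof.
elim: s x => [|y s ih] x /=; first by move=> _; rewrite inE => /eqP ->; rewrite lexx.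
move=> /andP[xy ps]; rewrite inE => /predU1P[->|/(ih _ ps)/andP[yz ->]].
  by rewrite lexx/= (le_trans (ltW xy))// path_le_last.
by rewrite andbT (le_trans (ltW xy)).
Qed.

Lemma vsum_cat p g x s1 s2 :
  vsum p g x (s1 ++ s2) = vsum p g x s1 + vsum p g (last x s1) s2.
Proof. by elim: s1 x => [|y s1 ih] x /=; rewrite ?add0r// ih addrA. Qed.

Lemma vsum_eq p g h x s : {in x :: s, g =1 h} -> vsum p g x s = vsum p h x s.
Proof.
elim: s x => //= y s ih x gh; rewrite ih; last first.
  by move=> z zs; apply: gh; rewrite inE zs orbT.
by rewrite !gh ?inE ?eqxx ?orbT.
Qed.

(** Superadditivity of om makes the bounds on the increments telescope; every
    p-variation bound for an integral or a monotone path rests on this. *)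
Lemma vsum_superadd p g (om : R -> R -> R) a b x s :
  (forall u v, a <= u -> u < v -> v <= b -> `|g v - g u| `^ p <= om u v) ->
  (forall u, a <= u -> u <= b -> 0 <= om u u) ->
  (forall u v w, a <= u -> u <= v -> v <= w -> w <= b -> om u v + om v w <= om u w) ->
  a <= x -> path <%R x s -> last x s <= b -> vsum p g x s <= om x (last x s).
Proof.
move=> gom om0 om2; elim: s x => [|y s ih] x ax /=; first by move=> _ /(om0 _ ax).
move=> /andP[xy ps] lb; have yl := path_le_last ps.
apply: le_trans (om2 x y _ ax (ltW xy) yl lb).
rewrite lerD//; first by apply: gom => //; exact: le_trans lb.
by apply: ih => //; rewrite (le_trans ax)// ltW.
Qed.

Lemma var_le_sub p g a b a' b' M :
  a <= a' -> b' <= b -> var_le p g a b M -> var_le p g a' b' M.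
Proof.
move=> aa bb h x s ax ps lb; apply: h => //; [exact: le_trans ax|exact: le_trans bb].
Qed.

Lemma var_le_trans p g a b M M' : M <= M' -> var_le p g a b M -> var_le p g a b M'.
Proof. by move=> MM h x s ax ps lb; apply: le_trans MM; exact: h. Qed.

Lemma var_le_eq p g h a b M : (forall t, a <= t <= b -> g t = h t) ->
  var_le p g a b M -> var_le p h a b M.
Proof.
move=> gh gM x s ax ps lb; rewrite -(@vsum_eq p g); first exact: gM.
move=> z /(path_mem_le ps)/andP[xz zl]; apply: gh.
by rewrite (le_trans ax)//= (le_trans zl).
Qed.

Lemma var_le_incr p g a b M u v : var_le p g a b M ->
  a <= u -> u <= v -> v <= b -> 0 < p -> `|g v - g u| `^ p <= M.
Proof.
move=> h au; rewrite le_eqVlt => /predU1P[<-|uv] ub p0.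
  by rewrite subrr normr0 powR0 ?gt_eqF//; exact: (h u [::]).
by have /= := h u [:: v]; rewrite addr0 uv; exact.
Qed.

Lemma var_le_ge0 p g a b M : a <= b -> var_le p g a b M -> 0 <= M.
Proof. by move=> ab h; exact: (h a [::]). Qed.

Lemma var_ub p g a b x s : finvar p g a b ->
  a <= x -> path <%R x s -> last x s <= b -> vsum p g x s <= var p g a b.
Proof.
move=> [M hM] ax ps lb; apply: ub_le_sup; last by exists x, s.
by exists M => _ [x' [s' [? ? ? ->]]]; exact: hM.
Qed.

Lemma var_lub p g a b M : a <= b -> var_le p g a b M -> var p g a b <= M.
Proof.
move=> ab hM; apply: ge_sup.
  by exists 0, a, [::]; split.
by move=> _ [x' [s' [? ? ? ->]]]; exact: hM.
Qed.

Lemma var_leP p g a b : finvar p g a b -> var_le p g a b (var p g a b).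
Proof. by move=> h x s *; exact: var_ub. Qed.

Lemma finvar_sub p g a b a' b' : a <= a' -> b' <= b ->
  finvar p g a b -> finvar p g a' b'.
Proof. by move=> aa bb [M /(var_le_sub aa bb)]; exists M. Qed.

Lemma var_ge0 p g a b : finvar p g a b -> a <= b -> 0 <= var p g a b.
Proof. by move=> h ab; apply: (var_ub h (lexx a) (s := [::])). Qed.

Lemma var_mono p g a b a' b' : a <= a' -> a' <= b' -> b' <= b ->
  finvar p g a b -> var p g a' b' <= var p g a b.
Proof.
move=> aa ab bb h; apply: var_lub => //.
by apply: var_le_sub aa bb _; exact: var_leP.
Qed.

(** The increment across the gap between the two chains only adds. *)
Lemma vsum_join p g x s y s' : path <%R x s -> last x s <= y -> path <%R y s' ->
  exists s2, [/\ path <%R x s2, last x s2 = last y s' &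
    vsum p g x s + vsum p g y s' <= vsum p g x s2].
Proof.
move=> ps; rewrite le_eqVlt => /predU1P[<- ps'|ly ps'].
  by exists (s ++ s'); rewrite cat_path ps ps' last_cat vsum_cat; split.
exists (s ++ y :: s'); rewrite cat_path ps/= ly ps' last_cat vsum_cat; split => //=.
by rewrite lerD2l lerDr powR_ge0.
Qed.

Lemma var_superadd p g a b c : finvar p g a c -> a <= b -> b <= c ->
  var p g a b + var p g b c <= var p g a c.
Proof.
move=> h ab bc; rewrite -lerBrDr; apply: var_lub => // x s ax ps lb.
rewrite lerBrDr addrC -lerBrDr; apply: var_lub => // y s' bx ps' lc.
rewrite lerBrDr addrC.
have [s2 [ps2 l2]] := vsum_join p g ps (le_trans lb bx) ps'.
move=> /le_trans; apply; apply: var_ub => //; by rewrite l2.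
Qed.

Lemma var_incr p g a b u v : finvar p g a b -> 0 < p ->
  a <= u -> u <= v -> v <= b -> `|g v - g u| `^ p <= var p g u v.
Proof.
move=> h p0 au uv vb; apply: (@var_le_incr _ _ u v) => //.
by apply: var_leP; exact: finvar_sub h.
Qed.

End Variation.

Section Variation2.
Variable R : realType.
Implicit Types (V W : normedZmodType R) (p a b c x y M k : R) (s : seq R).

Lemma vsum_comp2 V W1 W2 p (g : R -> V) (h1 : R -> W1) (h2 : R -> W2) k1 k2 x s :
  (forall u v, u \in x :: s -> v \in x :: s -> u < v ->
     `|g v - g u| `^ p <= k1 * `|h1 v - h1 u| `^ p + k2 * `|h2 v - h2 u| `^ p) ->
  path <%R x s ->
  vsum p g x s <= k1 * vsum p h1 x s + k2 * vsum p h2 x s.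
Proof.
elim: s x => [|y s ih] x /=; first by rewrite !mulr0 addr0.
move=> h /andP[xy ps]; rewrite !mulrDr addrACA lerD//.
  by apply: h => //; rewrite !inE eqxx ?orbT.
by apply: ih => // u v us vs; apply: h; rewrite inE ?us ?vs orbT.
Qed.

Lemma var_le_comp2 V W1 W2 p (g : R -> V) (h1 : R -> W1) (h2 : R -> W2) k1 k2 a b M1 M2 :
  0 <= k1 -> 0 <= k2 ->
  (forall u v, a <= u -> u <= v -> v <= b ->
     `|g v - g u| `^ p <= k1 * `|h1 v - h1 u| `^ p + k2 * `|h2 v - h2 u| `^ p) ->
  var_le p h1 a b M1 -> var_le p h2 a b M2 -> var_le p g a b (k1 * M1 + k2 * M2).
Proof.
move=> k10 k20 h H1 H2 x s ax ps lb.
apply: (@le_trans _ _ (k1 * vsum p h1 x s + k2 * vsum p h2 x s)).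
  apply: vsum_comp2 => // u v /(path_mem_le ps)/andP[xu _] /(path_mem_le ps)/andP[_ vl] uv.
  by apply: h => //; [exact: le_trans xu|exact: ltW|exact: le_trans lb].
by rewrite lerD// ler_wpM2l// ?H1// H2.
Qed.

Lemma var_leD V p (g h : R -> V) a b M1 M2 : 0 <= p ->
  var_le p g a b M1 -> var_le p h a b M2 ->
  var_le p (fun t => g t + h t) a b (2 `^ p * (M1 + M2)).
Proof.
move=> p0 H1 H2; rewrite mulrDr.
apply: (var_le_comp2 (powR_ge0 _ _) (powR_ge0 _ _) _ H1 H2) => u v _ _ _.
rewrite -mulrDr; apply: le_trans (powR_add_le p0 (normr_ge0 _) (normr_ge0 _)).
by apply: powR_le => //; rewrite opprD addrACA ler_normD.
Qed.

Lemma var_leN V p (g : R -> V) a b M :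
  var_le p g a b M -> var_le p (fun t => - g t) a b M.
Proof.
move=> h x s ax ps lb; suff -> : vsum p (fun t => - g t) x s = vsum p g x s by exact: h.
by elim: s x {ax ps lb} => //= y s ih x; rewrite -opprD normrN ih.
Qed.

Lemma var_leB V p (g h : R -> V) a b M1 M2 : 0 <= p ->
  var_le p g a b M1 -> var_le p h a b M2 ->
  var_le p (fun t => g t - h t) a b (2 `^ p * (M1 + M2)).
Proof. by move=> p0 H1 H2; apply: var_leD => //; exact: var_leN. Qed.

Lemma var_le_lip V W p (g : R -> V) (h : R -> W) k a b M : 0 <= p -> 0 <= k ->
  (forall u v, a <= u -> u <= v -> v <= b -> `|g v - g u| <= k * `|h v - h u|) ->
  var_le p h a b M -> var_le p g a b (k `^ p * M).
Proof.
move=> p0 k0 H hM; have := @var_le_comp2 _ _ _ p g h h (k `^ p) 0 a b M M.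
rewrite mul0r addr0; apply => //; first exact: powR_ge0.
by move=> u v au uv vb; rewrite mul0r addr0 -powRM// powR_le// H.
Qed.

Lemma var_le_cst V p (g : R -> V) a b : 0 < p -> (forall t, a <= t <= b -> g t = g a) ->
  var_le p g a b 0.
Proof.
move=> p0 h; apply: (@var_le_eq _ _ _ (cst (g a))) => [t /h->//|].
move=> x s _ _ _; elim: s x => //= y s ih x.
by rewrite subrr normr0 powR0 ?gt_eqF// add0r.
Qed.

Lemma var_le_mono p (k : R -> R) a b : 1 <= p ->
  (forall u v, a <= u -> u <= v -> v <= b -> k u <= k v) ->
  var_le p k a b (`|k b - k a| `^ p).
Proof.
move=> p1 hk x s ax ps lb; have p0 : 0 < p by exact: lt_le_trans p1.
have xl := path_le_last ps.
apply: (@le_trans _ _ (`|k (last x s) - k x| `^ p)).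
  apply: (@vsum_superadd _ _ p k (fun u v => `|k v - k u| `^ p) a b) => //.
  move=> u v w au uv vw wb.
  have k1 := hk u v au uv (le_trans vw wb); have k2 := hk v w (le_trans au uv) vw wb.
  apply: le_trans (powR_add_ge p1 (normr_ge0 _) (normr_ge0 _)) _.
  by apply: powR_le; [exact: ltW|exact: addr_ge0|rewrite !ger0_norm; lra].
have k1 := hk a x (lexx _) ax (le_trans xl lb).
have k2 := hk x _ ax xl lb; have k3 := hk _ b (le_trans ax xl) lb (lexx _).
by apply: powR_le => //; [exact: ltW|rewrite !ger0_norm; lra].
Qed.

End Variation2.

(** * Right-continuous paths of finite p-variation *)

Section Regularity.
Variables (R : realType).
Implicit Types (V : normedZmodType R) (p a b c t u v x y M T e : R) (s : seq R).

(** Epsilon-delta forms that look at [0, T] only, because the values of a path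
    outside that interval carry no meaning. *)
Definition rcont V T (g : R -> V) := forall t, 0 <= t -> t < T -> forall e, 0 < e ->
  exists2 d, 0 < d & forall u, t <= u -> u < t + d -> u <= T -> `|g u - g t| < e.

Definition llim V T (g : R -> V) := forall t, 0 < t -> t <= T -> forall e, 0 < e ->
  exists u, [/\ 0 <= u, u < t & forall v w, u <= v -> v < t -> u <= w -> w < t -> `|g v - g w| < e].

(** P r t speaks of the half-open interval [r, t[, so that a jump at t is no
    obstacle: the hypothesis on the left of t reaches the supremum of the times
    where Q holds, and the hypothesis on the right passes it. *)
Lemma real_induction T (Q : R -> Prop) (P : R -> R -> Prop) : 0 <= T ->
  Q 0 ->
  (forall t, 0 <= t -> t < T -> exists v, [/\ t < v, v <= T & P t v]) ->
  (forall t, 0 < t -> t <= T -> exists u, [/\ 0 <= u, u < t & forall v, u <= v -> v < t -> P v t]) ->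
  (forall r t : R, 0 <= r -> r < t -> t <= T -> P r t -> Q r -> Q t) ->
  Q T.
Proof.
move=> T0 Q0 Pr Pl step.
pose S := [set t | 0 <= t <= T /\ Q t].
have S0 : S 0 by split=> //; rewrite lexx.
have hS : has_sup S by split; [exists 0|exists T => t [/andP[]]].
have c0 : 0 <= sup S by apply: (ub_le_sup hS.2).
have cT : sup S <= T by apply: (ge_sup hS.1) => t [/andP[]].
have Qc : Q (sup S).
  move: c0; rewrite le_eqVlt => /predU1P[<-//|c0].
  have [u [u0 uc uP]] := Pl _ c0 cT.
  have cu : 0 < sup S - u by rewrite subr_gt0.
  have [t [/andP[t0 tT] Qt]] := sup_adherent cu hS; rewrite subKr => ut.
  have := ub_le_sup hS.2 (conj (introT andP (conj t0 tT)) Qt).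
  rewrite le_eqVlt => /predU1P[<-//|tc].
  by apply: (step t) => //; apply: uP => //; exact: ltW.
move: cT; rewrite le_eqVlt => /predU1P[<-//|cT].
have [v [cv vT cP]] := Pr _ c0 cT.
have Sv : S v by split; [rewrite vT (le_trans c0)// ltW|exact: (step (sup S))].
by have := ub_le_sup hS.2 Sv; rewrite leNgt cv.
Qed.

(** Where phi is constant the chain has repeated images; dropping them costs
    nothing as they contribute zero increments. *)
Lemma vsum_reparam V p (g : R -> V) (phi : R -> R) x s : 0 < p ->
  {homo phi : u v / u <= v} -> path <%R x s ->
  exists s2, [/\ path <%R (phi x) s2, last (phi x) s2 = phi (last x s) &
    vsum p (g \o phi) x s = vsum p g (phi x) s2].
Proof.
move=> p0 phiM; elim: s x => [|y s ih] x /=; first by exists [::].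
move=> /andP[xy /ih[s2 [ps2 l2 ->]]].
have := phiM _ _ (ltW xy); rewrite le_eqVlt => /predU1P[pe|pxy].
  exists s2; rewrite pe; split => //.
  by rewrite subrr normr0 powR0 ?gt_eqF// add0r.
by exists (phi y :: s2) => /=; rewrite pxy.
Qed.

Lemma var_le_minr V p (g : R -> V) a b v M : 0 < p -> a <= v ->
  var_le p g a v M -> var_le p (fun t => g (Num.min t v)) a b M.
Proof.
move=> p0 av h x s ax ps lb.
have mm : {homo (fun t => Num.min t v) : u w / u <= w}.
  by move=> u w uw; rewrite le_min !ge_min uw lexx orbT.
have [s2 [ps2 l2 ->]] := vsum_reparam g p0 mm ps.
by apply: h => //; rewrite ?le_min ?ax// l2 ge_min lexx orbT.
Qed.

Lemma var_le_maxr V p (g : R -> V) a b c M : 0 < p -> c <= b ->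
  var_le p g c b M -> var_le p (fun t => g (Num.max t c)) a b M.
Proof.
move=> p0 cb h x s ax ps lb.
have mm : {homo (fun t => Num.max t c) : u w / u <= w}.
  by move=> u w uw; rewrite ge_max !le_max uw lexx orbT.
have [s2 [ps2 l2 ->]] := vsum_reparam g p0 mm ps.
by apply: h => //; rewrite ?le_max ?lexx ?orbT// l2 ge_max lb.
Qed.

Lemma vsum_close V p (g : R -> V) x s e : 0 < p -> 0 < e ->
  exists2 d, 0 < d & forall h : R -> V, (forall z, z \in x :: s -> `|h z - g z| < d) ->
    `|vsum p h x s - vsum p g x s| < e.
Proof.
move=> p0; elim: s x e => [|y s ih] x e e0.
  by exists 1 => // h _; rewrite /= subrr normr0.
have e20 : 0 < e / 2 by rewrite divr_gt0.
have [d1 d10 h1] := ih y _ e20.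
have [d2 d20 h2] := powR_cont p0 (normr_ge0 (g y - g x)) e20.
exists (Num.min d1 (d2 / 2)); first by rewrite lt_min d10 divr_gt0.
move=> h hh /=; rewrite opprD addrACA; apply: le_lt_trans (ler_normD _ _) _.
rewrite [ltRHS]splitr ltrD//.
- apply: h2 => //; apply: le_lt_trans (ler_dist_dist _ _) _.
  rewrite subrACA.
  apply: le_lt_trans (ler_normB _ _) _; rewrite [ltRHS]splitr ltrD//.
    have /hh : y \in [:: x, y & s] by rewrite !inE eqxx orbT.
    by rewrite lt_min => /andP[].
  have /hh : x \in [:: x, y & s] by rewrite !inE eqxx.
  by rewrite lt_min => /andP[].
- apply: h1 => z zs; have /hh : z \in [:: x, y & s] by rewrite in_cons zs orbT.
  by rewrite lt_min => /andP[].
Qed.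

(** Lower semicontinuity: a chain sees finitely many values, so each sum passes
    to the limit. *)
Lemma var_le_lsc V p (g : R -> V) a b M : 0 < p ->
  (forall e, 0 < e -> exists2 h, var_le p h a b M & forall z, a <= z <= b -> `|h z - g z| < e) ->
  var_le p g a b M.
Proof.
move=> p0 H x s ax ps lb; apply/ler_addgt0Pr => e e0.
have [d d0 hd] := vsum_close g x s p0 e0.
have [h hM hg] := H _ d0.
have /hd : forall z, z \in x :: s -> `|h z - g z| < d.
  move=> z /(path_mem_le ps)/andP[xz zl]; apply: hg.
  by rewrite (le_trans ax)//= (le_trans zl).
by rewrite ltr_distl => /andP[+ _]; have := hM x s ax ps lb; lra.
Qed.

(** A nearly optimal chain among those that stop before t leaves almost no
    variation between its last point and t. *)
Lemma finvar_left V p (g : R -> V) a t e : a < t -> finvar p g a t -> 0 < e ->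
  exists u, [/\ a <= u, u < t & forall v, v < t -> var_le p g u v e].
Proof.
move=> at_ [M hM] e0.
pose S := [set r | exists x s, [/\ a <= x, path <%R x s, last x s < t & r = vsum p g x s]].
have hS : has_sup S.
  split; first by exists 0, a, [::]; split.
  by exists M => _ [x [s [ax ps lt ->]]]; apply: hM => //; exact: ltW.
have [_ [x [s [ax ps lt ->]]] h] := sup_adherent e0 hS.
exists (last x s); split => //; first by rewrite (le_trans ax)// path_le_last.
move=> v vt y s' ly ps' lv.
have [s2 [ps2 l2 h2]] := vsum_join p g ps ly ps'.
have : vsum p g x s2 <= sup S.
  by apply: (ub_le_sup hS.2); exists x, s2; split => //; rewrite l2 (le_lt_trans lv).
move: h h2; lra.
Qed.

(** A nearly optimal chain in ]t, T] leaves almost no variation between t,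
    excluded, and its first point; right-continuity then lets a chain start at t
    itself. *)
Lemma finvar_right V p (g : R -> V) T t e : 0 < p -> rcont T g -> 0 <= t -> t < T ->
  finvar p g t T -> 0 < e ->
  exists u, [/\ t < u, u <= T & var_le p g t u e].
Proof.
move=> p0 rg t0 tT [M hM] e0.
pose S := [set r | exists x s, [/\ t < x, path <%R x s, last x s <= T & r = vsum p g x s]].
have hS : has_sup S.
  split; first by exists 0, T, [::]; split => /=.
  by exists M => _ [x [s [ax ps lt ->]]]; apply: hM => //; exact: ltW.
have [_ [x [s [tx ps lT ->]]] h] := sup_adherent e0 hS.
exists x; split => //; first by rewrite (le_trans (path_le_last ps)).
have H y s' : t < y -> path <%R y s' -> last y s' <= x -> vsum p g y s' <= e.
  move=> ty ps' lx.
  have [s2 [ps2 l2 h2]] := vsum_join p g ps' lx ps.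
  have : vsum p g y s2 <= sup S by apply: (ub_le_sup hS.2); exists y, s2; rewrite l2.
  by move: h h2; lra.
move=> y s'; rewrite le_eqVlt => /predU1P[<-|]; last exact: H.
case: s' => [_ _|z s' /= /andP[tz ps'] lx]; first exact: ltW.
apply/ler_addgt0Pr => e' e'0.
have [d d0 hd] := powR_cont p0 (normr_ge0 (g z - g t)) e'0.
have [d' d'0 hd'] := rg t t0 tT _ d0.
pose w := Num.min ((t + z) / 2) (t + d' / 2).
have tw : t < w by rewrite lt_min; apply/andP; split; lra.
have wz : w < z by rewrite gt_min; apply/orP; left; lra.
have wd : w < t + d' by rewrite gt_min; apply/orP; right; lra.
have zT : z <= T by rewrite (le_trans (path_le_last ps'))// (le_trans lx)// (le_trans (path_le_last ps)).
have := hd' w (ltW tw) wd (ltW (lt_le_trans wz zT)) => hw.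
have := H w (z :: s') tw; rewrite /= wz => /(_ ps' lx) Hw.
have : `| `|g z - g w| `^ p - `|g z - g t| `^ p| < e'.
  apply: hd => //; apply: le_lt_trans (ler_dist_dist _ _) _.
  by rewrite subrACA subrr sub0r normrN.
rewrite ltr_distl => /andP[+ _]; move: Hw; set A := _ `^ p; set B := _ `^ p; lra.
Qed.

(** Left limits come for free from finite p-variation; only right-continuity has
    to be carried along. *)
Lemma finvar_llim V p (g : R -> V) T : 0 < p -> finvar p g 0 T -> llim T g.
Proof.
move=> p0 hg t t0 tT e e0.
have e20 : 0 < (e / 2) `^ p by rewrite powR_gt0// divr_gt0.
have [u [u0 ut hu]] := finvar_left t0 (finvar_sub (lexx _) tT hg) e20.
have H v w : u <= v -> v <= w -> w < t -> `|g w - g v| < e.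
  move=> uv vw wt; have := var_le_incr (hu w wt) uv vw (lexx _) p0.
  move=> /(powR_le_inv p0 (normr_ge0 _) (powR_ge0 _ _)).
  rewrite powRK ?gt_eqF//; last by rewrite divr_ge0 ?ltW.
  by move=> /le_lt_trans; apply; lra.
exists u; split => // v w uv vt uw wt.
by have [vw|/ltW vw] := leP v w; [rewrite distrC|]; apply: H.
Qed.

Lemma finvar_bounded V p (g : R -> V) T : 0 < p -> finvar p g 0 T ->
  exists2 N, 0 <= N & forall t, 0 <= t <= T -> `|g t| <= N.
Proof.
move=> p0 [M hM]; exists (`|g 0| + `|M| `^ p^-1); first by rewrite addr_ge0 ?powR_ge0.
move=> t /andP[t0 tT].
have := var_le_incr hM (lexx _) t0 tT p0.
move=> /le_trans/(_ (ler_norm M))/(powR_le_inv p0 (normr_ge0 _) (normr_ge0 _)) h.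
rewrite -[in leLHS](subrK (g 0) (g t)) addrC (le_trans (ler_normD _ _))// lerD2l//.
Qed.

End Regularity.

(** * Young's inequality for Riemann sums *)

Section MatrixNorm.
Variable R : realType.

Lemma mx_entry_le m n (M : 'M[R]_(m, n)) i j : `|M i j| <= `|M|.
Proof.
rewrite [leRHS]/Num.Def.normr/= mx_normrE; apply/bigmax_geP; right => /=; by exists (i, j).
Qed.

Lemma mx_norm_le m n (M : 'M[R]_(m, n)) c : 0 <= c ->
  (forall i j, `|M i j| <= c) -> `|M| <= c.
Proof.
move=> c0 h; rewrite [leLHS]/Num.Def.normr/= mx_normrE; by apply/bigmax_leP.
Qed.

Lemma mulmx_norm_le m n k (M : 'M[R]_(m, n)) (N : 'M[R]_(n, k)) :
  `|M *m N| <= n%:R * (`|M| * `|N|).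
Proof.
apply: mx_norm_le => [|i j]; first by rewrite !mulr_ge0.
rewrite mxE (le_trans (ler_norm_sum _ _ _))//.
have -> : n%:R * (`|M| * `|N|) = \sum_(k < n) (`|M| * `|N|).
  by rewrite sumr_const card_ord mulr_natl.
by apply: ler_sum => l _; rewrite normrM ler_pM// mx_entry_le.
Qed.

End MatrixNorm.

Section Young.
Variables (R : realType) (n d : nat).
Implicit Types (H : R -> 'M[R]_(n, d)) (A : R -> 'cV[R]_d).
Implicit Types (p q a b c t u v x y T e : R) (s : seq R).

Fixpoint rsum H A x s : 'cV[R]_n :=
  if s is y :: s' then H x *m (A y - A x) + rsum H A y s' else 0.

Lemma rsum_cat H A x s1 s2 :
  rsum H A x (s1 ++ s2) = rsum H A x s1 + rsum H A (last x s1) s2.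
Proof. by elim: s1 x => [|y s1 ih] x /=; rewrite ?add0r// ih addrA. Qed.

Definition superadd (w : R -> R -> R) a b :=
  (forall u v, a <= u -> u <= v -> v <= b -> 0 <= w u v) /\
  (forall u v t, a <= u -> u <= v -> v <= t -> t <= b -> w u v + w v t <= w u t).

Lemma superadd_sub w a b a' b' : a <= a' -> b' <= b ->
  superadd w a b -> superadd w a' b'.
Proof.
move=> aa bb [w0 w2]; split => [u v au uv vb|u v t au uv vt tb].
  by apply: w0 => //; [exact: le_trans au|exact: le_trans bb].
by apply: w2 => //; [exact: le_trans au|exact: le_trans bb].
Qed.

Lemma superadd_diag w a b u : superadd w a b -> a <= u -> u <= b -> w u u = 0.
Proof.
move=> [w0 w2] au ub; apply/eqP; rewrite eq_le w0// andbT.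
by rewrite -(lerD2l (w u u)) addr0 w2.
Qed.

Lemma superadd_powR w a b r : 1 <= r -> superadd w a b ->
  superadd (fun u v => w u v `^ r) a b.
Proof.
move=> r1 [w0 w2]; split => [u v *|u v t au uv vt tb]; first exact: powR_ge0.
have uvb : v <= b := le_trans vt tb; have av : a <= v := le_trans au uv.
have w1 : 0 <= w u v by exact: w0.
have w3 : 0 <= w v t by exact: w0.
apply: le_trans (powR_add_ge r1 w1 w3) _; apply: powR_le; last exact: w2.
- by rewrite (le_trans _ r1).
- exact: addr_ge0.
Qed.

(** The cut is the first point where w exceeds half of its total; superadditivity
    leaves at most the other half beyond it. *)
Lemma superadd_split w a b x s : superadd w a b -> a <= x -> last x s <= b ->
  path <%R x s -> s != [::] ->
  exists s1 y s2, [/\ s = s1 ++ y :: s2, w x (last x s1) <= w x (last x s) / 2 &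
    w y (last y s2) <= w x (last x s) / 2].
Proof.
move=> sw ax lb ps s0; have [w0 w2] := sw.
have xb := le_trans (path_le_last ps) lb.
have wxx : w x x = 0 := superadd_diag sw ax xb.
have [W WE] : exists W, W = w x (last x s) by eexists.
have W0 : 0 <= W by rewrite WE; apply: w0 => //; exact: path_le_last.
rewrite -WE; case: (boolP (has (fun z => W / 2 < w x z) s)) => hs.
  move: hs ps lb WE; case/split_find => y s1 s2 wy ns1.
  rewrite cat_rcons cat_path last_cat /= => /and3P[ps1 l1 ps2] lb WE.
  exists s1, y, s2; split => //.
  - case: (lastP s1) ns1 => [_|s1' z /hasPn/(_ z)] /=; first by rewrite wxx divr_ge0.
    by rewrite last_rcons mem_rcons mem_head -leNgt; exact.
  - have yl := path_le_last ps2.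
    have xy : x <= y by rewrite (le_trans (path_le_last ps1))// ltW.
    by have := w2 x y _ ax xy yl lb; lra.
have W00 : W <= W / 2.
  rewrite leNgt; apply: contra hs => WW; apply/hasP; exists (last x s).
    by case: s s0 {ps lb WE} => //= y s _; exact: mem_last.
  by rewrite -WE.
case: s s0 ps lb WE {hs} => // y s _ /= /andP[xy ps] lb WE.
exists [::], y, s; split => //=; first by rewrite wxx divr_ge0.
have yl := path_le_last ps.
have := w2 x y _ ax (ltW xy) yl lb.
have := w0 x y ax (ltW xy) (le_trans yl lb).
by rewrite -WE; move: W00; lra.
Qed.

(** The fixed point of C = 2^(1 - th) C + 2, the recursion that bisection
    produces. *)
Definition young_cst (th : R) : R := 2 / (1 - 2 `^ (1 - th)).

Lemma young_cst_den th : 1 < th -> 0 < 1 - 2 `^ (1 - th) :> R.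
Proof.
move=> th1; rewrite subr_gt0 -[ltRHS](powRr0 2).
by rewrite /powR gt_eqF// ltr_expR mul0r nmulr_rlt0 ?subr_lt0// ln_gt0// ltr1n.
Qed.

Lemma young_cst_gt0 th : 1 < th -> 0 < young_cst th.
Proof. by move=> th1; rewrite divr_gt0 ?ltr0n ?young_cst_den. Qed.

Lemma young_cstE th : 1 < th -> 2 `^ (1 - th) * young_cst th + 2 = young_cst th.
Proof.
by move=> /young_cst_den h; rewrite /young_cst; field; rewrite gt_eqF.
Qed.

Lemma half_powR th x : 0 <= x -> 2 * (x / 2) `^ th = 2 `^ (1 - th) * x `^ th.
Proof.
move=> x0; rewrite powRM// ?invr_ge0//.
rewrite powRB; last by rewrite pnatr_eq0 implybT.
rewrite powRr1// -powR_inv1// -powRrM mulN1r powRN; ring.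
Qed.

(** Bisection in place of the removal of points: cut the chain by superadd_split.
    Each half carries at most half of w, so by induction on the number of points
    the two halves together cost 2^(1 - th) < 1 times the bound for the whole, and
    joining them again costs two products of increments. *)
Lemma young_maximal H A w th k a b x s : 1 < th -> 0 <= k -> superadd w a b ->
  (forall u r v, a <= u -> u <= r -> r <= v -> v <= b ->
     `|(H r - H u) *m (A v - A r)| <= k * w u v `^ th) ->
  a <= x -> path <%R x s -> last x s <= b ->
  `|rsum H A x s - H x *m (A (last x s) - A x)| <=
    k * young_cst th * w x (last x s) `^ th.
Proof.
move=> th1 k0 sw hk; have [m] := ubnP (size s).
have C0 := young_cst_gt0 th1.
elim: m s x => // m ih s x; rewrite ltnS => sm ax ps lb.
have [s0|s0] := eqVneq s [::].
  by rewrite s0/= subrr mulmx0 subr0 normr0; apply: mulr_ge0 (powR_ge0 _ _); apply: mulr_ge0 (ltW C0).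
have [s1 [y [s2 [Es w1 w2]]]] := superadd_split sw ax lb ps s0.
move: sm ps lb w1 w2; rewrite {}Es {s0} last_cat/= => sm.
rewrite cat_path/= => /and3P[ps1 zy ps2] lb w1 w2.
set z := last x s1 in zy w1 *; set l := last y s2 in lb w1 w2 *.
set W := w x l in w1 w2 *.
have xz : x <= z := path_le_last ps1.
have yl : y <= l := path_le_last ps2.
have yb := le_trans yl lb; have zb := le_trans (ltW zy) yb.
have az := le_trans ax xz; have ay := le_trans az (ltW zy).
have zl := le_trans (ltW zy) yl.
have W0 : 0 <= W by apply: sw.1 => //; exact: le_trans xz zl.
rewrite rsum_cat /= -/z.
have -> : rsum H A x s1 + (H z *m (A y - A z) + rsum H A y s2) - H x *m (A l - A x)
  = (rsum H A x s1 - H x *m (A z - A x)) + (rsum H A y s2 - H y *m (A l - A y))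
    + ((H z - H x) *m (A y - A z) + (H y - H x) *m (A l - A y)).
  rewrite !(mulmxBr, mulmxBl); apply/matrixP => i j; rewrite !mxE; ring.
have sz1 : (size s1 < m)%N.
  by apply: leq_trans sm; rewrite size_cat/= addnS ltnS leq_addr.
have sz2 : (size s2 < m)%N.
  by apply: leq_trans sm; rewrite size_cat/= addnS ltnS leq_addl.
have i1 := ih _ _ sz1 ax ps1 zb; rewrite -/z in i1.
have i2 := ih _ _ sz2 ay ps2 lb; rewrite -/l in i2.
have hw u v : x <= u -> u <= v -> v <= l -> w u v `^ th <= W `^ th.
  move=> xu uv vl; apply: powR_le; first by rewrite (le_trans _ (ltW th1)).
    by apply: sw.1 => //; [exact: le_trans xu|exact: le_trans lb].
  have au := le_trans ax xu; have vb := le_trans vl lb.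
  have e1 := sw.2 x u l ax xu (le_trans uv vl) lb.
  have e2 := sw.2 u v l au uv vl lb.
  have e3 := sw.1 x u ax xu (le_trans uv vb).
  have e4 := sw.1 v l (le_trans au uv) vl lb.
  by rewrite /W; lra.
have b1 := hk x z y ax xz (ltW zy) yb.
have b2 := hk x y l ax (le_trans xz (ltW zy)) yl lb.
have hp u v : 0 <= w u v -> w u v <= W / 2 -> w u v `^ th <= (W / 2) `^ th.
  by move=> *; apply: powR_le => //; rewrite (le_trans _ (ltW th1)).
have h1 : w x z `^ th <= (W / 2) `^ th by apply: hp => //; apply: sw.1.
have h2 : w y l `^ th <= (W / 2) `^ th by apply: hp => //; apply: sw.1.
have h3 : w x y `^ th <= W `^ th by apply: hw => //; exact: le_trans xz (ltW zy).
apply: le_trans (ler_normD _ _) _.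
have kC0 : 0 <= k * young_cst th by rewrite mulr_ge0// ltW.
have {}i1 := le_trans i1 (ler_wpM2l kC0 h1).
have {}i2 := le_trans i2 (ler_wpM2l kC0 h2).
have {}b1 := le_trans b1 (ler_wpM2l k0 h3).
apply: (@le_trans _ _ (k * young_cst th * (2 * (W / 2) `^ th) + k * (2 * W `^ th))).
  apply: lerD; (apply: le_trans (ler_normD _ _) _).
    by rewrite mulr2n mulrDl mul1r mulrDr lerD.
  by rewrite mulr2n mulrDl mul1r mulrDr lerD.
rewrite half_powR// -[X in _ <= k * X * _](young_cstE th1).
rewrite le_eqVlt; apply/orP; left; apply/eqP; ring.
Qed.

End Young.

(** * Riemann sums and the mesh *)

Section Mesh.
Variable R : realType.
Implicit Types (a b c t u v x y T e dl : R) (s P : seq R).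

(** A mesh below dl, phrased as a path predicate so that it splits along
    concatenations. *)
Definition finer dl x s := path (fun u v : R => v - u < dl) x s.

Lemma finer_le dl dl' x s : dl <= dl' -> finer dl x s -> finer dl' x s.
Proof. by move=> h; apply: sub_path => u v /lt_le_trans; exact. Qed.

Lemma finer_partition_ex a b dl : a <= b -> 0 < dl ->
  exists P, itv_partition a b P /\ finer dl a P.
Proof.
move=> ab d0.
pose Q t := exists P, [/\ path <%R a P, last a P = a + t & finer dl a P].
have [||t t0 tT|t t0 tT|r t r0 rt tT rtd [P [pP lP fP]]|P [pP lP fP]] :=
  @real_induction R (b - a) Q (fun r t => t - r < dl).
- by rewrite subr_ge0.
- by exists [::]; rewrite addr0.
- exists (Num.min (t + dl / 2) (b - a)); split.
  + by rewrite lt_min tT andbT ltrDl divr_gt0.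
  + by rewrite ge_min lexx orbT.
  + by rewrite ltrBlDl gt_min; apply/orP; left; rewrite ltrD2l; lra.
- exists (Num.max 0 (t - dl / 2)); split.
  + by rewrite le_max lexx.
  + by rewrite gt_max t0/=; lra.
  + by move=> v; rewrite ge_max => /andP[_ ?] _; lra.
- exists (rcons P (a + t)); rewrite rcons_path pP last_rcons lP ltrD2l rt; split => //.
  by rewrite /finer rcons_path [path _ _ _]fP lP; lra.
- by exists P; split => //; split => //; rewrite lP; apply/eqP; lra.
Qed.

Lemma mesh_lt_finer a b dl P : 0 < dl -> mesh a b P < dl <-> finer dl a P.
Proof.
move=> d0; elim: P a => [|y P ih] a.
  by rewrite /mesh big_geq.
rewrite /mesh /= big_nat_recl//= gt_max; split => [/andP[h /ih ->]|/andP[h /ih h']].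
  by rewrite andbT.
by apply/andP; split.
Qed.

Lemma itv_partition_le a b P : itv_partition a b P -> a <= b.
Proof. by move=> [/path_le_last + /eqP <-]. Qed.

#[global] Instance mesh_to0_filter a b : Filter (mesh_to0 a b).
Proof.
split.
- by exists 1.
- move=> S1 S2 [d1 d10 h1] [d2 d20 h2]; exists (Num.min d1 d2); first by rewrite lt_min d10.
  by move=> P hP; rewrite lt_min => /andP[? ?]; split; [exact: h1|exact: h2].
- by move=> S1 S2 S12 [d1 d10 h1]; exists d1 => // P hP /(h1 P hP)/S12.
Qed.

Lemma mesh_to0_proper a b : a <= b -> ProperFilter (mesh_to0 a b).
Proof.
move=> ab; apply: Build_ProperFilter => -[dl d0 h].
have [P [hP fP]] := finer_partition_ex ab d0.
by apply: (h P hP); apply/mesh_lt_finer.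
Qed.

End Mesh.

Section YoungIntegral.
Variables (R : realType) (n d : nat).
Implicit Types (H : R -> 'M[R]_(n, d)) (A : R -> 'cV[R]_d) (I : 'cV[R]_n).
Implicit Types (p q a b c t u v x y T e dl : R) (s P : seq R).

Lemma riemann_sumE H A a b P : riemann_sum H A a b P = rsum H A a P.
Proof.
elim: P a => [|y P ih] a; first by rewrite /riemann_sum big_geq.
by rewrite /riemann_sum /= big_nat_recl//= -ih.
Qed.

Lemma young_integralP H A a b I : is_young_integral H A a b I <->
  forall e, 0 < e -> exists2 dl, 0 < dl &
    forall P, itv_partition a b P -> finer dl a P -> `|rsum H A a P - I| < e.
Proof.
split => [/cvgrPdist_lt h e /h[dl d0 hd]|h].
  exists dl => // P hP fP; rewrite distrC -(riemann_sumE _ _ _ b).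
  by apply: hd => //; apply/mesh_lt_finer.
apply/cvgrPdist_lt => e /h[dl d0 hd]; exists dl => // P hP /mesh_lt_finer fP.
by rewrite distrC riemann_sumE; apply: hd => //; exact: fP.
Qed.

Lemma young_integral_unique H A a b I I' : a <= b ->
  is_young_integral H A a b I -> is_young_integral H A a b I' -> I = I'.
Proof.
move=> ab h h'; have PF := mesh_to0_proper ab.
by apply: (@cvg_unique _ _ (riemann_sum H A a b P @[P --> mesh_to0 a b])).
Qed.

Lemma rsum_eq H H' A A' x s :
  (forall u, x <= u -> u < last x s -> H u = H' u) ->
  (forall u, x <= u -> u <= last x s -> A u = A' u) ->
  path <%R x s -> rsum H A x s = rsum H' A' x s.
Proof.
elim: s x => //= y s ih x hH hA /andP[xy ps]; have yl := path_le_last ps.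
rewrite hH ?(lt_le_trans xy)// !hA ?(ltW xy)// ?(le_trans (ltW xy))//.
rewrite (ih y)// => u yu ul; [apply: hH|apply: hA] => //; exact: le_trans (ltW xy) yu.
Qed.

Lemma young_integral_eq H H' A A' a b I :
  (forall u, a <= u -> u < b -> H u = H' u) ->
  (forall u, a <= u -> u <= b -> A u = A' u) ->
  is_young_integral H A a b I -> is_young_integral H' A' a b I.
Proof.
move=> hH hA /young_integralP h; apply/young_integralP => e /h[dl d0 hd].
exists dl => // P hP; have [pP /eqP lP] := hP.
by rewrite -(@rsum_eq H H' A A') ?lP//; exact: hd.
Qed.

Lemma rsum_subH H H' A x s :
  rsum (fun u => H u - H' u) A x s = rsum H A x s - rsum H' A x s.
Proof.
elim: s x => [|y s ih] x /=; first by rewrite subrr.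
by rewrite ih mulmxBl opprD addrACA.
Qed.

Lemma young_integralB H H' A a b I I' :
  is_young_integral H A a b I -> is_young_integral H' A a b I' ->
  is_young_integral (fun u => H u - H' u) A a b (I - I').
Proof.
move=> /young_integralP h /young_integralP h'; apply/young_integralP => e e0.
have e20 : 0 < e / 2 by rewrite divr_gt0.
have [dl d0 hd] := h _ e20; have [dl' d'0 hd'] := h' _ e20.
exists (Num.min dl dl'); first by rewrite lt_min d0.
move=> P hP fP; rewrite rsum_subH subrACA (le_lt_trans (ler_normB _ _))//.
rewrite [ltRHS]splitr ltrD//; [apply: hd|apply: hd'] => //;
  by apply: finer_le fP; rewrite ge_min lexx ?orbT.
Qed.

Lemma young_integral_add H A a b c I1 I2 I : a <= b -> b <= c ->
  is_young_integral H A a b I1 -> is_young_integral H A b c I2 ->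
  is_young_integral H A a c I -> I = I1 + I2.
Proof.
move=> ab bc /young_integralP h1 /young_integralP h2 /young_integralP h.
apply/eqP; rewrite -subr_eq0 -normr_le0; apply/ler_addgt0Pr => e e0; rewrite add0r.
have e30 : 0 < e / 3 by rewrite divr_gt0.
have [d1 d10 H1] := h1 _ e30; have [d2 d20 H2] := h2 _ e30.
have [d3 d30 H3] := h _ e30.
pose dl := Num.min d1 (Num.min d2 d3).
have dl0 : 0 < dl by rewrite !lt_min d10 d20.
have [P1 [hP1 f1]] := finer_partition_ex ab dl0.
have [P2 [hP2 f2]] := finer_partition_ex bc dl0.
have [p1 /eqP l1] := hP1; have [p2 /eqP l2] := hP2.
have hP : itv_partition a c (P1 ++ P2).
  by split; rewrite ?cat_path ?last_cat l1 ?p1 ?p2 ?l2.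
have f3 : finer dl a (P1 ++ P2) by rewrite /finer cat_path l1 [path _ _ P1]f1.
have e1 : `|rsum H A a P1 - I1| < e / 3.
  by apply: H1 => //; apply: finer_le f1; rewrite ge_min lexx.
have e2 : `|rsum H A b P2 - I2| < e / 3.
  by apply: H2 => //; apply: finer_le f2; rewrite !ge_min lexx orbT.
have e3 : `|rsum H A a (P1 ++ P2) - I| < e / 3.
  by apply: H3 => //; apply: finer_le f3; rewrite !ge_min lexx !orbT.
have -> : I - (I1 + I2) = (rsum H A a P1 - I1) + (rsum H A b P2 - I2)
                          - (rsum H A a (P1 ++ P2) - I).
  rewrite rsum_cat l1; apply/matrixP => i j; rewrite !mxE; ring.
apply: le_trans (ler_normB _ _) _.
have := ler_normD (rsum H A a P1 - I1) (rsum H A b P2 - I2).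
by move: e1 e2 e3; set x1 := `|_|; set x2 := `|_|; set x3 := `|_|; set x4 := `|_|; lra.
Qed.

(** Inside each interval of the coarser partition the refined sum differs from a
    single term by at most w, and these bounds add up. *)
Lemma rsum_refine H A (w : R -> R -> R) a b x P Q dl :
  superadd w a b ->
  (forall u s, a <= u -> path <%R u s -> last u s <= b -> last u s - u < dl ->
     `|rsum H A u s - H u *m (A (last u s) - A u)| <= w u (last u s)) ->
  a <= x -> last x P <= b -> path <%R x P -> finer dl x P ->
  path <%R x Q -> {subset P <= Q} -> last x Q = last x P ->
  `|rsum H A x Q - rsum H A x P| <= w x (last x P).
Proof.
move=> sw hw; elim: P x Q => [|y P ih] x Q ax lb.
  move=> _ _ pQ _ /= lQ; case: Q pQ lQ => [|z Q /= /andP[xz pQ] lQ].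
    by rewrite subrr normr0 => _ _; apply: sw.1.
  by have := path_le_last pQ; rewrite lQ leNgt xz.
move=> /= /andP[xy pP] /andP[fy fP] pQ sPQ; have yQ := sPQ y (mem_head _ _).
have yl := path_le_last pP; have yb := le_trans yl lb; have ay := le_trans ax (ltW xy).
case/splitPr: yQ pQ sPQ => Q1 Q2; rewrite cat_path last_cat /= => /and3P[p1 l1 p2] sPQ lQ.
have s2 : {subset P <= Q2}.
  move=> z zP; have yz : y < z by move/(order_path_min lt_trans)/allP: pP => /(_ z zP).
  have /sPQ : z \in y :: P by rewrite inE zP orbT.
  rewrite mem_cat inE => /or3P[zQ1|/eqP zy|//].
    have : z <= last x Q1.
      have zx : z \in x :: Q1 by rewrite inE zQ1 orbT.
      by have /andP[] := path_mem_le p1 zx.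
    by move=> /le_lt_trans/(_ l1); rewrite ltNge (ltW yz).
  by move: yz; rewrite zy ltxx.
have i2 := ih y Q2 ay lb pP fP p2 s2 lQ.
have p1' : path <%R x (rcons Q1 y) by rewrite rcons_path p1.
have := hw x (rcons Q1 y) ax p1'; rewrite last_rcons => /(_ yb fy).
have -> : rsum H A x (rcons Q1 y) = rsum H A x Q1 + H (last x Q1) *m (A y - A (last x Q1)).
  by rewrite -cats1 rsum_cat /= addr0.
move=> i1.
rewrite rsum_cat /=.
have -> : rsum H A x Q1 + (H (last x Q1) *m (A y - A (last x Q1)) + rsum H A y Q2) -
    (H x *m (A y - A x) + rsum H A y P) =
    (rsum H A x Q1 + H (last x Q1) *m (A y - A (last x Q1)) - H x *m (A y - A x)) +
    (rsum H A y Q2 - rsum H A y P).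
  by apply/matrixP => i j; rewrite !mxE; ring.
apply: le_trans (ler_normD _ _) _; apply: le_trans (lerD i1 i2) _.
by apply: sw.2 => //; exact: ltW.
Qed.

End YoungIntegral.

Section CommonRefinement.
Variable R : realType.

Lemma common_refinement (a b : R) (P Q : seq R) :
  itv_partition a b P -> itv_partition a b Q ->
  exists S, [/\ itv_partition a b S, {subset P <= S} & {subset Q <= S}].
Proof.
move=> hP hQ; have [pP /eqP lP] := hP; have [pQ /eqP lQ] := hQ.
pose S := sort <=%R (undup (P ++ Q)).
have memS z : (z \in S) = (z \in P) || (z \in Q).
  by rewrite mem_sort mem_undup mem_cat.
have pS : path <%R a S.
  rewrite lt_path_sortedE sort_lt_sorted undup_uniq andbT; apply/allP => z.
  by rewrite memS => /orP[]; [have /allP := order_path_min lt_trans pP|have /allP := order_path_min lt_trans pQ]; exact.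
exists S; split => [|z zP|z zQ]; rewrite ?memS ?zP ?zQ ?orbT//.
split => //; rewrite eq_le; apply/andP; split.
  have := mem_last a S; rewrite inE memS => /or3P[/eqP ->|zP|zQ].
  - by rewrite -lP path_le_last.
  - have zx : last a S \in a :: P by rewrite inE zP orbT.
    by have := path_mem_le pP zx; rewrite lP => /andP[].
  - have zx : last a S \in a :: Q by rewrite inE zQ orbT.
    by have := path_mem_le pQ zx; rewrite lQ => /andP[].
have bS : b \in a :: S.
  by have := mem_last a P; rewrite lP !inE memS => /orP[->//|->]; rewrite orbT.
by have /andP[] := path_mem_le pS bS.
Qed.

End CommonRefinement.

(** * Existence of the Young integral *)

Section Oscillation.
Variable R : realType.
Implicit Types (V W : normedZmodType R) (T e t u v r : R).

Definition regulated V T (g : R -> V) := [/\ rcont T g, llim T g &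
  exists2 N, 0 <= N & forall t, 0 <= t <= T -> `|g t| <= N].

Lemma finvar_regulated V p T (g : R -> V) : 0 < p -> rcont T g -> finvar p g 0 T ->
  regulated T g.
Proof.
by move=> p0 rg fg; split => //; [exact: finvar_llim fg|exact: finvar_bounded fg].
Qed.

(** When a short interval contains a jump of both paths, its middle point r lies
    either before the jump, where H has hardly moved yet, or after it, where A
    hardly moves any more.  This is why left-point sums converge along the mesh
    even when H and A jump together. *)
Lemma regulated_product V W T (H : R -> V) (A : R -> W) e : 0 <= T ->
  regulated T H -> regulated T A -> 0 < e ->
  exists2 dl, 0 < dl & forall u r v, 0 <= u -> u <= r -> r <= v -> v <= T ->
    v - u < dl -> `|H r - H u| * `|A v - A r| <= e.
Proof.
move=> T0 [rH lH [NH NH0 bH]] [rA lA [NA NA0 bA]] e0.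
pose e1 := e / (2 * NA + 1); pose e2 := e / (2 * NH + 1).
have dA : 0 < 2 * NA + 1 by lra.
have dH : 0 < 2 * NH + 1 by lra.
have e10 : 0 < e1 by rewrite divr_gt0.
have e20 : 0 < e2 by rewrite divr_gt0.
have hH x y : 0 <= x <= T -> 0 <= y <= T -> `|H y - H x| <= 2 * NH.
  move=> /bH hx /bH hy; apply: le_trans (ler_normB _ _) _; lra.
have hA x y : 0 <= x <= T -> 0 <= y <= T -> `|A y - A x| <= 2 * NA.
  move=> /bA hx /bA hy; apply: le_trans (ler_normB _ _) _; lra.
have p1 x y : x <= e1 -> 0 <= y -> y <= 2 * NA -> 0 <= x -> x * y <= e.
  move=> xe y0 yN x0; have -> : e = e1 * (2 * NA + 1) by rewrite mulfVK ?gt_eqF.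
  by apply: ler_pM => //; lra.
have p2 x y : x <= 2 * NH -> 0 <= y -> y <= e2 -> 0 <= x -> x * y <= e.
  move=> xe y0 yN x0; have -> : e = (2 * NH + 1) * e2 by rewrite mulrC mulfVK ?gt_eqF.
  by apply: ler_pM => //; lra.
pose P s t := forall x y, s <= x -> x < t -> s <= y -> y < t ->
  `|H y - H x| <= e1 /\ `|A y - A x| <= e2.
(* The second clause of Q remembers that H oscillates little just before t; it is
   needed for the intervals that straddle t with their middle point before t. *)
pose Q t := exists dl, [/\ 0 < dl, (forall u r v, 0 <= u -> u <= r -> r <= v -> v <= t ->
    v - u < dl -> `|H r - H u| * `|A v - A r| <= e) &
    forall u r, 0 <= u -> u <= r -> r < t -> t - u < dl -> `|H r - H u| <= e1].
suff [dl [dl0 h _]] : Q T by exists dl.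
apply: (@real_induction R T Q P) => //.
- exists 1; split => // [u r v u0 ur rv v0 _|u r u0 ur r0].
    have -> : r = u by apply/eqP; rewrite eq_le ur; lra.
    by rewrite subrr normr0 mul0r ltW.
  by have := le_lt_trans ur r0; rewrite ltNge u0.
- move=> t t0 tT.
  have [d1 d10 h1] := rH t t0 tT _ (divr_gt0 e10 (ltr0Sn _ 1)).
  have [d2 d20 h2] := rA t t0 tT _ (divr_gt0 e20 (ltr0Sn _ 1)).
  pose v := Num.min (t + d1) (Num.min (t + d2) T).
  exists v; split; [by rewrite !lt_min tT; lra|by rewrite !ge_min lexx !orbT|].
  move=> x y tx xv ty yv.
  move: xv yv; rewrite !lt_min => /and3P[x1 x2 x3] /and3P[y1 y2 y3].
  have a1 := h1 x tx x1 (ltW x3); have a2 := h2 x tx x2 (ltW x3).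
  have b1 := h1 y ty y1 (ltW y3); have b2 := h2 y ty y2 (ltW y3).
  split.
  + apply: le_trans (ler_distD (H t) _ _) _; move: a1 b1; rewrite [`|H t - _|]distrC.
    by set z1 := `|_|; set z2 := `|_|; lra.
  + apply: le_trans (ler_distD (A t) _ _) _; move: a2 b2; rewrite [`|A t - _|]distrC.
    by set z1 := `|_|; set z2 := `|_|; lra.
- move=> t t0 tT.
  have [u1 [u10 ut1 h1]] := lH t t0 tT _ e10.
  have [u2 [u20 ut2 h2]] := lA t t0 tT _ e20.
  exists (Num.max u1 u2); split; [by rewrite le_max u10|by rewrite gt_max ut1|].
  move=> v; rewrite ge_max => /andP[uv1 uv2] vt x y vx xt vy yt; split; apply: ltW.
    by apply: h1 => //; [exact: le_trans vy|exact: le_trans vx].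
  by apply: h2 => //; [exact: le_trans vy|exact: le_trans vx].
- move=> s t s0 st tT Pst [dl [dl0 h1 h2]].
  exists (Num.min dl (t - s)); split; first by rewrite lt_min dl0 subr_gt0.
    move=> u r v u0 ur rv vt; rewrite lt_min => /andP[vu1 vu2].
    have rT : r <= T by rewrite (le_trans rv)// (le_trans vt).
    have vT : v <= T by rewrite (le_trans vt).
    have r0 : 0 <= r by exact: le_trans ur.
    have v0 : 0 <= v by exact: le_trans rv.
    have uT : u <= T by rewrite (le_trans ur).
    have [vs|sv] := leP v s; first exact: h1.
    have [su|us] := leP s u.
      have [tr|rt] := leP t r.
        have -> : r = v by apply/eqP; rewrite eq_le rv (le_trans vt).
        by rewrite subrr normr0 mulr0 ltW.
      have [a _] := Pst u r su (le_lt_trans ur rt) (le_trans su ur) rt.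
      by apply: p1 => //; apply: hA; apply/andP.
    have vt' : v < t by lra.
    have [sr|rs] := leP s r.
      have [_ a] := Pst r v sr (le_lt_trans rv vt') (ltW sv) vt'.
      by apply: p2 => //; apply: hH; apply/andP.
    apply: p1 => //; last by apply: hA; apply/andP.
    by apply: h2 => //; lra.
  move=> u r u0 ur rt; rewrite lt_min => /andP[tu1 tu2].
  have su : s <= u by lra.
  by have [] := Pst u r su (le_lt_trans ur rt) (le_trans su ur) rt.
Qed.

End Oscillation.

Section YoungExistence.
Variables (R : realType) (n d : nat) (p q T : R).
Hypotheses (p1 : 1 <= p) (q1 : 1 <= q) (pq : 1 < p^-1 + q^-1) (T0 : 0 <= T).
Implicit Types (H : R -> 'M[R]_(n, d)) (A : R -> 'cV[R]_d) (I : 'cV[R]_n).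
Implicit Types (a b c t u v x y e dl : R) (s P : seq R).

Let th := p^-1 + q^-1.
Let al := p^-1 / th.
Let p0 : 0 < p. Proof. exact: lt_le_trans p1. Qed.
Let q0 : 0 < q. Proof. exact: lt_le_trans q1. Qed.
Let pV0 : 0 < p^-1. Proof. by rewrite invr_gt0. Qed.
Let qV0 : 0 < q^-1. Proof. by rewrite invr_gt0. Qed.
Let th0 : 0 < th. Proof. exact: addr_gt0. Qed.
Let al0 : 0 < al. Proof. exact: divr_gt0. Qed.
Let alC : 1 - al = q^-1 / th.
Proof. by rewrite /al -{1}(divff (lt0r_neq0 th0)) -mulrBl /th addrC addKr. Qed.
Let alC0 : 0 < 1 - al. Proof. by rewrite alC divr_gt0. Qed.

(** The exponents al and 1 - al sum to 1, so that Hoelder's inequality makes this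
    superadditive, and its power th = 1/p + 1/q is the product of the p-variation
    norm of H and the q-variation norm of A. *)
Definition young_ctrl H A u v := var p H u v `^ al * var q A u v `^ (1 - al).

Lemma young_ctrl_powR H A u v : finvar p H u v -> finvar q A u v -> u <= v ->
  young_ctrl H A u v `^ th = var p H u v `^ p^-1 * var q A u v `^ q^-1.
Proof.
move=> fH fA uv; rewrite powRM ?powR_ge0// -!powRrM alC /al !divfK ?gt_eqF//.
Qed.

Lemma young_ctrl_superadd H A a b : finvar p H a b -> finvar q A a b ->
  superadd (young_ctrl H A) a b.
Proof.
move=> fH fA; split => [u v *|u v t au uv vt tb]; first by rewrite mulr_ge0 ?powR_ge0.
have fH' : finvar p H u t by apply: finvar_sub fH.
have fA' : finvar q A u t by apply: finvar_sub fA.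
have H1 : 0 <= var p H u v by apply: var_ge0 => //; apply: finvar_sub fH' => //.
have H2 : 0 <= var p H v t by apply: var_ge0 => //; apply: finvar_sub fH' => //.
have A1 : 0 <= var q A u v by apply: var_ge0 => //; apply: finvar_sub fA' => //.
have A2 : 0 <= var q A v t by apply: var_ge0 => //; apply: finvar_sub fA' => //.
have := @hoelder2 R (var p H u v `^ al) (var p H v t `^ al) (var q A u v `^ (1 - al))
  (var q A v t `^ (1 - al)) al^-1 (1 - al)^-1 (powR_ge0 _ _) (powR_ge0 _ _)
  (powR_ge0 _ _) (powR_ge0 _ _).
rewrite !invr_gt0 !invrK => /(_ al0 alC0); rewrite addrC subrK => /(_ erefl).
rewrite !powRK ?gt_eqF// => h.
rewrite /young_ctrl; apply: le_trans (h) _; apply: ler_pM; rewrite ?powR_ge0//.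
  by apply: powR_le; [exact: ltW|exact: addr_ge0|exact: var_superadd].
by apply: powR_le; [exact: ltW|exact: addr_ge0|exact: var_superadd].
Qed.

Lemma increment_product_le H A a b u r v : finvar p H a b -> finvar q A a b ->
  a <= u -> u <= r -> r <= v -> v <= b ->
  `|H r - H u| * `|A v - A r| <= young_ctrl H A u v `^ th.
Proof.
move=> fH fA au ur rv vb.
have uv := le_trans ur rv.
have fH' : finvar p H u v by exact: finvar_sub fH.
have fA' : finvar q A u v by exact: finvar_sub fA.
rewrite young_ctrl_powR//; apply: ler_pM => //; apply: powR_le_inv => //.
- exact: var_ge0.
- by apply: le_trans (var_incr fH' p0 (lexx _) ur rv) _; apply: var_mono.
- exact: var_ge0.
- by apply: le_trans (var_incr fA' q0 ur rv (lexx _)) _; apply: var_mono.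
Qed.

Definition young_const : R := d%:R * young_cst th.

Lemma young_const_ge0 : 0 <= young_const.
Proof. by rewrite mulr_ge0// ltW// young_cst_gt0. Qed.

Lemma young_rsum_le H A a b x s : finvar p H a b -> finvar q A a b ->
  a <= x -> path <%R x s -> last x s <= b ->
  `|rsum H A x s - H x *m (A (last x s) - A x)| <=
  young_const * (var p H x (last x s) `^ p^-1 * var q A x (last x s) `^ q^-1).
Proof.
move=> fH fA ax ps lb; have xl := path_le_last ps.
rewrite -young_ctrl_powR //; [|exact: finvar_sub fH|exact: finvar_sub fA].
apply: (young_maximal pq _ (young_ctrl_superadd fH fA)) => // u r v au ur rv vb.
apply: le_trans (mulmx_norm_le _ _) _; apply: ler_wpM2l => //.
exact: (increment_product_le fH fA).
Qed.

(** On short intervals a product of increments is bounded both by a small eta and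
    by w^th.  Interpolation bounds it by a power of eta times w^th' with
    th' = (1 + th) / 2, which is still above 1: Young's inequality applies with a
    constant that tends to 0 with eta. *)
Lemma young_rsum_uniform H A e : rcont T H -> finvar p H 0 T ->
  rcont T A -> finvar q A 0 T -> 0 < e ->
  exists dl, 0 < dl /\ forall a b P Q, 0 <= a -> b <= T ->
    itv_partition a b P -> finer dl a P -> itv_partition a b Q ->
    {subset P <= Q} -> `|rsum H A a Q - rsum H A a P| <= e.
Proof.
move=> rH fH rA fA e0; pose th' := (1 + th) / 2.
have th1 : 1 < th' by rewrite /th'; move: pq; rewrite -/th; lra.
have th'th : th' <= th by rewrite /th'; move: pq; rewrite -/th; lra.
have th'0 : 0 < th' by exact: lt_trans th1.
pose be := th' / th.
have be0 : 0 < be by exact: divr_gt0.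
have be1 : be <= 1 by rewrite ler_pdivrMr// mul1r.
have be1' : 0 < 1 - be.
  by rewrite subr_gt0 /be ltr_pdivrMr// mul1r /th'; move: pq; rewrite -/th; lra.
pose w := young_ctrl H A.
have sw : superadd w 0 T := young_ctrl_superadd fH fA.
pose W := w 0 T `^ th'.
have W0 : 0 <= W by exact: powR_ge0.
have C0 := young_cst_gt0 th1.
pose D := d%:R * young_cst th' * W + 1.
have D0 : 0 < D.
  by rewrite ltr_wpDl//; apply: mulr_ge0 => //; apply: mulr_ge0 => //; exact: ltW.
pose eta := (e / D) `^ (1 - be)^-1.
have eta0 : 0 < eta by rewrite powR_gt0// divr_gt0.
have etaE : eta `^ (1 - be) = e / D.
  by rewrite /eta powRVK// ?gt_eqF// ltW// divr_gt0.
have [dl dl0 hdl] := regulated_product T0 (finvar_regulated p0 rH fH)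
  (finvar_regulated q0 rA fA) eta0.
exists dl; split => // a b P Q a0 bT hP fP hQ PQ.
have [pP /eqP lP] := hP; have [pQ /eqP lQ] := hQ.
have ab := itv_partition_le hP.
pose k := d%:R * (e / D).
have eD0 : 0 <= e / D by rewrite ltW// divr_gt0.
have k0 : 0 <= k by rewrite mulr_ge0.
have sw' : superadd (fun u v => k * young_cst th' * w u v `^ th') 0 T.
  have [s1 s2] := superadd_powR (ltW th1) sw.
  split => [u v *|u v t *]; first by apply: mulr_ge0 (powR_ge0 _ _); apply: mulr_ge0 (ltW C0).
  by rewrite -mulrDr; apply: ler_wpM2l; [apply: mulr_ge0 (ltW C0)|exact: s2].
apply: (@le_trans _ _ (k * young_cst th' * w a b `^ th')).
  rewrite -[X in w a X]lP; apply: (rsum_refine sw' _ a0 _ pP fP pQ PQ) => //; rewrite ?lP//.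
  move=> u s u0 ps lT ld.
  apply: (@young_maximal _ _ _ H A w th' k u (last u s)) => //.
  - by apply: superadd_sub sw.
  - move=> x r v ux xr rv vl; apply: le_trans (mulmx_norm_le _ _) _.
    rewrite -mulrA; apply: ler_wpM2l => //.
    have x0 : 0 <= x by exact: le_trans ux.
    have vT : v <= T by exact: le_trans lT.
    rewrite -etaE; have -> : w x v `^ th' = (w x v `^ th) `^ be.
      by rewrite -powRrM /be mulrC divfK ?gt_eqF.
    apply: (powR_interp (ltW be0) be1 (mulr_ge0 (normr_ge0 _) (normr_ge0 _))).
    + by apply: hdl => //; lra.
    + exact: (increment_product_le fH fA).
apply: (@le_trans _ _ (k * young_cst th' * W)).
  apply: ler_wpM2l; first exact: mulr_ge0 (ltW C0).
  apply: powR_le; [exact: ltW|by apply: sw.1|].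
  have h1 := sw.2 0 a b (lexx _) a0 ab bT.
  have h2 := sw.2 0 b T (lexx _) (le_trans a0 ab) bT (lexx _).
  have h3 := sw.1 0 a (lexx _) a0 (le_trans ab bT).
  have h4 := sw.1 b T (le_trans a0 ab) bT (lexx _).
  apply: (le_trans _ h2); rewrite -[leLHS]addr0; apply: lerD h4.
  by apply: le_trans h1; rewrite lerDr.
rewrite (_ : k * young_cst th' * W = e * ((D - 1) / D)); last first.
  by rewrite /k /D addrK; field; rewrite gt_eqF// -/D.
rewrite ger_pMr// ler_pdivrMr// mul1r; lra.
Qed.

(** The sums over two fine partitions are both close to the sum over a common
    refinement. *)
Lemma young_integral_ex H A a b : rcont T H -> finvar p H 0 T ->
  rcont T A -> finvar q A 0 T -> 0 <= a -> a <= b -> b <= T ->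
  exists I, is_young_integral H A a b I.
Proof.
move=> rH fH rA fA a0 ab bT; have PF := mesh_to0_proper ab.
pose F := riemann_sum H A a b P @[P --> mesh_to0 a b].
suff /cvg_ex[I hI] : cvg F by exists I.
apply/cauchy_cvgP/cauchyP => e e0.
have e30 : 0 < e / 3 by rewrite divr_gt0.
have [dl [dl0 h]] := young_rsum_uniform rH fH rA fA e30.
have [P [hP fP]] := finer_partition_ex ab dl0.
exists (riemann_sum H A a b P); exists dl => // Q hQ /mesh_lt_finer fQ.
have {}fQ := fQ dl0.
have [S [hS PS QS]] := common_refinement hP hQ.
have h1 := h _ _ _ _ a0 bT hP fP hS PS.
have h2 := h _ _ _ _ a0 bT hQ fQ hS QS.
rewrite /= -ball_normE /ball_/= !riemann_sumE.
apply: le_lt_trans (ler_distD (rsum H A a S) _ _) _.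
move: h1 h2; rewrite [`|rsum H A a P - _|]distrC.
by set z1 := `|_|; set z2 := `|_|; lra.
Qed.

Lemma young_integral_le H A a b I : finvar p H a b -> finvar q A a b -> a <= b ->
  is_young_integral H A a b I ->
  `|I - H a *m (A b - A a)| <=
  young_const * (var p H a b `^ p^-1 * var q A a b `^ q^-1).
Proof.
move=> fH fA ab /young_integralP hI; apply/ler_addgt0Pr => e e0.
have [dl dl0 h] := hI _ e0.
have [P [hP fP]] := finer_partition_ex ab dl0.
have := h P hP fP; have [pP /eqP lP] := hP.
have := young_rsum_le fH fA (lexx a) pP; rewrite lP => /(_ (lexx _)) h1 h2.
apply: le_trans (ler_distD (rsum H A a P) _ _) _.
by move: h1 h2; rewrite [`|I - _|]distrC; set z1 := `|_|; set z2 := `|_|; lra.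
Qed.

End YoungExistence.

(** * The Young integral as a path *)

Section YoungPath.
Variables (R : realType) (n d : nat) (p q T : R).
Hypotheses (p1 : 1 <= p) (q1 : 1 <= q) (pq : 1 < p^-1 + q^-1) (T0 : 0 <= T).
Implicit Types (H : R -> 'M[R]_(n, d)) (A : R -> 'cV[R]_d) (I : 'cV[R]_n).
Implicit Types (a b c t u v x y e dl : R) (s P : seq R).

Let p0 : 0 < p. Proof. exact: lt_le_trans p1. Qed.
Let q0 : 0 < q. Proof. exact: lt_le_trans q1. Qed.

(** The counterpart of Dspace in the max norm.  Left limits are left out since
    finite p-variation provides them. *)
Definition Dpath (V : normedZmodType R) r (g : R -> V) := rcont T g /\ finvar r g 0 T.

Definition yint H A t : 'cV[R]_n := xget 0 [set I | is_young_integral H A 0 t I].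

Lemma yint_integral H A t : Dpath p H -> Dpath q A -> 0 <= t -> t <= T ->
  is_young_integral H A 0 t (yint H A t).
Proof.
move=> [rH fH] [rA fA] t0 tT.
have [I hI] := young_integral_ex p1 q1 pq T0 rH fH rA fA (lexx _) t0 tT.
exact: (@xgetPex _ 0 [set I | is_young_integral H A 0 t I] (ex_intro _ I hI)).
Qed.

Lemma yint_unique H A t I : 0 <= t -> is_young_integral H A 0 t I -> yint H A t = I.
Proof.
move=> t0 hI; have := @xgetPex _ 0 [set I | is_young_integral H A 0 t I] (ex_intro _ I hI).
by move=> h; exact: (young_integral_unique t0 h hI).
Qed.

Lemma yint_incr H A u v : Dpath p H -> Dpath q A -> 0 <= u -> u <= v -> v <= T ->
  is_young_integral H A u v (yint H A v - yint H A u).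
Proof.
move=> hH hA u0 uv vT; have v0 := le_trans u0 uv; have uT := le_trans uv vT.
have [I hI] : exists I, is_young_integral H A u v I.
  by have [rH fH] := hH; have [rA fA] := hA; exact: (young_integral_ex p1 q1 pq T0).
have := young_integral_add u0 uv (yint_integral hH hA u0 uT) hI (yint_integral hH hA v0 vT).
by move=> ->; rewrite addrC addKr.
Qed.

Lemma yint0 H A : yint H A 0 = 0.
Proof.
apply: yint_unique => //; apply/young_integralP => e e0; exists 1 => // P [pP /eqP lP] _.
case: P pP lP => [|y P /= /andP[y0 pP] lP]; first by rewrite /= subrr normr0.
by have := path_le_last pP; rewrite lP leNgt y0.
Qed.

Lemma yint_eq H H' A A' t :
  (forall u, 0 <= u -> u < t -> H u = H' u) ->
  (forall u, 0 <= u -> u <= t -> A u = A' u) -> yint H A t = yint H' A' t.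
Proof.
move=> hH hA; rewrite /yint; congr xget; apply/seteqP; split => I /=.
  exact: young_integral_eq.
by apply: young_integral_eq => u u0 ut; rewrite ?hH ?hA.
Qed.

Lemma yintB H H' A t : Dpath p H -> Dpath p H' -> Dpath q A -> 0 <= t -> t <= T ->
  yint (fun u => H u - H' u) A t = yint H A t - yint H' A t.
Proof.
move=> hH hH' hA t0 tT; apply: yint_unique => //.
by apply: young_integralB; exact: yint_integral.
Qed.

Definition yint_const : R := d%:R + young_const d p q.

Lemma yint_const_ge0 : 0 <= yint_const.
Proof. by apply: addr_ge0 => //; exact: young_const_ge0 pq. Qed.

Lemma yint_incr_le H A a b N u v : Dpath p H -> Dpath q A -> 0 <= a -> b <= T ->
  (forall t, a <= t <= b -> `|H t| <= N) -> var_le p H a b (N `^ p) -> 0 <= N ->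
  a <= u -> u <= v -> v <= b ->
  `|yint H A v - yint H A u| <= yint_const * N * var q A u v `^ q^-1.
Proof.
move=> hH hA a0 bT HN vN N0 au uv vb.
have u0 := le_trans a0 au; have vT := le_trans vb bT; have v0 := le_trans u0 uv.
have [_ fH] := hH; have [_ fA] := hA.
have fH' : finvar p H u v by exact: finvar_sub fH.
have fA' : finvar q A u v by exact: finvar_sub fA.
have := young_integral_le p1 q1 pq fH' fA' uv (yint_incr hH hA u0 uv vT).
move: (yint H A v - yint H A u) => J hJ.
rewrite -(subrK (H u *m (A v - A u)) J).
apply: le_trans (ler_normD _ _) _; rewrite addrC.
have h1 : `|H u *m (A v - A u)| <= d%:R * (N * var q A u v `^ q^-1).
  apply: le_trans (mulmx_norm_le _ _) _; apply: ler_wpM2l => //; apply: ler_pM => //.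
    by apply: HN; rewrite au (le_trans uv).
  by apply: powR_le_inv => //; [exact: var_ge0|exact: (var_incr fA' q0)].
apply: le_trans (lerD h1 hJ) _; rewrite /yint_const -mulrA mulrDl lerD2l.
apply: ler_wpM2l; first exact: young_const_ge0 pq.
apply: ler_wpM2r; first exact: powR_ge0.
rewrite -[leRHS](@powRK _ p) ?gt_eqF//; apply: powR_le.
- by rewrite invr_ge0 ltW.
- exact: var_ge0.
- by apply: var_lub => //; exact: var_le_sub vN.
Qed.

Hypothesis qp : q <= p.

(** Since p >= q, the power p/q of the q-variation of A is superadditive, so the
    p-variation of the integral is a multiple of it: a driver with small
    q-variation makes the integral small. *)
Lemma yint_var_le H A a b N : Dpath p H -> Dpath q A -> 0 <= a -> b <= T ->
  (forall t, a <= t <= b -> `|H t| <= N) -> var_le p H a b (N `^ p) -> 0 <= N ->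
  var_le p (yint H A) a b ((yint_const * N) `^ p * var q A a b `^ (p / q)).
Proof.
move=> hH hA a0 bT HN vN N0 x s ax ps lb; have xl := path_le_last ps.
have [_ fA] := hA; have C0 := yint_const_ge0.
have pq1 : 1 <= p / q by rewrite ler_pdivlMr// mul1r.
have fA' : finvar q A a b by exact: finvar_sub fA.
have sv : superadd (fun u v => var q A u v `^ (p / q)) a b.
  apply: superadd_powR => //; split => [u v au uv vb|u v t au uv vt tb].
    by apply: var_ge0 => //; exact: finvar_sub fA'.
  by apply: var_superadd => //; exact: finvar_sub fA'.
apply: (@le_trans _ _ ((yint_const * N) `^ p * var q A x (last x s) `^ (p / q))).
  apply: (@vsum_superadd _ _ p (yint H A)
     (fun u v => (yint_const * N) `^ p * var q A u v `^ (p / q)) a b) => //.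
  - move=> u v au uv vb; rewrite [p / q]mulrC powRrM -powRM ?mulr_ge0 ?powR_ge0//.
    apply: powR_le => //; first exact: ltW.
    exact: (yint_incr_le hH hA a0 bT HN vN N0 au (ltW uv) vb).
  - by move=> u _ _; apply: mulr_ge0; exact: powR_ge0.
  - move=> u v w au uv vw wb; rewrite -mulrDr.
    by apply: ler_wpM2l; [exact: powR_ge0|exact: sv.2].
apply: ler_wpM2l; first exact: powR_ge0.
apply: powR_le; first by rewrite (le_trans _ pq1).
  by apply: var_ge0 => //; exact: finvar_sub fA'.
exact: var_mono.
Qed.

Lemma Dpath_normed (V : normedZmodType R) (H : R -> V) : Dpath p H -> exists2 N, 0 <= N &
  (forall t, 0 <= t <= T -> `|H t| <= N) /\ var_le p H 0 T (N `^ p).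
Proof.
move=> [_ fH]; have [N N0 hN] := finvar_bounded p0 fH; have [M hM] := fH.
exists (N + `|M| `^ p^-1); first by rewrite addr_ge0 ?powR_ge0.
split=> [t /hN /le_trans|]; first by apply; rewrite lerDl powR_ge0.
apply: var_le_trans hM; apply: le_trans (ler_norm M) _.
rewrite -[leLHS](@powRVK _ p) ?gt_eqF//.
by apply: powR_le; [exact: ltW|exact: powR_ge0|rewrite lerDr].
Qed.

Lemma yint_Dpath H A : Dpath p H -> Dpath q A -> Dpath p (yint H A).
Proof.
move=> hH hA; have [N N0 [HN vN]] := Dpath_normed hH; split; last first.
  by eexists; exact: (yint_var_le hH hA (lexx _) (lexx _) HN vN N0).
move=> t t0 tT e e0; have [rA fA] := hA.
have C0 := yint_const_ge0.
have D0 : 0 < yint_const * N + 1 by rewrite ltr_wpDl// mulr_ge0.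
have eD0 : 0 < e / (yint_const * N + 1) by rewrite divr_gt0.
have [u [tu uT hu]] := finvar_right q0 rA t0 tT (finvar_sub t0 (lexx _) fA)
  (powR_gt0 q eD0).
exists (u - t) => [|v tv vu vT]; first by rewrite subr_gt0.
have vu' : v <= u by rewrite addrC subrK in vu; exact: ltW.
apply: le_lt_trans (yint_incr_le hH hA (lexx _) (lexx _) HN vN N0 t0 tv vT) _.
have h : var q A t v `^ q^-1 <= e / (yint_const * N + 1).
  rewrite -[leRHS](@powRK _ q) ?gt_eqF//; last exact: ltW.
  apply: powR_le; first by rewrite invr_ge0 ltW.
    by apply: var_ge0 => //; apply: finvar_sub fA.
  by apply: var_lub => //; apply: var_le_sub hu.
apply: le_lt_trans (ler_wpM2l (mulr_ge0 C0 N0) h) _.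
rewrite mulrCA -[ltRHS]mulr1 ltr_pM2l// ltr_pdivrMr// mul1r.
by rewrite -[ltLHS]addr0 ltrD2l.
Qed.

End YoungPath.

(** * Reflection and p-variation *)

Section RunningMax.
Variable R : realType.
Implicit Types (p a b c u v x y e k S W M : R) (s : seq R) (D z l : R -> R).

(** The value Du is only approached, not attained, by the values in E; the values
    of E are cut down to Du, which lowers both powers, before passing to the
    limit. *)
Lemma tracking_step_up p Dv Du c k S W (E : R -> Prop) : 1 <= p -> 0 <= k ->
  Dv < Du -> c < Du -> (forall e, 0 < e -> exists2 y, E y & Du - e < y) ->
  (forall y, E y -> S + `|y - Dv| `^ p + k * `|c - y| `^ p <= W) ->
  S + `|Du - Dv| `^ p + k * `|c - Du| `^ p <= W.
Proof.
move=> p1 k0 vu cu hE hW; have p0 : 0 < p by exact: lt_le_trans p1.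
apply/ler_addgt0Pr => e e0.
have ek0 : 0 < e / 2 / (k + 1) by rewrite !divr_gt0// ltr_wpDl.
have [d1 d10 h1] := powR_cont p0 (normr_ge0 (Du - Dv)) (divr_gt0 e0 (ltr0Sn _ 1)).
have [d2 d20 h2] := powR_cont p0 (normr_ge0 (c - Du)) ek0.
pose dl := Num.min (Num.min d1 d2) (Num.min (Du - Dv) (Du - c)).
have dl0 : 0 < dl by rewrite !lt_min d10 d20 !subr_gt0 vu.
have [z Ez hz] := hE _ dl0.
pose y := Num.min z Du.
have yz : y <= z by rewrite ge_min lexx.
have yDu : y <= Du by rewrite ge_min lexx orbT.
have hy : Du - dl < y by rewrite lt_min hz ltrBlDr ltrDl.
have [e1 e2 e3 e4] : [/\ dl <= d1, dl <= d2, dl <= Du - Dv & dl <= Du - c].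
  by split; rewrite !ge_min lexx ?orbT.
have vy : Dv < y by apply: le_lt_trans hy; rewrite lerBrDl -lerBrDr.
have cy : c < y by apply: le_lt_trans hy; rewrite lerBrDl -lerBrDr.
have vz := lt_le_trans vy yz; have cz := lt_le_trans cy yz.
have nv t : Dv < t -> `|t - Dv| = t - Dv.
  by move=> vt; rewrite ger0_norm// subr_ge0 ltW.
have nc t : c < t -> `|c - t| = t - c.
  by move=> ct; rewrite ler0_norm ?opprB// subr_le0 ltW.
have a1 : `|y - Dv| `^ p <= `|z - Dv| `^ p.
  by apply: powR_le => //; [exact: ltW|rewrite !nv// lerD2r].
have a2 : `|c - y| `^ p <= `|c - z| `^ p.
  by apply: powR_le => //; [exact: ltW|rewrite !nc// lerD2r].
have yd : `|y - Du| < dl by rewrite ler0_norm ?subr_le0// opprB ltrBlDr -ltrBlDl.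
have {}h1 : `|Du - Dv| `^ p - e / 2 <= `|y - Dv| `^ p.
  have /h1 : `| `|y - Dv| - `|Du - Dv| | < d1.
    by rewrite !nv// opprB addrA subrK; exact: lt_le_trans e1.
  by move=> /(_ (normr_ge0 _)); rewrite ltr_distl => /andP[/ltW].
have {}h2 : `|c - Du| `^ p - e / 2 / (k + 1) <= `|c - y| `^ p.
  have /h2 : `| `|c - y| - `|c - Du| | < d2.
    by rewrite !nc// opprB addrA subrK; exact: lt_le_trans e2.
  by move=> /(_ (normr_ge0 _)); rewrite ltr_distl => /andP[/ltW].
have := hW z Ez.
have k1 : k * (e / 2 / (k + 1)) <= e / 2.
  have k10 : 0 < k + 1 by rewrite ltr_wpDl.
  by rewrite mulrCA ger_pMr ?divr_gt0// ler_pdivrMr// mul1r lerDl.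
have m2 := ler_wpM2l k0 (le_trans h2 a2); rewrite mulrBr in m2.
move: m2 k1 h1 a1; set A1 := k * (`|c - Du| `^ p); set A2 := k * (e / 2 / (k + 1)).
set A3 := k * _; set A4 := _ `^ p; set A5 := _ `^ p; set A6 := _ `^ p; lra.
Qed.

Lemma tracking_step_down p Dv Du c k S W (E : R -> Prop) : 1 <= p -> 0 <= k ->
  Du < Dv -> Du < c -> (forall e, 0 < e -> exists2 y, E y & y < Du + e) ->
  (forall y, E y -> S + `|y - Dv| `^ p + k * `|c - y| `^ p <= W) ->
  S + `|Du - Dv| `^ p + k * `|c - Du| `^ p <= W.
Proof.
move=> p1 k0 uv uc hE hW.
have nN (x y : R) : `|- x - - y| = `|x - y| by rewrite -opprD normrN.
have := @tracking_step_up p (- Dv) (- Du) (- c) k S W (fun y => E (- y)) p1 k0.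
rewrite !ltrN2 !nN; apply => //.
  by move=> e /hE[y Ey ye]; exists (- y); rewrite ?opprK//; lra.
by move=> y /hW; rewrite -nN -[`|c - _|]nN opprK.
Qed.

(** D only ever moves towards values that z takes in the meantime, so an upward
    move of D ends below a value of z reached during that move, and the preceding
    downward move ended above an earlier value of z.  The induction over the chain
    carries the cost of one more jump from its end point to an arbitrary c: when D
    rises beyond c, the bound is applied to the chain for z prolonged by the value
    that z has reached. *)
Lemma var_le_tracking p D z a b M : 1 <= p -> a <= b -> D a = z a ->
  (forall u v e, a <= u -> u < v -> v <= b -> D u < D v -> 0 < e ->
    exists2 y, u < y <= v & D v - e < z y) ->
  (forall u v e, a <= u -> u < v -> v <= b -> D v < D u -> 0 < e ->
    exists2 y, u < y <= v & z y < D v + e) ->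
  var_le p z a b M -> var_le p D a b M.
Proof.
move=> p1 ab Da up down zM; have p0 : 0 < p by exact: lt_le_trans p1.
pose B u c W := forall x s, a <= x -> path <%R x s -> last x s <= u ->
  vsum p z x s + `|c - z (last x s)| `^ p <= W.
have Bsub u v c W : u <= v -> B v c W -> B u c W.
  by move=> uv h x s ax ps lu; apply: h => //; exact: le_trans uv.
have Bapp u v c W y : u < y <= v -> B v c W -> B u (z y) (W - `|c - z y| `^ p).
  move=> /andP[uy yv] h x s ax ps lu.
  have ps' : path <%R x (rcons s y) by rewrite rcons_path ps (le_lt_trans lu).
  have := h x (rcons s y) ax ps'; rewrite last_rcons => /(_ yv).
  by rewrite -cats1 vsum_cat/= addr0; lra.
have key s : path <%R a s -> last a s <= b -> forall c W, B (last a s) c W ->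
    vsum p D a s + `|c - D (last a s)| `^ p <= W.
  elim/last_ind: s => [_ _ c W /(_ a [::])|s u ih]; first by rewrite /= Da; exact.
  rewrite rcons_path last_rcons => /andP[ps lu] ub c W hB.
  have al := path_le_last ps; have lb := le_trans (ltW lu) ub.
  rewrite -cats1 vsum_cat /= addr0; set v := last a s in lu al lb ih *.
  have hv y : v < y <= u -> vsum p D a s + `|z y - D v| `^ p + 1 * `|c - z y| `^ p <= W.
    by move=> hy; have := ih ps lb _ _ (Bapp _ _ _ _ _ hy hB); lra.
  have hc := ih ps lb _ _ (Bsub _ _ _ _ (ltW lu) hB).
  rewrite -[`|c - D u| `^ p]mul1r.
  have [vu|uv|<-] := ltgtP (D v) (D u); last first.
  - by rewrite subrr normr0 powR0 ?gt_eqF// addr0 mul1r.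
  - have [uc|cu] := ltP (D u) c.
      apply: (@tracking_step_down p (D v) (D u) c 1 (vsum p D a s) W
        (fun y => exists2 t, v < t <= u & y = z t) p1 ler01 uv uc).
        move=> e e0; have [t ht zt] := down v u e al lu ub uv e0.
        by exists (z t) => //; exists t.
      by move=> _ [t ht ->]; exact: hv.
    rewrite mul1r; apply: le_trans hc; rewrite -addrA lerD2l.
    apply: le_trans (powR_add_ge p1 (normr_ge0 _) (normr_ge0 _)) _.
    by apply: powR_le; [exact: ltW|exact: addr_ge0|rewrite !ler0_norm; lra].
  - have [cu|uc] := ltP c (D u).
      apply: (@tracking_step_up p (D v) (D u) c 1 (vsum p D a s) W
        (fun y => exists2 t, v < t <= u & y = z t) p1 ler01 vu cu).
        move=> e e0; have [t ht zt] := up v u e al lu ub vu e0.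
        by exists (z t) => //; exists t.
      by move=> _ [t ht ->]; exact: hv.
    rewrite mul1r; apply: le_trans hc; rewrite -addrA lerD2l.
    apply: le_trans (powR_add_ge p1 (normr_ge0 _) (normr_ge0 _)) _.
    by apply: powR_le; [exact: ltW|exact: addr_ge0|rewrite !ger0_norm; lra].
have start s : path <%R a s -> last a s <= b -> vsum p D a s <= M.
  case/lastP: s => [_ _|s u]; first exact: var_le_ge0 zM.
  rewrite rcons_path last_rcons => /andP[ps lu] ub.
  have al := path_le_last ps; have lb := le_trans (ltW lu) ub.
  rewrite -cats1 vsum_cat /= addr0; set v := last a s in lu al lb *.
  have zB y : v < y <= u -> B v (z y) M.
    move=> /andP[vy yu] x r ax pr lv.
    have pr' : path <%R x (rcons r y) by rewrite rcons_path pr (le_lt_trans lv).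
    have := zM x (rcons r y) ax pr'; rewrite last_rcons => /(_ (le_trans yu ub)).
    by rewrite -cats1 vsum_cat/= addr0.
  have hv c y : v < y <= u -> vsum p D a s + `|z y - D v| `^ p + 0 * `|c - z y| `^ p <= M.
    by move=> /zB hB; rewrite mul0r addr0; exact: (key s ps lb).
  have [vu|uv|e] := ltgtP (D v) (D u).
  - have := @tracking_step_up p (D v) (D u) (D u - 1) 0 (vsum p D a s) M
      (fun y => exists2 t, v < t <= u & y = z t) p1 (lexx _) vu.
    rewrite mul0r addr0; apply; first by lra.
      move=> e e0; have [t ht zt] := up v u e al lu ub vu e0.
      by exists (z t) => //; exists t.
    by move=> _ [t ht ->]; exact: hv.
  - have := @tracking_step_down p (D v) (D u) (D u + 1) 0 (vsum p D a s) M
      (fun y => exists2 t, v < t <= u & y = z t) p1 (lexx _) uv.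
    rewrite mul0r addr0; apply; first by lra.
      move=> e e0; have [t ht zt] := down v u e al lu ub uv e0.
      by exists (z t) => //; exists t.
    by move=> _ [t ht ->]; exact: hv.
  - rewrite e subrr normr0 powR0 ?gt_eqF// addr0.
    have := hv 0 u; rewrite lu lexx mul0r addr0 => /(_ isT).
    by apply: le_trans; rewrite lerDl powR_ge0.
move=> x s; rewrite le_eqVlt => /predU1P[<-|ax ps lb]; first exact: start.
apply: (@le_trans _ _ (vsum p D a (x :: s))); first by rewrite /= lerDr powR_ge0.
by apply: start; rewrite //= ax.
Qed.

(** The Skorokhod reflection term in dimension one: l is the barrier minus the
    path to be reflected. *)
Definition reflection l u : R :=
  sup [set y | exists2 r, 0 <= r <= u & y = Num.max 0 (l r)].

Definition ubounded T l := exists N, forall t, 0 <= t <= T -> l t <= N.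

Section Reflection.
Variables (T : R) (l : R -> R).
Hypothesis bl : ubounded T l.

Let has_sup_reflection u : 0 <= u -> u <= T ->
  has_sup [set y | exists2 r, 0 <= r <= u & y = Num.max 0 (l r)].
Proof.
move=> u0 uT; split; first by exists (Num.max 0 (l 0)), 0; rewrite ?lexx ?u0.
have [N hN] := bl; exists (Num.max 0 N) => _ [r /andP[r0 ru] ->].
by rewrite ge_max !le_max lexx/= hN ?orbT// r0 (le_trans ru).
Qed.

Lemma reflection_ge r u : 0 <= r -> r <= u -> u <= T -> l r <= reflection l u.
Proof.
move=> r0 ru uT; apply: (@le_trans _ _ (Num.max 0 (l r))); first by rewrite le_max lexx orbT.
apply: (ub_le_sup (has_sup_reflection (le_trans r0 ru) uT).2).
by exists r => //; rewrite r0.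
Qed.

Lemma reflection_ge0 u : 0 <= u -> u <= T -> 0 <= reflection l u.
Proof.
move=> u0 uT; apply: (@le_trans _ _ (Num.max 0 (l u))); first by rewrite le_max lexx.
by apply: (ub_le_sup (has_sup_reflection u0 uT).2); exists u; rewrite ?u0 /=.
Qed.

Lemma reflection_le u y : 0 <= u -> 0 <= y ->
  (forall r, 0 <= r <= u -> l r <= y) -> reflection l u <= y.
Proof.
move=> u0 y0 h; apply: ge_sup.
  by exists (Num.max 0 (l 0)), 0; rewrite ?lexx ?u0.
by move=> _ [r hr ->]; rewrite ge_max y0 h.
Qed.

Lemma reflection_mono u v : 0 <= u -> u <= v -> v <= T ->
  reflection l u <= reflection l v.
Proof.
move=> u0 uv vT; apply: reflection_le => //.
  by rewrite reflection_ge0// (le_trans u0).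
by move=> r /andP[r0 ru]; apply: reflection_ge => //; exact: le_trans uv.
Qed.

Lemma reflection0 : l 0 <= 0 -> 0 <= T -> reflection l 0 = 0.
Proof.
move=> l0 T0; apply/eqP; rewrite eq_le reflection_ge0// andbT reflection_le//.
by move=> r r0; have -> : r = 0 by apply/eqP; rewrite eq_le andbC.
Qed.

(** Otherwise l would stay below the larger of the former value and the new value
    minus e on the whole of [0, v]. *)
Lemma reflection_increase u v e : 0 <= u -> u <= v -> v <= T ->
  reflection l u < reflection l v -> 0 < e ->
  exists2 t, u < t <= v & reflection l v - e < l t.
Proof.
move=> u0 uv vT uKv e0.
pose m := Num.max (reflection l u) (reflection l v - e).
have m0 : 0 <= m by rewrite le_max reflection_ge0// (le_trans uv).
have mv : m < reflection l v by rewrite gt_max uKv/= ltrBlDr ltrDl.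
have [t [/andP[t0 tv] mt]] : exists t, 0 <= t <= v /\ m < l t.
  apply: contrapT => h; move: mv; rewrite ltNge => /negP; apply.
  apply: reflection_le => //; first exact: le_trans uv.
  by move=> r hr; rewrite leNgt; apply/negP => lr; apply: h; exists r.
move: mt; rewrite gt_max => /andP[mt1 mt2]; exists t; rewrite // tv andbT ltNge.
apply/negP => tu; move: mt1; rewrite ltNge => /negP; apply.
by apply: reflection_ge => //; exact: le_trans uv vT.
Qed.

Lemma reflection_osc a u m : 0 <= a -> a <= u -> u <= T -> 0 <= m ->
  (forall r, a <= r <= u -> l r <= l a + m) ->
  reflection l u <= reflection l a + m.
Proof.
move=> a0 au uT m0 h; have aT := le_trans au uT.
apply: reflection_le; [exact: le_trans au|by rewrite addr_ge0// reflection_ge0|].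
move=> r /andP[r0 ru]; have [ra|ar] := leP r a.
  by apply: (le_trans (reflection_ge r0 ra aT)); rewrite lerDl.
apply: (le_trans (h r _)); first by rewrite ru ltW.
by rewrite lerD2r reflection_ge.
Qed.

Lemma reflection_rcont : rcont T l -> rcont T (reflection l).
Proof.
move=> rl t t0 tT e e0; have e20 : 0 < e / 2 by rewrite divr_gt0.
have [d d0 hd] := rl t t0 tT _ e20; exists d => // u tu ud uT.
rewrite ger0_norm ?subr_ge0 ?reflection_mono// ltrBlDl.
apply: (@le_lt_trans _ _ (reflection l t + e / 2)); last by rewrite ltrD2l; lra.
apply: reflection_osc => //; first exact: ltW.
move=> r /andP[tr ru]; rewrite -lerBlDl; apply: le_trans (ler_norm _) _.
by apply/ltW/hd => //; [exact: le_lt_trans ud|exact: le_trans uT].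
Qed.

End Reflection.

Lemma reflection_eq l l' u : (forall r, 0 <= r <= u -> l r = l' r) ->
  reflection l u = reflection l' u.
Proof.
move=> h; rewrite /reflection; congr sup; apply/seteqP; split => y [r hr ->];
  by exists r => //; rewrite h.
Qed.

(** When the difference of the two reflection terms rises, the first one has just
    been pushed up to a value of l while the second one dominates l' at that time;
    so the difference tracks l - l'. *)
Lemma reflection_var_le p T l l' a b M : 1 <= p -> ubounded T l -> ubounded T l' ->
  0 <= a -> a <= b -> b <= T -> (forall t, 0 <= t <= a -> l t = l' t) ->
  var_le p (fun t => l t - l' t) a b M ->
  var_le p (fun t => reflection l t - reflection l' t) a b M.
Proof.
move=> p1 bl bl' a0 ab bT ll'; apply: var_le_tracking => //.
- by rewrite (reflection_eq ll') ll' ?a0 ?lexx// !subrr.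
- move=> u v e au uv vb h e0.
  have u0 := le_trans a0 au; have vT := le_trans vb bT; have uv' := ltW uv.
  have m := reflection_mono bl' u0 uv' vT.
  have [|t ht lt] := reflection_increase bl u0 uv' vT _ e0; first by lra.
  exists t => //; move: ht => /andP[ut tv].
  by have := reflection_ge bl' (le_trans u0 (ltW ut)) tv vT; lra.
- move=> u v e au uv vb h e0.
  have u0 := le_trans a0 au; have vT := le_trans vb bT; have uv' := ltW uv.
  have m := reflection_mono bl u0 uv' vT.
  have [|t ht lt] := reflection_increase bl' u0 uv' vT _ e0; first by lra.
  exists t => //; move: ht => /andP[ut tv].
  by have := reflection_ge bl (le_trans u0 (ltW ut)) tv vT; lra.
Qed.

End RunningMax.

(** * Increments of the vector field *)

Section VectorField.
Variable R : realType.
Implicit Types (a b m n : nat).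

Lemma bounded_fun_ex a b m n (g : 'M[R]_(a, b) -> 'M[R]_(m, n)) :
  bounded_fun g -> exists2 C, 0 <= C & forall x, `|g x| <= C.
Proof.
move=> [M [_ h]]; exists (`|M| + 1); first by rewrite addr_ge0.
by move=> x; apply: (h (`|M| + 1)) => //; rewrite (le_lt_trans (ler_norm M))// ltrDl.
Qed.

Lemma mxvec_norm a b (v : 'M[R]_(a, b)) : `|mxvec v| = `|v|.
Proof.
apply/eqP; rewrite eq_le; apply/andP; split; apply: mx_norm_le => // i j.
  by case/mxvec_indexP: j => k l; rewrite ord1 mxvecE mx_entry_le.
by rewrite -mxvecE mx_entry_le.
Qed.

Lemma diff_norm_le a b m n (g : 'M[R]_(a, b) -> 'M[R]_(m, n)) x v :
  `|'d g x v| <= (a * b)%:R * (`|v| * `|lin_mx ('d g x)|).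
Proof.
rewrite -mxvec_norm -mul_vec_lin; apply: le_trans (mulmx_norm_le _ _) _.
by rewrite mxvec_norm.
Qed.

Lemma lin_mxB_norm_le a b m n (D1 D2 : {linear 'M[R]_(a, b) -> 'M[R]_(m, n)}) v :
  `|D1 v - D2 v| <= (a * b)%:R * (`|v| * `|lin_mx D1 - lin_mx D2|).
Proof.
rewrite -mxvec_norm [mxvec _]linearB /= -(mul_vec_lin D1) -(mul_vec_lin D2) -mulmxBr.
by apply: le_trans (mulmx_norm_le _ _) _; rewrite mxvec_norm.
Qed.

Lemma is_derive_entry a b m n (g : 'M[R]_(a, b) -> 'M[R]_(m, n)) x v (l : R) i j :
  differentiable g (x + l *: v) ->
  is_derive l 1 (fun t : R => g (x + t *: v) i j) ('d g (x + l *: v) v i j).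
Proof.
move=> dg; have dv : derivable g (x + l *: v) v := diff_derivable dg.
have cv : (fun h : R => h^-1 * (g (x + (h + l) *: v) i j - g (x + l *: v) i j)) @ 0^'
    --> 'd g (x + l *: v) v i j.
  rewrite -deriveE//.
  have /cvg_ex[L hL] := dv; have DL : 'D_v g (x + l *: v) = L by exact: cvg_lim hL.
  rewrite DL.
  have := cvg_comp _ _ hL (@coord_continuous R m n i j L).
  apply: cvg_trans; apply: near_eq_cvg; near=> h.
  by rewrite /= !mxE scalerDl addrCA [h *: v + _]addrC addrA.
have cv' : (fun h : R => h^-1 *: (g (x + (h *: (1 : R^o) + l) *: v) i j - g (x + l *: v) i j)) @ 0^'
    --> 'd g (x + l *: v) v i j.
  by under eq_fun do rewrite [_ *: 1]mulr1.
split; first by apply/cvg_ex; exists ('d g (x + l *: v) v i j).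
exact: cvg_lim cv'.
Unshelve. all: by end_near. Qed.

Lemma mvt01 (phi dphi : R -> R) C :
  (forall t : R, is_derive t 1 phi (dphi t)) ->
  (forall t, 0 <= t <= 1 -> `|dphi t| <= C) -> `|phi 1 - phi 0| <= C.
Proof.
move=> dp hC.
have cphi : {within `[0, 1], continuous phi}.
  by apply: derivable_within_continuous => t _; have [] := dp t.
have [t ht ->] := MVT (@ltr01 R) (fun t _ => dp t) cphi.
by rewrite subr0 mulr1; apply: hC; move: ht; rewrite in_itv/= => /andP[/ltW -> /ltW ->].
Qed.

(** Applied both to the vector field and to its derivative. *)
Lemma Cb_lipschitz a b m n (g : 'M[R]_(a, b) -> 'M[R]_(m, n)) : Cb 1 g ->
  exists2 C, 0 <= C & forall x y, `|g y - g x| <= C * `|y - x|.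
Proof.
move=> [_ _ [dg [_ /bounded_fun_ex[C C0 hC] _]]].
exists ((a * b)%:R * C); first by rewrite mulr_ge0.
move=> x y; apply: mx_norm_le => [|i j]; first by rewrite !mulr_ge0.
have := @mvt01 (fun t => g (x + t *: (y - x)) i j)
  (fun t => 'd g (x + t *: (y - x)) (y - x) i j) ((a * b)%:R * C * `|y - x|).
rewrite scale1r scale0r addr0 [x + _]addrC subrK !mxE; apply.
  by move=> t; exact: is_derive_entry.
move=> t _; apply: le_trans (mx_entry_le _ _ _) _; apply: le_trans (diff_norm_le _ _ _) _.
by rewrite -mulrA; apply: ler_wpM2l => //; rewrite mulrC ler_wpM2r.
Qed.

(** The mean value theorem is applied to the difference of g along the segments
    from x1 to x2 and from y1 to y2, run simultaneously; the Lipschitz continuity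
    of the derivative accounts for the second term. *)
Lemma Cb2_increments a b m n (g : 'M[R]_(a, b) -> 'M[R]_(m, n)) : Cb 2 g ->
  exists2 C, 0 <= C & forall x1 x2 y1 y2 e, `|x1 - y1| <= e -> `|x2 - y2| <= e ->
    `|(g x2 - g y2) - (g x1 - g y1)| <=
      C * (`|(x2 - y2) - (x1 - y1)| + e * `|y2 - y1|).
Proof.
move=> [_ _ [dg hD]]; have [L L0 hL] := Cb_lipschitz hD.
have [_ /bounded_fun_ex[C C0 hC] _] := hD.
pose ab : R := (a * b)%:R.
have ab0 : 0 <= ab by [].
exists (ab * (C + L)); first by rewrite mulr_ge0// addr_ge0.
move=> x1 x2 y1 y2 e e1 e2; have e0 : 0 <= e by exact: le_trans e1.
set dx := x2 - x1; set dy := y2 - y1.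
apply: mx_norm_le => [|i j].
  by rewrite !mulr_ge0 ?addr_ge0// mulr_ge0.
have := @mvt01 (fun t => g (x1 + t *: dx) i j - g (y1 + t *: dy) i j)
  (fun t => 'd g (x1 + t *: dx) dx i j - 'd g (y1 + t *: dy) dy i j)
  (ab * (C + L) * (`|x2 - y2 - (x1 - y1)| + e * `|dy|)).
have -> : x1 + 1 *: dx = x2 by rewrite scale1r addrC subrK.
have -> : y1 + 1 *: dy = y2 by rewrite scale1r addrC subrK.
rewrite !scale0r !addr0 !mxE; apply.
  by move=> t; apply: is_deriveB; exact: is_derive_entry.
move=> t /andP[t0 t1];
move xtE : (x1 + t *: dx) => xt; move ytE : (y1 + t *: dy) => yt.
have dE : x2 - y2 - (x1 - y1) = dx - dy by rewrite subrACA.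
have xyt : `|xt - yt| <= e.
  have -> : xt - yt = (1 - t) *: (x1 - y1) + t *: (x2 - y2).
    by rewrite -xtE -ytE /dx /dy; apply/matrixP => k l; rewrite !mxE; ring.
  apply: le_trans (ler_normD _ _) _; rewrite !normrZ ger0_norm ?subr_ge0// ger0_norm//.
  have -> : e = (1 - t) * e + t * e by ring.
  by apply: lerD; apply: ler_wpM2l; rewrite ?subr_ge0.
clearbody dx dy; clear xtE ytE.
have gen (A1 A2 A3 : 'M[R]_(m, n)) : A1 i j - A3 i j = (A1 - A2 + (A2 - A3)) i j.
  by rewrite !mxE; ring.
pose U := 'd g xt (dx - dy); pose W := 'd g xt dy - 'd g yt dy.
have -> : 'd g xt dx i j - 'd g yt dy i j = (U + W) i j.
  have -> : U = 'd g xt dx - 'd g xt dy by exact: (linearB ('d g xt) dx dy).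
  exact: gen.
apply: le_trans (mx_entry_le (U + W) i j) _; apply: le_trans (ler_normD U W) _.
rewrite dE mulrDr; apply: lerD.
  apply: le_trans (diff_norm_le _ _ _) _; rewrite -mulrA; apply: ler_wpM2l => //.
  rewrite mulrC; apply: ler_wpM2r => //; apply: le_trans (hC _) _; rewrite lerDl//.
apply: le_trans (lin_mxB_norm_le ('d g xt) ('d g yt) dy) _; rewrite -!mulrA.
apply: ler_wpM2l => //; rewrite mulrC mulrA; apply: ler_wpM2r => //.
apply: le_trans (hL yt xt) _; apply: ler_pM => //.
by rewrite lerDr.
Qed.

End VectorField.

(** * Vector-valued paths *)

Section Entries.
Variables (R : realType) (n : nat).
Implicit Types (g h : R -> 'cV[R]_n) (p a b M T : R).

Lemma mx_norm_powR_le p (v : 'cV[R]_n) : 0 < p ->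
  `|v| `^ p <= \sum_(i < n) `|v i ord0| `^ p.
Proof.
move=> p0; have S0 : 0 <= \sum_(i < n) `|v i ord0| `^ p.
  by apply: sumr_ge0 => i _; exact: powR_ge0.
have [v0|v0] := eqVneq `|v| 0; first by rewrite v0 powR0 ?gt_eqF.
have [[i j] /= E] := mx_norm_neq0 v0.
have -> : `|v| = `|v i ord0| by rewrite [LHS]E ord1.
rewrite (bigD1 i)//= lerDl; apply: sumr_ge0 => k _; exact: powR_ge0.
Qed.

Lemma var_le_entry p g i a b M : 0 <= p -> var_le p g a b M ->
  var_le p (fun t => g t i ord0) a b M.
Proof.
move=> p0 h; have := @var_le_lip R _ _ p (fun t => g t i ord0) g 1 a b M p0 ler01.
rewrite powR1 mul1r; apply => // u v _ _ _; rewrite mul1r.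
by have := mx_entry_le (g v - g u) i ord0; rewrite !mxE.
Qed.

Lemma var_le_col p g a b M : 0 < p ->
  (forall i, var_le p (fun t => g t i ord0) a b M) -> var_le p g a b (n%:R * M).
Proof.
move=> p0 h x s ax ps lb.
apply: (@le_trans _ _ (\sum_(i < n) vsum p (fun t => g t i ord0) x s)).
  elim: s x {ax ps lb} => [|y s ih] x /=; first by rewrite big1.
  rewrite big_split/=; apply: lerD (ih _).
  by apply: le_trans (mx_norm_powR_le _ p0) _; apply: ler_sum => i _; rewrite !mxE.
have -> : n%:R * M = \sum_(i < n) M by rewrite sumr_const card_ord mulr_natl.
by apply: ler_sum => i _; exact: h.
Qed.

Lemma rcont_entry T g i : rcont T g -> rcont T (fun t => g t i ord0).
Proof.
move=> rg t t0 tT e e0; have [d d0 h] := rg t t0 tT e e0; exists d => // u tu ud uT.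
apply: le_lt_trans (h u tu ud uT).
by have := mx_entry_le (g u - g t) i ord0; rewrite !mxE.
Qed.

Lemma rcont_col T g : (forall i, rcont T (fun t => g t i ord0)) -> rcont T g.
Proof.
move=> rg t t0 tT e e0; have e20 : 0 < e / 2 by rewrite divr_gt0.
have H (s : seq 'I_n) : exists2 d, 0 < d & forall i u, i \in s ->
    t <= u -> u < t + d -> u <= T -> `|g u i ord0 - g t i ord0| <= e / 2.
  elim: s => [|i s [d d0 h]]; first by exists 1.
  have [d' d'0 h'] := rg i t t0 tT _ e20.
  exists (Num.min d d'); first by rewrite lt_min d0.
  move=> j u; rewrite inE -ltrBlDl lt_min !ltrBlDl => /predU1P[->|js] tu /andP[ud ud'] uT.
    exact/ltW/h'.
  exact: h.
have [d d0 h] := H (enum 'I_n); exists d => // u tu ud uT.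
apply: (@le_lt_trans _ _ (e / 2)); last by lra.
apply: mx_norm_le => [|i j]; first exact: ltW.
by rewrite ord1 !mxE; apply: h => //; rewrite mem_enum.
Qed.

End Entries.

Section DpathClosure.
Variables (R : realType) (T p : R).
Hypothesis p0 : 0 < p.
Implicit Types (V W : normedZmodType R).

Lemma rcont_lip V W (g : R -> V) (h : R -> W) k : 0 <= k ->
  (forall u v, 0 <= u -> u <= v -> v <= T -> `|g v - g u| <= k * `|h v - h u|) ->
  rcont T h -> rcont T g.
Proof.
move=> k0 gh rh t t0 tT e e0.
have k10 : 0 < k + 1 by rewrite ltr_wpDl.
have [d d0 hd] := rh t t0 tT _ (divr_gt0 e0 k10); exists d => // u tu ud uT.
apply: le_lt_trans (gh t u t0 tu uT) _.
apply: le_lt_trans (ler_wpM2l k0 (ltW (hd u tu ud uT))) _.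
by rewrite mulrCA -[ltRHS]mulr1 ltr_pM2l// ltr_pdivrMr// mul1r ltrDl.
Qed.

Lemma Dpath_lip V W (g : R -> V) (h : R -> W) k : 0 <= k ->
  (forall u v, 0 <= u -> u <= v -> v <= T -> `|g v - g u| <= k * `|h v - h u|) ->
  Dpath T p h -> Dpath T p g.
Proof.
move=> k0 gh [rh [M hM]]; split; first exact: rcont_lip gh rh.
by eexists; apply: (var_le_lip (ltW p0) k0 _ hM) => u v; exact: gh.
Qed.

Lemma rcontD V (g h : R -> V) : rcont T g -> rcont T h -> rcont T (fun t => g t + h t).
Proof.
move=> rg rh t t0 tT e e0; have e20 : 0 < e / 2 by rewrite divr_gt0.
have [d d0 hd] := rg t t0 tT _ e20; have [d' d'0 hd'] := rh t t0 tT _ e20.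
exists (Num.min d d'); first by rewrite lt_min d0.
move=> u tu; rewrite -ltrBlDl lt_min !ltrBlDl => /andP[ud ud'] uT.
rewrite opprD addrACA; apply: le_lt_trans (ler_normD _ _) _.
by rewrite [ltRHS]splitr ltrD// ?hd ?hd'.
Qed.

Lemma DpathD V (g h : R -> V) : Dpath T p g -> Dpath T p h -> Dpath T p (fun t => g t + h t).
Proof.
move=> [rg [M hM]] [rh [M' hM']]; split; first exact: rcontD.
by eexists; exact: (var_leD (ltW p0) hM hM').
Qed.

Lemma DpathN V (g : R -> V) : Dpath T p g -> Dpath T p (fun t => - g t).
Proof.
by apply: (@Dpath_lip _ _ _ _ 1) => // u v *; rewrite -opprD normrN mul1r.
Qed.

Lemma DpathB V (g h : R -> V) : Dpath T p g -> Dpath T p h -> Dpath T p (fun t => g t - h t).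
Proof. by move=> hg hh; apply: DpathD => //; exact: DpathN. Qed.

End DpathClosure.

(** * The solution map *)

Section SolutionMap.
Variables (R : realType) (n d : nat) (T p q : R).
Variables (f : 'cV[R]_n -> 'M[R]_(n, d)) (y : 'cV[R]_n) (X L : R -> 'cV[R]_n).
Hypotheses (T0 : 0 <= T) (q1 : 1 <= q) (qp : q <= p) (pq : 1 < p^-1 + q^-1).
Hypotheses (hf : Cb 2 f) (hX : Dpath T p X) (hL : Dpath T p L).
Implicit Types (Y : R -> 'cV[R]_n) (B : R -> 'cV[R]_d) (s t u v M dl : R).

Let p1 : 1 <= p. Proof. exact: le_trans qp. Qed.
Let p0 : 0 < p. Proof. exact: lt_le_trans p1. Qed.

(** A fixed point Y of solution_map is the first component of a solution, and
    reflection_path is the second one.  The obstacle is the barrier minus the path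
    before reflection. *)
Definition unreflected B Y t : 'cV[R]_n := y + yint (f \o Y) B t + X t.
Definition obstacle B Y i t : R := L t i ord0 - unreflected B Y t i ord0.
Definition reflection_path B Y t : 'cV[R]_n := \col_i reflection (obstacle B Y i) t.
Definition solution_map B Y t := unreflected B Y t + reflection_path B Y t.

Lemma reflection_pathE B Y t i : reflection_path B Y t i ord0 = reflection (obstacle B Y i) t.
Proof. by rewrite mxE. Qed.

Let f_lip : exists2 C, 0 <= C & forall x z, `|f z - f x| <= C * `|z - x|.
Proof. by apply: Cb_lipschitz; case: hf => [? ? [? []]]. Qed.

Lemma comp_Dpath Y : Dpath T p Y -> Dpath T p (f \o Y).
Proof.
by have [C C0 hC] := f_lip; apply: (Dpath_lip p0 C0) => u v _ _ _; exact: hC.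
Qed.

Lemma unreflected_Dpath B Y : Dpath T q B -> Dpath T p Y -> Dpath T p (unreflected B Y).
Proof.
move=> hB hY; apply: DpathD => //.
apply: (@Dpath_lip _ _ _ p0 _ _ _ (yint (f \o Y) B) 1) => //.
  by move=> u v _ _ _; rewrite mul1r opprD addrACA subrr add0r.
exact: (yint_Dpath p1 q1 pq T0 qp (comp_Dpath hY) hB).
Qed.

Lemma obstacle_Dpath B Y i : Dpath T q B -> Dpath T p Y -> Dpath T p (obstacle B Y i).
Proof.
move=> hB hY; apply: (DpathB p0).
  apply: (@Dpath_lip _ _ _ p0 _ _ _ L 1) => // u v _ _ _; rewrite mul1r.
  by have := mx_entry_le (L v - L u) i ord0; rewrite !mxE.
apply: (@Dpath_lip _ _ _ p0 _ _ _ (unreflected B Y) 1) => //; last exact: unreflected_Dpath.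
move=> u v _ _ _; rewrite mul1r; move: (unreflected B Y v) (unreflected B Y u) => z1 z2.
by have := mx_entry_le (z1 - z2) i ord0; rewrite !mxE.
Qed.

Lemma obstacle_bounded B Y i : Dpath T q B -> Dpath T p Y -> ubounded T (obstacle B Y i).
Proof.
move=> hB hY; have [_ fl] := obstacle_Dpath i hB hY.
have [N _ hN] := finvar_bounded p0 fl; exists N => t /hN; apply: le_trans.
exact: ler_norm.
Qed.

Lemma reflection_path_mono B Y i u v : Dpath T q B -> Dpath T p Y ->
  0 <= u -> u <= v -> v <= T -> reflection_path B Y u i ord0 <= reflection_path B Y v i ord0.
Proof.
by move=> hB hY *; rewrite !mxE; apply: (reflection_mono (obstacle_bounded i hB hY)).
Qed.

Lemma reflection_path_Dpath B Y : Dpath T q B -> Dpath T p Y -> Dpath T p (reflection_path B Y).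
Proof.
move=> hB hY; split.
  apply: rcont_col => i; apply: (@rcont_lip _ _ _ _ _ (reflection (obstacle B Y i)) 1) => //.
    by move=> u v _ _ _; rewrite !mxE mul1r.
  apply: (reflection_rcont (obstacle_bounded i hB hY)).
  by have [] := obstacle_Dpath i hB hY.
pose M := \sum_(i < n) `|reflection_path B Y T i ord0 - reflection_path B Y 0 i ord0| `^ p.
exists (n%:R * M); apply: var_le_col => // i.
apply: var_le_trans; last by apply: (var_le_mono p1) => u v; exact: reflection_path_mono.
by rewrite /M (bigD1 i)//= lerDl; apply: sumr_ge0 => j _; exact: powR_ge0.
Qed.

Lemma solution_map_Dpath B Y : Dpath T q B -> Dpath T p Y -> Dpath T p (solution_map B Y).
Proof.
by move=> hB hY; apply: DpathD => //; [exact: unreflected_Dpath|exact: reflection_path_Dpath].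
Qed.

(** Left-point sums do not see the integrand at the end point: unreflected at time t
    depends on Y before t only, which is what lets a jump at t be inserted
    explicitly. *)
Lemma unreflected_eq B B' Y Y' t : (forall u, 0 <= u -> u < t -> Y u = Y' u) ->
  (forall u, 0 <= u -> u <= t -> B u = B' u) -> unreflected B Y t = unreflected B' Y' t.
Proof.
move=> hY hB; rewrite /unreflected; congr (_ + _ + _); apply: yint_eq => // u u0 ut.
by rewrite /= hY.
Qed.

Lemma solution_map_eq B B' Y Y' t : (forall u, 0 <= u -> u < t -> Y u = Y' u) ->
  (forall u, 0 <= u -> u <= t -> B u = B' u) -> solution_map B Y t = solution_map B' Y' t.
Proof.
move=> hY hB; have zE : unreflected B Y t = unreflected B' Y' t by exact: unreflected_eq.
have kE : reflection_path B Y t = reflection_path B' Y' t.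
  apply: eq_mx => i j; apply: reflection_eq => r /andP[r0 rt].
  have E : unreflected B Y r = unreflected B' Y' r.
    apply: unreflected_eq => u u0 ur; first by apply: hY => //; exact: lt_le_trans rt.
    by apply: hB => //; exact: le_trans rt.
  by rewrite /obstacle E.
by rewrite /solution_map zE kE.
Qed.

(** Composition with f, integration and reflection are each Lipschitz for the
    p-variation of a difference that vanishes up to time s, and integration brings
    in the q-variation of the driver after s. *)
Lemma solution_map_contraction M : 0 <= M -> exists2 C, 0 <= C & forall B Y Y' s v dl,
  Dpath T q B -> Dpath T p Y -> Dpath T p Y' -> 0 <= s -> s <= v -> v <= T ->
  (forall u, 0 <= u -> u <= s -> Y u = Y' u) ->
  var_le p Y' s v M -> var_le p (fun t => Y t - Y' t) s v dl ->
  var_le p (fun t => solution_map B Y t - solution_map B Y' t) s v (C * var q B s v `^ (p / q) * dl).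
Proof.
move=> M0; have [l l0 hl] := f_lip; have [c c0 hc] := Cb2_increments hf.
have c20 : 0 <= (c * 2) `^ p by exact: powR_ge0.
have lp0 : 0 <= l `^ p by exact: powR_ge0.
have M10 : 0 <= 1 + M by exact: addr_ge0.
pose Ga := l `^ p + (c * 2) `^ p * (1 + M).
have Ga0 : 0 <= Ga by apply: addr_ge0 => //; exact: mulr_ge0.
pose yc := yint_const d p q.
have yc0 : 0 <= yc := yint_const_ge0 d pq.
have ycp0 : 0 <= yc `^ p by exact: powR_ge0.
exists (2 `^ p * (1 + n%:R) * (yc `^ p * Ga)).
  apply: mulr_ge0; last exact: mulr_ge0.
  by apply: mulr_ge0; [exact: powR_ge0|exact: addr_ge0].
move=> B Y Y' s v dl hB hY hY' s0 sv vT YY vY' vD.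
have dl0 : 0 <= dl := var_le_ge0 sv vD.
have Gd0 : 0 <= Ga * dl by exact: mulr_ge0.
have pn0 : p != 0 by rewrite gt_eqF.
have [e eE e0] : exists2 e, e `^ p = dl & 0 <= e.
  by exists (dl `^ p^-1); [rewrite powRVK|exact: powR_ge0].
have [N NE N0] : exists2 N, N `^ p = Ga * dl & 0 <= N.
  by exists ((Ga * dl) `^ p^-1); [rewrite powRVK|exact: powR_ge0].
have root x z : 0 <= x -> 0 <= z -> x `^ p <= z `^ p -> x <= z.
  move=> x0 z0 /(powR_le_inv p0 x0 (powR_ge0 _ _)); by rewrite powRK.
have D_le t : s <= t <= v -> `|Y t - Y' t| <= e.
  move=> /andP[st tv]; apply: root => //; rewrite eE.
  have := var_le_incr vD (lexx _) st tv p0.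
  by rewrite (YY s s0 (lexx s)) [Y' s - _]subrr subr0.
pose G t := f (Y t) - f (Y' t).
have G_le t : s <= t <= v -> `|G t| <= N.
  move=> /D_le h; apply: root => //.
  apply: (@le_trans _ _ ((l * e) `^ p)).
    apply: powR_le => //; first exact: ltW.
    by apply: le_trans (hl _ _) _; exact: ler_wpM2l.
  rewrite powRM// eE NE; apply: ler_wpM2r => //.
  by rewrite lerDl mulr_ge0.
have vG : var_le p G s v (N `^ p).
  have H : var_le p G s v ((c * 2) `^ p * dl + (c * 2) `^ p * dl * M).
    apply: (var_le_comp2 c20 (mulr_ge0 c20 dl0) _ vD vY') => u w su uw wv.
    have hu : s <= u <= v by rewrite su (le_trans uw).
    have hw : s <= w <= v by rewrite wv (le_trans su).
    have h := hc (Y u) (Y w) (Y' u) (Y' w) e (D_le u hu) (D_le w hw).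
    apply: le_trans (powR_le (ltW p0) (normr_ge0 _) h) _.
    move: (normr_ge0 (Y w - Y' w - (Y u - Y' u))) (normr_ge0 (Y' w - Y' u)).
    move: `|Y w - Y' w - (Y u - Y' u)| `|Y' w - Y' u| => a b a0 b0.
    have eb0 : 0 <= e * b by exact: mulr_ge0.
    rewrite powRM// ?addr_ge0//.
    apply: le_trans (ler_wpM2l (powR_ge0 c p) (powR_add_le (ltW p0) a0 eb0)) _.
    rewrite (powRM p c0)// (powRM p e0)// eE le_eqVlt; apply/orP; left.
    by apply/eqP; ring.
  apply: var_le_trans H; rewrite NE /Ga.
  have -> : (l `^ p + (c * 2) `^ p * (1 + M)) * dl =
      l `^ p * dl + ((c * 2) `^ p * dl + (c * 2) `^ p * dl * M) by ring.
  by rewrite lerDr mulr_ge0.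
have hfY := comp_Dpath hY; have hfY' := comp_Dpath hY'.
have hG : Dpath T p G by exact: (DpathB p0 hfY hfY').
move EE : (var q B s v `^ (p / q)) => E.
have E0 : 0 <= E by rewrite -EE; exact: powR_ge0.
have := yint_var_le p1 q1 pq T0 qp hG hB s0 vT G_le vG N0.
rewrite -/yc powRM// NE EE => vJ.
move SE : (yc `^ p * (Ga * dl) * E) => S; rewrite SE in vJ.
have vz : var_le p (fun t => unreflected B Y t - unreflected B Y' t) s v S.
  apply: var_le_eq vJ => t /andP[st tv].
  have t0 := le_trans s0 st; have tT := le_trans tv vT.
  have -> := yintB p1 q1 pq T0 hfY hfY' hB t0 tT.
  rewrite /unreflected; move: (yint _ _ _) (yint _ _ _) => I1 I2.
  by apply/matrixP => i j; rewrite !mxE; ring.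
have vk i : var_le p (fun t => (reflection_path B Y t - reflection_path B Y' t) i ord0) s v S.
  have vl : var_le p (fun t => obstacle B Y i t - obstacle B Y' i t) s v S.
    have := var_leN (var_le_entry i (ltW p0) vz).
    apply: var_le_eq => t _; rewrite /obstacle; move: (unreflected B Y t) (unreflected B Y' t) => z1 z2.
    by rewrite !mxE; ring.
  have ll t : 0 <= t <= s -> obstacle B Y i t = obstacle B Y' i t.
    move=> /andP[t0 ts]; have zE : unreflected B Y t = unreflected B Y' t.
      by apply: unreflected_eq => // u u0 ut; apply: YY => //; rewrite (le_trans (ltW ut)).
    by rewrite /obstacle zE.
  have := reflection_var_le p1 (obstacle_bounded i hB hY) (obstacle_bounded i hB hY') s0 sv vT ll vl.
  by apply: var_le_eq => t _; rewrite !mxE.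
have := var_leD (ltW p0) vz (var_le_col p0 vk).
have -> : 2 `^ p * (S + n%:R * S) = 2 `^ p * (1 + n%:R) * (yc `^ p * Ga) * E * dl.
  by rewrite -SE; ring.
by apply: var_le_eq => t _; exact: addrBACA.
Qed.

(** Because f is bounded the integral contributes a term that is small with the
    driver, while the reflection term grows by at most the oscillation of the
    barrier and of the path before reflection.  That C0 does not depend on Y is
    what makes the length of the extension steps uniform. *)
Lemma solution_map_growth : exists C0 C1, [/\ 0 <= C0, 0 <= C1 & forall B Y s v M,
  Dpath T q B -> Dpath T p Y -> 0 <= s -> s <= v -> v <= T -> var_le p Y s v M ->
  var_le p (solution_map B Y) s v (C0 + C1 * (1 + M) * var q B s v `^ (p / q))].
Proof.
have [l l0 hl] := f_lip.
have [cf cf0 hcf] : exists2 C, 0 <= C & forall x, `|f x| <= C.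
  by apply: bounded_fun_ex; case: hf.
have [_ [VX hVX]] := hX; have [_ [VL hVL]] := hL.
have VX0 := var_le_ge0 T0 hVX; have VL0 := var_le_ge0 T0 hVL.
have [yc ycE] : exists yc, yint_const d p q = yc by eexists.
have yc0 : 0 <= yc by rewrite -ycE; exact: yint_const_ge0.
have [k2 k2E] : exists k, 2 `^ p = k :> R by eexists.
have k20 : 0 <= k2 by rewrite -k2E; exact: powR_ge0.
have [D DE] : exists D, k2 * (1 + n%:R * k2) = D by eexists.
have D0 : 0 <= D by rewrite -DE mulr_ge0// addr_ge0// mulr_ge0.
have ycp0 : 0 <= yc `^ p by exact: powR_ge0.
have lp0 : 0 <= l `^ p by exact: powR_ge0.
have cp0 : 0 <= cf `^ p by exact: powR_ge0.
exists (D * (k2 * VX) + k2 * (n%:R * (k2 * VL))), (D * (k2 * (yc `^ p * (cf `^ p + l `^ p)))).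
split.
- by apply: addr_ge0; apply: mulr_ge0 => //; apply: mulr_ge0 => //; exact: mulr_ge0.
- apply: mulr_ge0 => //; apply: mulr_ge0 => //; apply: mulr_ge0 => //; exact: addr_ge0.
move=> B Y s v M hB hY s0 sv vT vY.
have M0 := var_le_ge0 sv vY.
have hfY := comp_Dpath hY.
have pn0 : p != 0 by rewrite gt_eqF.
have [a aE] : exists a, cf `^ p + l `^ p * M = a by eexists.
have lM0 : 0 <= l `^ p * M by exact: mulr_ge0.
have a0 : 0 <= a by rewrite -aE addr_ge0.
have [N NE N0] : exists2 N, N `^ p = a & 0 <= N.
  by exists (a `^ p^-1); [rewrite powRVK|exact: powR_ge0].
have f_le t : s <= t <= v -> `|(f \o Y) t| <= N.
  move=> _; rewrite -(powRK pn0 N0) NE; apply: powR_le_inv => //.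
  apply: (@le_trans _ _ (cf `^ p)); last by rewrite -aE lerDl.
  by apply: powR_le => //; [exact: ltW|exact: hcf].
have vf : var_le p (f \o Y) s v (N `^ p).
  rewrite NE; apply: var_le_trans (var_le_lip (ltW p0) l0 _ vY).
    by rewrite -aE lerDr.
  by move=> u w _ _ _; exact: hl.
move EE : (var q B s v `^ (p / q)) => E.
have E0 : 0 <= E by rewrite -EE; exact: powR_ge0.
have := yint_var_le p1 q1 pq T0 qp hfY hB s0 vT f_le vf N0.
rewrite ycE powRM// NE EE => vJ.
move JE : (yc `^ p * a * E) => J; rewrite JE in vJ.
have J0 : 0 <= J by rewrite -JE; apply: mulr_ge0 => //; exact: mulr_ge0.
move ZE : (k2 * (J + VX)) => Z.
have Z0 : 0 <= Z by rewrite -ZE mulr_ge0// addr_ge0.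
have vz : var_le p (unreflected B Y) s v Z.
  rewrite -ZE -k2E; apply: (var_leD (ltW p0)); last exact: var_le_sub hVX.
  have := @var_le_lip R _ _ p (fun t => y + yint (f \o Y) B t) (yint (f \o Y) B) 1 s v J (ltW p0) ler01.
  rewrite powR1 mul1r; apply => // u w _ _ _.
  by rewrite mul1r opprD addrACA subrr add0r.
have vk i : var_le p (fun t => reflection_path B Y t i ord0) s v (k2 * (VL + Z)).
  have km u w : s <= u -> u <= w -> w <= v -> reflection_path B Y u i ord0 <= reflection_path B Y w i ord0.
    by move=> su uw wv; apply: reflection_path_mono => //; [exact: le_trans su|exact: le_trans vT].
  apply: var_le_trans (var_le_mono p1 km).
  have [m mE] : exists m, VL `^ p^-1 + Z `^ p^-1 = m by eexists.
  apply: (@le_trans _ _ (m `^ p)); last first.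
    rewrite -mE -k2E; apply: le_trans (powR_add_le (ltW p0) (powR_ge0 _ _) (powR_ge0 _ _)) _.
    by rewrite !powRVK.
  have m0 : 0 <= m by rewrite -mE addr_ge0// powR_ge0.
  apply: powR_le => //; first exact: ltW.
  rewrite ger0_norm ?subr_ge0 ?km// lerBlDl !mxE.
  apply: (reflection_osc (obstacle_bounded i hB hY)) => // r /andP[sr rv].
  rewrite -lerBlDl /obstacle subrACA; apply: le_trans (ler_norm _) _.
  rewrite -mE; apply: le_trans (ler_normB _ _) _; apply: lerD; apply: powR_le_inv => //.
    by apply: (var_le_incr (var_le_entry i (ltW p0) hVL)) => //; exact: le_trans vT.
  exact: (var_le_incr (var_le_entry i (ltW p0) vz)).
have := var_leD (ltW p0) vz (var_le_col p0 vk).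
apply: var_le_trans; rewrite k2E.
have -> : k2 * (Z + n%:R * (k2 * (VL + Z))) = D * Z + k2 * (n%:R * (k2 * VL)).
  by rewrite -DE; ring.
have Jle : J <= yc `^ p * (cf `^ p + l `^ p) * (1 + M) * E.
  rewrite -JE; apply: ler_wpM2r => //; rewrite -mulrA; apply: ler_wpM2l => //.
  rewrite -aE mulrDr mulr1; apply: lerD; first by rewrite lerDl.
  by apply: ler_wpM2r => //; rewrite lerDr.
have h : D * Z <= D * (k2 * (yc `^ p * (cf `^ p + l `^ p) * (1 + M) * E + VX)).
  by rewrite -ZE; apply: ler_wpM2l => //; apply: ler_wpM2l => //; rewrite lerD2r.
apply: le_trans (lerD h (lexx _)) _; rewrite le_eqVlt; apply/orP; left; apply/eqP; ring.
Qed.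

End SolutionMap.

(** * Picard iteration *)

Section FixedPoint.
Variables (R : realType) (n d : nat) (T p q : R).
Variables (f : 'cV[R]_n -> 'M[R]_(n, d)) (y : 'cV[R]_n) (X L : R -> 'cV[R]_n).
Hypotheses (T0 : 0 <= T) (q1 : 1 <= q) (qp : q <= p) (pq : 1 < p^-1 + q^-1).
Hypotheses (hf : Cb 2 f) (hX : Dpath T p X) (hL : Dpath T p L).
Implicit Types (Y : R -> 'cV[R]_n) (B A : R -> 'cV[R]_d) (s t u v M dl e : R).

Let p1 : 1 <= p. Proof. exact: le_trans qp. Qed.
Let p0 : 0 < p. Proof. exact: lt_le_trans p1. Qed.

Local Notation Phi := (solution_map f y X L).

Lemma stop_Dpath Y s : 0 <= s -> s <= T -> Dpath T p Y ->
  Dpath T p (fun t => Y (Num.min t s)).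
Proof.
move=> s0 sT [rY [M hM]]; split; last first.
  by exists M; apply: var_le_minr => //; apply: var_le_sub hM.
move=> t t0 tT e e0; have [st|ts] := leP s t.
  exists 1 => // u tu _ _; rewrite !min_r ?subrr ?normr0//; exact: le_trans tu.
have [dl dl0 h] := rY t t0 tT e e0.
exists dl => // u tu ud uT; apply: h => //.
- by rewrite le_min tu ltW.
- by rewrite gt_min ud.
- by rewrite ge_min uT.
Qed.

(** Extension of a fixed point beyond time s by Picard iteration, as long as
    the driver varies little after s; the admissible variation eps does not
    depend on the fixed point that is extended. *)
Lemma picard_extension : exists2 eps, 0 < eps & forall B Y0 s,
  Dpath T q B -> Dpath T p Y0 -> 0 <= s -> s <= T ->
  var q B s T `^ (p / q) <= eps ->
  (forall u, 0 <= u -> u <= s -> Phi B Y0 u = Y0 u) ->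
  exists2 Y, Dpath T p Y & forall u, 0 <= u -> u <= T -> Phi B Y u = Y u.
Proof.
have [C0 [C1 [C00 C10 growth]]] := solution_map_growth y T0 q1 qp pq hf hX hL.
(* The ball of radius M is preserved as soon as the driver contributes at most 1. *)
pose M := C0 + 1; have M0 : 0 <= M by rewrite addr_ge0.
have [C CC0 contr] := solution_map_contraction y T0 q1 qp pq hf hX hL M0.
have [K2 K2E] : exists k, 2 `^ p = k :> R by eexists.
have K21 : 1 <= K2 by rewrite -K2E -[leLHS](powRr0 2); apply: ler_powR; [rewrite ler1n|exact: ltW].
(* This ratio absorbs the factor K2 lost at each quasi-triangle inequality. *)
pose la := (2 * K2)^-1.
have K20 : 0 < 2 * K2 by lra.
have la0 : 0 < la by rewrite invr_gt0.
have la1 : la < 1 by rewrite invf_lt1; lra.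
have laK : 2 * K2 * la = 1 by rewrite divff// gt_eqF.
pose D := C1 * (1 + M) + C + 1.
have CM0 : 0 <= C1 * (1 + M) by rewrite mulr_ge0// addr_ge0.
have D0 : 0 < D by rewrite ltr_wpDl// addr_ge0.
exists (la / D); first by rewrite divr_gt0.
move=> B Y0 s hB hY0 s0 sT.
move: (powR_ge0 (var q B s T) (p / q)) => E0 hE fixY0.
have {}growth Y M' hY := @growth B Y s T M' hB hY s0 sT (lexx T).
have {}contr Y Y' dl hY hY' := @contr B Y Y' s T dl hB hY hY' s0 sT (lexx T).
move: (var q B s T `^ (p / q)) E0 hE growth contr => E E0 hE growth contr.
have ED : E * D <= la by rewrite -ler_pdivlMr.
have E1 : C1 * (1 + M) * E <= 1.
  apply: le_trans (ltW la1); apply: le_trans ED; rewrite mulrC; apply: ler_wpM2l => //.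
  by rewrite /D -addrA lerDl addr_ge0.
have E2 : C * E <= la.
  apply: le_trans ED; rewrite mulrC; apply: ler_wpM2l => //; rewrite /D; lra.
clear D D0 ED hE.
pose Z k := iter k (Phi B) (fun t => Y0 (Num.min t s)).
have Z_D k : Dpath T p (Z k).
  elim: k => [|k ih]; first exact: stop_Dpath.
  exact: (solution_map_Dpath y T0 q1 qp pq hf hX hL hB ih).
have Z_eq k u : 0 <= u -> u <= s -> Z k u = Y0 u.
  elim: k u => [|k ih] u u0 us; first by rewrite /Z /= min_l.
  rewrite /Z iterS -/(Z k) -(fixY0 u u0 us); apply: solution_map_eq => // w w0 wu.
  by apply: ih => //; rewrite (le_trans (ltW wu)).
have Z_M k : var_le p (Z k) s T M.
  elim: k => [|k ih].
    apply: var_le_trans M0 _; apply: var_le_cst => // t /andP[st _].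
    by rewrite /Z /= min_r// minxx.
  rewrite /Z iterS -/(Z k); apply: var_le_trans (growth _ _ (Z_D k) ih).
  by rewrite /M lerD2l.
have Z_D0 k u j : 0 <= u -> u <= s -> Z j u = Z k u by move=> *; rewrite !Z_eq.
have [c0 c0E] : exists c, K2 * (M + M) = c by eexists.
have c00 : 0 <= c0 by rewrite -c0E mulr_ge0 ?addr_ge0//; lra.
have dist1 k : var_le p (fun t => Z k.+1 t - Z k t) s T (c0 * la ^+ k).
  elim: k => [|k ih].
    by rewrite expr0 mulr1 -c0E -K2E; apply: var_leB => //; exact: ltW.
  have := contr _ _ _ (Z_D k.+1) (Z_D k) (fun w w0 ws => Z_D0 k w k.+1 w0 ws) (Z_M k) ih.
  apply: var_le_trans; apply: (@le_trans _ _ (la * (c0 * la ^+ k))).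
    by apply: ler_wpM2r => //; rewrite mulr_ge0// exprn_ge0// ltW.
  by rewrite exprS mulrCA.
have [c cE] : exists c, 2 * K2 * c0 = c by eexists.
have c_ge0 : 0 <= c by rewrite -cE mulr_ge0// ltW.
have lak k : 0 <= la ^+ k by rewrite exprn_ge0// ltW.
have dist j k : var_le p (fun t => Z (k + j)%N t - Z k t) s T (c * la ^+ k).
  elim: j k => [|j ih] k.
    apply: var_le_trans (mulr_ge0 c_ge0 (lak k)) _; apply: var_le_cst => // t _.
    by rewrite addn0 !subrr.
  have := var_leD (ltW p0) (ih k.+1) (dist1 k); rewrite addSnnS.
  have -> : 2 `^ p * (c * la ^+ k.+1 + c0 * la ^+ k) = c * la ^+ k.
    have e1 : c * la ^+ k.+1 = c0 * la ^+ k.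
      have -> : c * la ^+ k.+1 = 2 * K2 * la * (c0 * la ^+ k) by rewrite -cE exprS; ring.
      by rewrite laK mul1r.
    by rewrite e1 K2E -cE; ring.
  by apply: var_le_eq => t _; rewrite addrA subrK.
pose r k := (c * la ^+ k) `^ p^-1.
have pn0 : p != 0 by rewrite gt_eqF.
have r_small e : 0 < e -> exists k : nat, forall j, (k <= j)%N -> r j < e.
  move=> e0; have [k hk] := geometric_small c (ltW la0) la1 (powR_gt0 p e0).
  exists k => j /hk h; rewrite -(powRK pn0 (ltW e0)); apply: gt0_ltr_powR => //.
  - by rewrite invr_gt0.
  - by rewrite nnegrE mulr_ge0.
  - by rewrite nnegrE powR_ge0.
have point (W : R -> 'cV[R]_n) x u : var_le p W s T x -> W s = 0 -> s <= u -> u <= T ->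
    `|W u| <= x `^ p^-1.
  move=> vW Ws su uT; apply: powR_le_inv => //; first exact: var_le_ge0 vW.
  by have := var_le_incr vW (lexx _) su uT p0; rewrite Ws subr0.
have distp k j u : 0 <= u -> u <= T -> `|Z (k + j)%N u - Z k u| <= r k.
  move=> u0 uT; have [us|/ltW su] := leP u s.
    by rewrite (Z_D0 k u (k + j)%N u0 us) subrr normr0 powR_ge0.
  apply: (point _ _ _ (dist j k)) => //.
  by rewrite (Z_D0 k s (k + j)%N s0 (lexx s)) subrr.
pose Y u := lim (Z k u @[k --> \oo]).
have Y_cvg u : 0 <= u -> u <= T -> Z k u @[k --> \oo] --> Y u.
  move=> u0 uT; suff : cvg (Z k u @[k --> \oo]) by [].
  apply/cauchy_cvgP/cauchyP => e e0; have [k hk] := r_small e e0.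
  exists (Z k u); exists k => // j /= kj; rewrite -ball_normE /ball_/= distrC.
  by rewrite -(subnKC kj); apply: le_lt_trans (distp _ _ _ u0 uT) (hk k (leqnn k)).
have distY k u : 0 <= u -> u <= T -> `|Y u - Z k u| <= r k.
  move=> u0 uT; apply/ler_addgt0Pr => e e0.
  have /cvgrPdist_lt/(_ e e0)[m _ hm] := Y_cvg u u0 uT.
  apply: le_trans (ler_distD (Z (k + m)%N u) _ _) _; rewrite addrC; apply: lerD.
    exact: distp.
  by apply/ltW/hm; rewrite /= leq_addl.
have Y_eq u : 0 <= u -> u <= s -> Y u = Y0 u.
  move=> u0 us; apply/eqP; rewrite -subr_eq0 -normr_le0; apply/ler_addgt0Pr => e e0.
  have [k /(_ k (leqnn k)) hk] := r_small e e0.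
  by rewrite add0r -(Z_eq k u u0 us) (le_trans (distY k u u0 (le_trans us sT)))// ltW.
have Y_M : var_le p Y s T M.
  apply: var_le_lsc => // e e0; have [k /(_ k (leqnn k)) hk] := r_small e e0.
  exists (Z k) => // z /andP[sz zT]; rewrite distrC.
  by apply: le_lt_trans hk; apply: distY => //; exact: le_trans sz.
have Y_dist k : var_le p (fun t => Y t - Z k t) s T (c * la ^+ k).
  apply: var_le_lsc => // e e0; have [j /(_ (k + j)%N (leq_addl _ _)) hj] := r_small e e0.
  exists (fun t => Z (k + j)%N t - Z k t); first exact: dist.
  move=> z /andP[sz zT]; rewrite subrACA subrr subr0 distrC.
  by apply: le_lt_trans hj; apply: distY => //; exact: le_trans sz.
have Y_D : Dpath T p Y.
  split.
    move=> t t0 tT e e0; have e30 : 0 < e / 3 by rewrite divr_gt0.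
    have [k /(_ k (leqnn k)) hk] := r_small _ e30.
    have [rZ _] := Z_D k; have [dl dl0 hd] := rZ t t0 tT _ e30.
    exists dl => // u tu ud uT; have u0 := le_trans t0 tu.
    have h1 := distY k u u0 uT; have h2 := distY k t t0 (ltW tT).
    have h3 := hd u tu ud uT.
    apply: le_lt_trans (ler_distD (Z k u) _ _) _.
    apply: le_lt_trans (lerD h1 (ler_distD (Z k t) _ _)) _.
    move: h2 h3 hk; rewrite [`|Z k t - _|]distrC.
    by set x1 := `|_|; set x2 := `|_|; set x3 := r k; lra.
  have [M1 hM1] := (Z_D 0).2.
  have h : var_le p (fun t => Y (Num.max t s) - Z 0 (Num.max t s)) 0 T (c * la ^+ 0).
    exact: (@var_le_maxr R _ p (fun t => Y t - Z 0 t)).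
  eexists; apply: (var_le_eq _ (var_leD (ltW p0) hM1 h)) => t /andP[t0 tT].
  have [ts|/ltW st] := leP t s; last by rewrite addrC subrK.
  by rewrite (Y_eq s)// (Z_eq 0 s)// subrr addr0 (Z_eq 0)// Y_eq.
exists Y => // u u0 uT; have [us|/ltW su] := leP u s.
  rewrite Y_eq// -(fixY0 u u0 us); apply: solution_map_eq => // w w0 wu.
  by rewrite Y_eq// (le_trans (ltW wu)).
apply/eqP; rewrite -subr_eq0 -normr_le0; apply/ler_addgt0Pr => e e0; rewrite add0r.
have Y_Z k u' : 0 <= u' -> u' <= s -> Y u' = Z k u' by move=> *; rewrite Y_eq// Z_eq.
have step k : var_le p (fun t => Phi B Y t - Y t) s T (2 * K2 * la * (c * la ^+ k)).
  have h1 : var_le p (fun t => Phi B Y t - Phi B (Z k) t) s T (la * (c * la ^+ k)).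
    apply: var_le_trans (contr _ _ _ Y_D (Z_D k) (Y_Z k) (Z_M k) (Y_dist k)).
    by apply: ler_wpM2r => //; rewrite mulr_ge0.
  have h2 : var_le p (fun t => Y t - Z k.+1 t) s T (la * (c * la ^+ k)).
    by rewrite mulrCA -exprS; exact: Y_dist.
  have := var_leB (ltW p0) h1 h2; rewrite K2E.
  have -> : K2 * (la * (c * la ^+ k) + la * (c * la ^+ k)) = 2 * K2 * la * (c * la ^+ k) by ring.
  apply: var_le_eq => t _; rewrite /Z iterS -/(Z k).
  by rewrite subrACA [X in _ - X]subrr subr0.
have [k /(_ k (leqnn k)) hk] := r_small e e0.
apply: le_trans (ltW hk); rewrite /r; apply: (point (fun t => Phi B Y t - Y t)) => //.
  by have := step k; rewrite laK mul1r.
rewrite (Y_eq s s0 (lexx s)) -(fixY0 s s0 (lexx s)).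
rewrite (@solution_map_eq _ _ _ f y X L B B Y Y0 s) ?subrr// => w w0 wu.
by rewrite Y_eq// ltW.
Qed.

End FixedPoint.

(** * Existence and uniqueness of the fixed point *)

Section LeftLimit.
Variables (R : realType) (m : nat).
Implicit Types (g : R -> 'cV[R]_m) (T t u v e q M : R).

Lemma llim_ex T g t : llim T g -> 0 < t -> t <= T ->
  exists l, forall e, 0 < e -> exists u, [/\ 0 <= u, u < t & forall v, u <= v -> v < t -> `|g v - l| < e].
Proof.
move=> lg t0 tT; pose F := g u @[u --> t^'-].
have near_lt u : u < t -> \forall v \near t^'-, u <= v /\ v < t.
  move=> ut; near=> v; split; first by near: v; exact: nbhs_left_ge.
  by near: v; exact: nbhs_left_lt.
have : cvg F.
  apply/cauchy_cvgP/cauchyP => e e0; have [u [u0 ut hu]] := lg t t0 tT e e0.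
  exists (g u); move: (near_lt u ut); apply: filterS => v [uv vt] /=.
  by rewrite -ball_normE /ball_/=; apply: hu.
move=> /cvg_ex[l hl]; exists l => e e0.
have e20 : 0 < e / 2 by rewrite divr_gt0.
have [u [u0 ut hu]] := lg t t0 tT _ e20; exists u; split => // v uv vt.
have /cvgrPdist_lt/(_ _ e20) hn := hl.
have [w [[uw wt] wl]] : exists w, (u <= w /\ w < t) /\ `|l - g w| < e / 2.
  by apply: (@filter_ex _ (t^'-)); apply: filterI (near_lt u ut) hn.
apply: le_lt_trans (ler_distD (g w) _ _) _; rewrite [ltRHS]splitr ltrD//.
  exact: hu.
by rewrite distrC.
Unshelve. all: by end_near. Qed.

(** The driver deprived of its jump at t: the extension step first solves the
    equation up to t, excluded. *)
Definition stop_before g t (l : 'cV[R]_m) u := if u < t then g u else l.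

Definition left_limit g t l := forall e, 0 < e ->
  exists u, [/\ 0 <= u, u < t & forall v, u <= v -> v < t -> `|g v - l| < e].

Lemma stop_before_var_le T q g t l s M : 0 < q -> left_limit g t l -> llim T g ->
  0 < t -> t <= T -> 0 <= s -> s < t -> (forall v, v < t -> var_le q g s v M) ->
  var_le q (stop_before g t l) s T M.
Proof.
move=> q0 hl lg t0 tT s0 st hM; apply: var_le_lsc => // e e0.
have [u1 [u10 u1t hu1]] := hl e e0; have [u2 [u20 u2t hu2]] := lg t t0 tT e e0.
pose v := Num.max s (Num.max u1 u2).
have vt : v < t by rewrite !gt_max st u1t.
have [sv u1v u2v] : [/\ s <= v, u1 <= v & u2 <= v] by split; rewrite !le_max lexx ?orbT.
exists (fun z => g (Num.min z v)); first by apply: var_le_minr => //; exact: hM.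
move=> z _ /=; rewrite /stop_before; case: (ltP z t) => [zt|tz].
  have [zv|/ltW vz] := leP z v; first by rewrite subrr normr0.
  by apply: hu2 => //; exact: le_trans vz.
by rewrite min_r; [exact: hu1|exact: le_trans (ltW vt) tz].
Qed.

Lemma stop_before_Dpath T q g t l : 0 < q -> left_limit g t l ->
  0 < t -> t <= T -> Dpath T q g -> Dpath T q (stop_before g t l).
Proof.
move=> q0 hl t0 tT [rg fg]; have [M hM] := fg; split; last first.
  exists M; apply: stop_before_var_le (finvar_llim q0 fg) _ _ _ _ _ => // v vt.
  by apply: var_le_sub hM => //; rewrite (le_trans _ tT)// ltW.
move=> r r0 rT e e0; rewrite /stop_before; case: (ltP r t) => [rt|tr].
  have [d d0 h] := rg r r0 rT e e0; exists (Num.min d (t - r)).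
    by rewrite lt_min d0 subr_gt0.
  move=> u ru; rewrite -ltrBlDl lt_min ltrBlDl ltrD2r => /andP[ud ut] uT.
  by rewrite ut; apply: h.
exists 1 => // u ru _ _; case: (ltP u t) => [ut|_]; last by rewrite subrr normr0.
by have := le_lt_trans (le_trans tr ru) ut; rewrite ltxx.
Qed.

End LeftLimit.

Section Existence.
Variables (R : realType) (n d : nat) (T p q : R).
Variables (f : 'cV[R]_n -> 'M[R]_(n, d)) (y : 'cV[R]_n) (X L : R -> 'cV[R]_n).
Variable A : R -> 'cV[R]_d.
Hypotheses (T0 : 0 <= T) (q1 : 1 <= q) (qp : q <= p) (pq : 1 < p^-1 + q^-1).
Hypotheses (hf : Cb 2 f) (hX : Dpath T p X) (hL : Dpath T p L) (hA : Dpath T q A).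
Implicit Types (Y : R -> 'cV[R]_n) (s t u v M dl e : R).

Let p1 : 1 <= p. Proof. exact: le_trans qp. Qed.
Let p0 : 0 < p. Proof. exact: lt_le_trans p1. Qed.
Let q0 : 0 < q. Proof. exact: lt_le_trans q1. Qed.

Local Notation Phi := (solution_map f y X L).

(** The variation of A on [s, t[ tends to 0 as s and t come together from either
    side, whereas a jump at t may be large. *)
Lemma small_variation_induction (Q : R -> Prop) e : 0 < e -> Q 0 ->
  (forall s t, 0 <= s -> s < t -> t <= T -> (forall v, v < t -> var_le q A s v e) ->
     Q s -> Q t) -> Q T.
Proof.
move=> e0 Q0 step; have [rA fA] := hA.
apply: (@real_induction R T Q (fun s t => forall v, v < t -> var_le q A s v e)) => //.
- move=> t t0 tT.
  have [u [tu uT hu]] := finvar_right q0 rA t0 tT (finvar_sub t0 (lexx _) fA) e0.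
  by exists u; split => // v vu; apply: var_le_sub hu => //; exact: ltW.
- move=> t t0 tT.
  have [u [u0 ut hu]] := finvar_left t0 (finvar_sub (lexx _) tT fA) e0.
  by exists u; split => // v uv vt w wt; apply: var_le_sub (hu w wt).
Qed.

Lemma powR_ratio_le e x : 0 < e -> 0 <= x -> x <= e `^ (q / p) -> x `^ (p / q) <= e.
Proof.
move=> e0 x0 h; have pq0 : 0 <= p / q by rewrite ltW// divr_gt0.
apply: le_trans (powR_le pq0 x0 h) _; rewrite -powRrM.
have -> : q / p * (p / q) = 1 by rewrite mulrA divfK ?divff ?gt_eqF.
by rewrite powRr1// ltW.
Qed.

(** One step of the induction extends the fixed point to [0, t[ by Picard
    iteration with the driver stopped before t; one further application of the
    solution map with the full driver then inserts the jump at t. *)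
Lemma fixed_point_ex : exists2 Y, Dpath T p Y &
  forall u, 0 <= u -> u <= T -> Phi A Y u = Y u.
Proof.
have [eps eps0 hpic] := picard_extension y T0 q1 qp pq hf hX hL.
pose Q t := exists2 Y, Dpath T p Y & forall u, 0 <= u -> u <= t -> Phi A Y u = Y u.
suff : Q T by [].
have e0 : 0 < eps `^ (q / p) by exact: powR_gt0.
apply: (small_variation_induction e0) => [|s t s0 st tT hv [Y0 hY0 fixY0]].
  have D0 : Dpath T p (fun _ : R => 0 : 'cV[R]_n).
    split; first by move=> t *; exists 1 => // *; rewrite subrr normr0.
    by exists 0; exact: var_le_cst.
  exists (Phi A (fun=> 0)); first exact: (solution_map_Dpath y T0 q1 qp pq hf hX hL hA D0).
  move=> u u0 u0'; have -> : u = 0 by apply/eqP; rewrite eq_le u0 u0'.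
  by apply: solution_map_eq => // w w0 /(le_lt_trans w0); rewrite ltxx.
have t0 : 0 < t by exact: le_lt_trans st.
have [rA fA] := hA; have lA := finvar_llim q0 fA.
have [l hl] := llim_ex lA t0 tT.
pose B := stop_before A t l.
have BA u : u < t -> B u = A u by rewrite /B /stop_before => ->.
have hB : Dpath T q B by exact: stop_before_Dpath.
have vB : var q B s T `^ (p / q) <= eps.
  have sT := le_trans (ltW st) tT; have [_ fB] := hB.
  apply: powR_ratio_le => //; first by apply: var_ge0 => //; exact: finvar_sub fB.
  by apply: var_lub => //; apply: stop_before_var_le hv.
have fixB u : 0 <= u -> u <= s -> Phi B Y0 u = Y0 u.
  move=> u0 us; apply: etrans (fixY0 u u0 us); apply: solution_map_eq => [//|w w0 wu].
  by apply: BA; exact: le_lt_trans (le_trans wu us) st.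
have [Y hY fixY] := hpic B Y0 s hB hY0 s0 (le_trans (ltW st) tT) vB fixB.
exists (Phi A Y); first exact: (solution_map_Dpath y T0 q1 qp pq hf hX hL hA hY).
move=> u u0 ut; apply: solution_map_eq => [w w0 wu|//].
have wt := lt_le_trans wu ut.
apply: etrans (fixY w w0 (le_trans (ltW wt) tT)).
by apply: solution_map_eq => [//|r r0 rw]; apply/esym/BA; exact: le_lt_trans wt.
Qed.

(** On a step of small variation the difference of two fixed points is at most half
    of itself; at the end of the step both values are given by the same past. *)
Lemma fixed_point_unique Y Y' : Dpath T p Y -> Dpath T p Y' ->
  (forall u, 0 <= u -> u <= T -> Phi A Y u = Y u) ->
  (forall u, 0 <= u -> u <= T -> Phi A Y' u = Y' u) ->
  forall u, 0 <= u -> u <= T -> Y u = Y' u.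
Proof.
move=> hY hY' fixY fixY'; have [_ [M hM]] := hY'; have [_ fA] := hA.
have M0 := var_le_ge0 T0 hM.
have [C C0 contr] := solution_map_contraction y T0 q1 qp pq hf hX hL M0.
pose eps := 2^-1 / (C + 1).
have C10 : 0 < C + 1 by rewrite ltr_wpDl.
have eps0 : 0 < eps by rewrite divr_gt0.
have e0 : 0 < eps `^ (q / p) by exact: powR_gt0.
pose Q t := forall u, 0 <= u -> u <= t -> Y u = Y' u.
suff : Q T by [].
have last t : 0 <= t -> t <= T -> (forall u, 0 <= u -> u < t -> Y u = Y' u) -> Y t = Y' t.
  move=> t0 tT h; apply: etrans (esym (fixY t t0 tT)) _.
  by apply: etrans (fixY' t t0 tT); apply: solution_map_eq.
apply: (small_variation_induction e0) => [u u0 u0'|s t s0 st tT hv Qs].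
  have -> : u = 0 by apply/eqP; rewrite eq_le u0 u0'.
  by apply: last => // w w0 /(le_lt_trans w0); rewrite ltxx.
have H v : s <= v -> v < t -> Y v = Y' v.
  move=> sv vt; have vT := le_trans (ltW vt) tT.
  have fD : finvar p (fun r => Y r - Y' r) s v.
    by apply: finvar_sub (DpathB p0 hY hY').2.
  move DE : (var p (fun r => Y r - Y' r) s v) => D.
  have D0 : 0 <= D by rewrite -DE; exact: var_ge0.
  have vD := var_leP fD; rewrite DE in vD.
  have vM : var_le p Y' s v M by exact: var_le_sub hM.
  have := contr A Y Y' s v D hA hY hY' s0 sv vT Qs vM vD.
  have hE : var q A s v `^ (p / q) <= eps.
    apply: powR_ratio_le => //; first by apply: var_ge0 => //; exact: finvar_sub fA.
    by apply: var_lub => //; exact: hv.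
  move: (var q A s v `^ (p / q)) (powR_ge0 (var q A s v) (p / q)) hE => E E0 hE vPhi.
  have {vPhi} : D <= C * E * D.
    rewrite -[leLHS]DE; apply: var_lub => //; apply: var_le_eq vPhi => r /andP[sr rv].
    by rewrite fixY ?fixY'// ?(le_trans s0)// (le_trans rv).
  have CE : C * E <= 2^-1.
    apply: (@le_trans _ _ ((C + 1) * eps)); first by apply: ler_pM => //; rewrite lerDl.
    by rewrite /eps mulrC divfK// gt_eqF.
  move=> h; have DD : D <= 2^-1 * D by apply: le_trans h _; exact: ler_wpM2r.
  have D00 : D <= 0 by lra.
  have := var_le_incr vD (lexx _) sv (lexx _) p0; rewrite (Qs s)// subrr subr0.
  move=> /le_trans/(_ D00) h0; apply/eqP; rewrite -subr_eq0 -normr_eq0.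
  have : `|Y v - Y' v| `^ p == 0 by rewrite eq_le h0 powR_ge0.
  by rewrite powR_eq0 => /andP[].
move=> u u0; rewrite le_eqVlt => /predU1P[->|ut].
  apply: last => //; first exact: le_trans (ltW st).
  move=> w w0 wt; have [ws|/ltW sw] := leP w s; [exact: Qs|exact: H].
by have [us|/ltW su] := leP u s; [exact: Qs|exact: H].
Qed.

End Existence.

(** * Null sets of Lebesgue-Stieltjes measures *)

Section StieltjesMeasure.
Variables (R : realType) (c : cumulative R R).
Implicit Types (a b s t u v e eta : R).

Local Notation mu := (lebesgue_stieltjes_measure c).

Lemma cumulative_le u v : u <= v -> c u <= c v.
Proof. exact: (cumulative_is_nondecreasing c). Qed.

Lemma stieltjes_itvoc a b : a <= b -> mu `]a, b]%classic = (c b - c a)%:E.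
Proof.
move=> ab; rewrite /lebesgue_stieltjes_measure /measure_extension/=.
by rewrite measurable_mu_extE/= ?wlength_itv_bnd//; exact: is_ocitv.
Qed.

Lemma stieltjes_null_itvco s e : 0 < e -> c (s + e) = c s ->
  (forall eta, 0 < eta -> exists2 u, u < s & c s - c u <= eta) ->
  mu `[s, s + e[%classic = 0%E.
Proof.
move=> e0 cse hs; apply/eqP; rewrite -measure_le0; apply/lee_addgt0Pr => eta eta0.
have [u us hu] := hs eta eta0.
apply: (@le_trans _ _ (mu `]u, s + e]%classic)).
  apply: le_measure; rewrite ?inE; [exact: measurable_itv|exact: measurable_itv|].
  move=> x /=; rewrite !in_itv/= => /andP[sx xe]; rewrite (lt_le_trans us sx)/=.
  exact: ltW.
rewrite stieltjes_itvoc; last by rewrite (le_trans (ltW us))// lerDl ltW.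
by rewrite cse add0e lee_fin.
Qed.

(** The intervals ]s - 1/k, s] shrink to the atom. *)
Lemma stieltjes_atom_le s eta : mu [set s] = 0%E -> 0 < eta ->
  exists2 u, u < s & c s - c u <= eta.
Proof.
move=> m0 eta0; pose F (k : nat) := `]s - k.+1%:R^-1, s]%classic.
have lts k : s - k.+1%:R^-1 < s by rewrite ltrBlDr ltrDl invr_gt0.
have FE k : mu (F k) = (c s - c (s - k.+1%:R^-1))%:E.
  by rewrite stieltjes_itvoc// ltW.
have : mu \o F @ \oo --> mu (\bigcap_k F k).
  apply: nonincreasing_cvg_mu.
  - by apply: (@le_lt_trans _ _ (c s - c (s - 1%:R^-1))%:E); [rewrite -(FE 0%N)|exact: ltry].
  - by move=> k; exact: measurable_itv.
  - by apply: bigcap_measurable => // k _; exact: measurable_itv.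
  - move=> k j kj; apply/subsetPset => x; rewrite /F /= !in_itv/= => /andP[h ->].
    by rewrite andbT; apply: le_lt_trans h; rewrite lerB// lef_pV2 ?posrE// ler_nat.
have -> : \bigcap_k F k = [set s].
  apply/seteqP; split => [x h|_ -> k _]; last by rewrite /F /= in_itv/= lts lexx.
  apply/eqP; rewrite eq_le; apply/andP; split.
    by have := h 0%N I; rewrite /F/= in_itv/= => /andP[].
  apply/ler_addgt0Pr => e e0; have [k ke] : exists k : nat, k.+1%:R^-1 < e :> R.
    have := near_infty_natSinv_lt (PosNum e0); move=> [k _ hk]; exists k; exact: (hk k (leqnn k)).
  by have := h k I; rewrite /F/= in_itv/= ltrBlDr => /andP[/ltW h' _]; rewrite (le_trans h')// lerD2l ltW.
rewrite m0 => /fine_cvgP[_ /cvgrPdist_lt/(_ _ eta0)[k _ hk]].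
exists (s - k.+1%:R^-1) => //; have := hk k (leqnn k).
rewrite /= FE/= sub0r normrN => /ltW; apply: le_trans; exact: ler_norm.
Qed.

(** For a fixed end point r the points s with a null interval [s, r[ form an
    interval, which is itself of the form [a, r[ or a countable union of such null
    intervals; and rational end points suffice to cover E. *)
Lemma stieltjes_right_cover (E : set R) :
  (forall s, E s -> exists2 e, 0 < e & mu `[s, s + e[%classic = 0%E) ->
  mu.-negligible E.
Proof.
move=> hE.
pose N (r : R) : set R := [set s | s < r /\ mu `[s, r[%classic = 0%E].
have Nup r u v : N r u -> u <= v -> v < r -> N r v.
  move=> [_ h] uv vr; split => //; apply/eqP; rewrite -measure_le0 -[leRHS]h.
  apply: le_measure; rewrite ?inE; [exact: measurable_itv|exact: measurable_itv|].
  by move=> x /=; rewrite !in_itv/= => /andP[vx ->]; rewrite (le_trans uv).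
have itv_null u r : N r u -> mu.-negligible `[u, r[%classic.
  by move=> [_ h]; exists `[u, r[%classic; split => //; exact: measurable_itv.
have ratU (F : rat -> set R) : (forall x, mu.-negligible (F x)) ->
    mu.-negligible (\bigcup_x F x).
  move=> hF; pose G k := if @unpickle rat k is Some x then F x else set0.
  have : mu.-negligible (\bigcup_k G k).
    apply: negligible_bigcup => k; rewrite /G; case: unpickle => [x|]; first exact: hF.
    exact: negligible_set0.
  move=> hG; apply: negligibleS hG => s [x _ Fs].
  have GF : G (pickle x) = F x by rewrite /G pickleK.
  by exists (pickle x); [|rewrite GF].
have Nnull r : mu.-negligible (N r).
  have [[a [Na ha]]|h] := pselect (exists a, N r a /\ forall s, N r s -> a <= s).
    apply: negligibleS (itv_null a r Na) => s Ns /=; rewrite in_itv/= ha//=.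
    by case: Ns.
  pose F (x : rat) := [set s | N r (ratr x) /\ ratr x <= s < r].
  have : mu.-negligible (\bigcup_x F x).
    apply: ratU => x; have [hx|hx] := pselect (N r (ratr x)).
      by apply: negligibleS (itv_null _ _ hx) => s [_ hs]; rewrite /= in_itv.
    by apply: negligibleS (negligible_set0 _) => s [/hx].
  apply: negligibleS => s Ns; have [s' [Ns' s's]] : exists s', N r s' /\ s' < s.
    apply: contrapT => h'; apply: h; exists s; split => // w Nw; rewrite leNgt.
    by apply/negP => ws; apply: h'; exists w.
  have [x] := rat_in_itvoo s's; rewrite in_itv/= => /andP[sx xs].
  exists x => //; split; last by rewrite ltW//; case: Ns.
  by apply: Nup Ns' (ltW sx) _; apply: lt_trans xs _; case: Ns.
apply: negligibleS (ratU (fun x => N (ratr x)) _) => [s Es|x]; last exact: Nnull.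
have [e e0 he] := hE s Es.
have se : s < s + e by rewrite ltrDl.
have [x] := rat_in_itvoo se; rewrite in_itv/= => /andP[sx xe].
exists x => //; split => //; apply/eqP; rewrite -measure_le0 -[leRHS]he.
apply: le_measure; rewrite ?inE; [exact: measurable_itv|exact: measurable_itv|].
by move=> z /=; rewrite !in_itv/= => /andP[-> zx]; rewrite (lt_trans zx).
Qed.

Import HBNNSimple.

(** A simple function below g vanishes outside the null set. *)
Lemma integral_null_support (D : set R) (g : R -> R) :
  (forall s, D s -> 0 <= g s) -> mu.-negligible [set s | D s /\ 0 < g s] ->
  (\int[mu]_(s in D) (g s)%:E = 0)%E.
Proof.
move=> g0 [N [mN N0 hN]].
have gD0 s : D s -> (0 <= (g s)%:E)%E by move=> /g0; rewrite lee_fin.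
apply/eqP; rewrite eq_le integral_ge0// andbT ge0_integralE//.
apply: ge_ereal_sup => _ [h /= hg <-]; rewrite -integralT_nnsfun.
have -> // : (\int[mu]_x (h x)%:E = 0)%E.
rewrite (@ge0_ae_eq_integral _ _ _ mu setT _ (cst 0%E)) ?integral0//.
- exact/measurable_EFinP/measurable_funTS.
- by move=> x _; rewrite lee_fin.
- exists N; split => // x /= hx; apply: hN => /=; apply: contrapT => nD; apply: hx => _.
  have := hg x; rewrite patchE; case: ifPn => [xD|_]; last first.
    by rewrite lee_fin => h0; congr (_%:E); apply/eqP; rewrite eq_le h0/=.
  move: xD; rewrite inE => xD; rewrite lee_fin => hgx.
  have gx : g x <= 0 by rewrite leNgt; apply/negP => gx; apply: nD.
  by congr (_%:E); apply/eqP; rewrite eq_le (le_trans hgx gx)/=.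
Qed.

(** k times the indicator function of S is a simple function below g. *)
Lemma integral_zero_null (D S : set (measurableTypeR R)) (g : R -> R) (k : R) :
  (forall s, D s -> 0 <= g s) -> (\int[mu]_(s in D) (g s)%:E = 0)%E ->
  measurable S -> S `<=` D -> 0 < k -> (forall s, S s -> k <= g s) ->
  mu S = 0%E.
Proof.
move=> g0 I0 mS SD k0 hk.
have gD0 s : D s -> (0 <= (g s)%:E)%E by move=> /g0; rewrite lee_fin.
pose h := scale_nnsfun (indic_nnsfun R mS) (ltW k0).
have : (sintegral mu h <= 0)%E.
  rewrite -I0 ge0_integralE//; apply: ereal_sup_ubound; exists h => // x.
  rewrite /= patchE mindicE; case: ifPn => [xD|xD].
    rewrite lee_fin; have [xS|xS] := boolP (x \in S).
      by rewrite mulr1; apply: hk; move: xS; rewrite inE.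
    by rewrite mulr0; apply: g0; move: xD; rewrite inE.
  have [xS|xS] := boolP (x \in S); last by rewrite mulr0.
  by move: xD; rewrite mem_set//; apply: SD; move: xS; rewrite inE.
have e1 : sintegral mu h = (k%:E * sintegral mu (indic_nnsfun R mS))%E.
  exact: (sintegralrM mu k (indic_nnsfun R mS)).
have e2 : sintegral mu (indic_nnsfun R mS) = mu S.
  apply: etrans (sintegral_indic mu S); apply: eq_sintegral => x.
  by rewrite /= mindicE indicE.
rewrite e1 e2.
rewrite pmule_rle0 ?lte_fin// => h0; apply/eqP.
by rewrite -measure_le0.
Qed.

End StieltjesMeasure.

(** * The minimality condition *)

Section Minimality.
Variables (R : realType) (T : R).
Hypothesis T0 : 0 <= T.
Implicit Types (g k l : R -> R) (a b s t u v e eta m : R).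

Lemma extendE k t : 0 <= t -> t <= T -> extend T k t = k t.
Proof. by move=> t0 tT; rewrite /extend min_l// max_r. Qed.

Lemma extend_lt0 k t : t <= 0 -> extend T k t = k 0.
Proof. by move=> t0; rewrite /extend max_l// ge_min t0. Qed.

Lemma extend_gtT k t : T <= t -> extend T k t = k T.
Proof. by move=> Tt; rewrite /extend min_r// max_r. Qed.

Lemma extend_cumulative k : (forall s t, 0 <= s -> s <= t -> t <= T -> k s <= k t) ->
  rcont T k -> exists c : cumulative R R, (c : R -> R) =1 extend T k.
Proof.
move=> km rk.
have nd : nondecreasing (extend T k).
  move=> x z xz; apply: km.
  - by rewrite le_max lexx.
  - by rewrite ge_max !le_max lexx/= le_min !ge_min xz lexx !orbT.
  - by rewrite ge_max T0 ge_min lexx orbT.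
have rc : forall x, extend T k @ at_right x --> extend T k x.
  move=> x; apply/cvgrPdist_lt => e e0.
  have [x0|x0] := ltP x 0.
    near=> z; have z0 : z < 0 by near: z; exact: nbhs_right_lt.
    by rewrite !extend_lt0 ?ltW// subrr normr0.
  have [Tx|xT] := leP T x.
    near=> z; have xz : x < z by near: z; exact: nbhs_right_gt.
    by rewrite !extend_gtT ?subrr ?normr0// (le_trans Tx)// ltW.
  have [d d0 h] := rk x x0 xT e e0; near=> z.
  have xz : x <= z by near: z; exact: nbhs_right_ge.
  have zd : z < x + d by near: z; apply: nbhs_right_lt; rewrite ltrDl.
  have zT : z <= T by near: z; exact: nbhs_right_le.
  by rewrite !extendE ?(le_trans x0)// ?ltW// distrC; exact: h.
pose c := HB.pack_for (cumulative R R) (extend T k) (isCumulative.Build R _ R _ nd rc).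
by exists c.
Unshelve. all: by end_near. Qed.

(** Off the barrier the reflection term is constant for a while to the right, and
    it cannot have jumped since a jump ends on the barrier; so every point off the
    barrier starts a null right-neighbourhood. *)
Lemma reflection_minimal l : ubounded T l -> rcont T l -> l 0 <= 0 ->
  stieltjes_integral_vanishes T (fun s => reflection l s - l s) (reflection l).
Proof.
move=> bl rl l0; set k := reflection l.
have km s t : 0 <= s -> s <= t -> t <= T -> k s <= k t by exact: reflection_mono.
have rk : rcont T k by exact: reflection_rcont.
have [c cE] := extend_cumulative km rk; exists c => // t /andP[t0 tT].
apply: integral_null_support => [s|].
  rewrite /= in_itv/= => /andP[s0 st]; rewrite subr_ge0.
  exact: (reflection_ge bl s0 (lexx s) (le_trans st tT)).
apply: stieltjes_right_cover => s /= [+ +]; rewrite in_itv/= subr_gt0 => /andP[s0 st] lk.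
have sT := le_trans st tT.
have atom eta : 0 < eta -> exists2 u, u < s & c s - c u <= eta.
  move=> eta0; rewrite !cE extendE//.
  move: s0; rewrite le_eqVlt => /predU1P[s0|s0].
    by exists (- 1); [rewrite -s0 oppr_lt0|rewrite -s0 cE extend_lt0 ?subrr ?ltW// oppr_le0].
  have [ks0|ks0] := leP (k s) 0.
    exists 0 => //; rewrite cE extendE//; have := @reflection_ge0 _ T l bl 0 (lexx _) T0.
    by rewrite -/k; lra.
  pose m := Num.max 0 (Num.max (l s) (k s - eta)).
  have mk : m < k s by rewrite !gt_max ks0 lk/= ltrBlDr ltrDl.
  have [r [/andP[r0 rs] mr]] : exists r, 0 <= r <= s /\ m < l r.
    apply: contrapT => h; move: mk; rewrite ltNge => /negP; apply.
    apply: reflection_le; [exact: ltW|by rewrite le_max lexx|].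
    by move=> r hr; rewrite leNgt; apply/negP => lr; apply: h; exists r.
  move: mr; rewrite !gt_max => /and3P[_ ls lks].
  have rs' : r < s by rewrite lt_neqAle rs andbT; apply/eqP => rse; move: ls; rewrite rse ltxx.
  exists r => //; rewrite cE extendE//; last exact: le_trans sT.
  have := reflection_ge bl r0 (lexx r) (le_trans rs sT).
  by rewrite -/k; lra.
have [e e0 ce] : exists2 e, 0 < e & c (s + e) = c s.
  move: sT; rewrite le_eqVlt => /predU1P[sT|sT].
    by exists 1 => //; rewrite !cE sT (extend_gtT k (lexx T)) extend_gtT// lerDl.
  have kl : 0 < k s - l s by rewrite subr_gt0.
  have [d d0 h] := rl s s0 sT _ kl.
  pose e := Num.min (d / 2) (T - s).
  have e0 : 0 < e by rewrite lt_min divr_gt0//= subr_gt0.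
  have ed : e < d by rewrite gt_min; apply/orP; left; lra.
  have eT : e <= T - s by rewrite ge_min lexx orbT.
  have see : s <= s + e by rewrite lerDl ltW.
  have seT : s + e <= T by rewrite -lerBrDl.
  have se0 := le_trans s0 see.
  exists e => //; rewrite !cE (extendE k s0 (ltW sT)) (extendE k se0 seT).
  apply/eqP; rewrite eq_le; apply/andP; split; last exact: km.
  apply: reflection_le => //.
  - by apply: (reflection_ge0 bl) => //; exact: ltW.
  move=> r /andP[r0 rse]; have [rs|sr] := leP r s.
    by apply: (reflection_ge bl) => //; exact: ltW.
  have rd : r < s + d by rewrite (le_lt_trans rse)// ltrD2l.
  have /ltW := h r (ltW sr) rd (le_trans rse seT).
  by move=> /(le_trans (ler_norm _)); rewrite lerD2r.
by exists e => //; apply: stieltjes_null_itvco.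
Qed.

(** Suppose that k exceeds at time t the value m that reflection requires.  As long
    as k > m the path is off the barrier, so k neither jumps nor grows (flat); going
    back to the first time where k > m, it must have got there by a jump or by
    moving continuously, and both are excluded. *)
Lemma minimal_reflection g k l : ubounded T l -> rcont T k -> rcont T g ->
  (forall s t, 0 <= s -> s <= t -> t <= T -> k s <= k t) -> k 0 = 0 ->
  (forall s, 0 <= s -> s <= T -> 0 <= g s) ->
  (forall s, 0 <= s -> s <= T -> g s = k s - l s) ->
  stieltjes_integral_vanishes T g k ->
  forall t, 0 <= t -> t <= T -> k t = reflection l t.
Proof.
move=> bl rk rg km k0 g0 gE [c cE cI] t t0 tT.
have I0 := cI T; rewrite T0 lexx in I0; have {}I0 := I0 isT.
have gD s : [set` `[0, T]] s -> 0 <= g s.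
  by rewrite /= in_itv/= => /andP[s0 sT]; exact: g0.
have atom s eta : 0 < s -> s <= T -> 0 < g s -> 0 < eta ->
    exists2 u, [/\ 0 <= u & u < s] & forall v, u <= v -> v <= s -> k s - k v <= eta.
  move=> s0 sT gs eta0.
  have m0 : lebesgue_stieltjes_measure c [set s] = 0%E.
    apply: (@integral_zero_null _ c _ [set s] g (g s) gD I0) => //.
    - by move=> x /= ->; rewrite in_itv/= ltW.
    - by move=> x ->.
  have [u us hu] := stieltjes_atom_le m0 eta0.
  exists (Num.max 0 u); first by split; [rewrite le_max lexx|rewrite gt_max s0].
  move=> v; rewrite ge_max => /andP[v0 uv] vs; apply: le_trans hu.
  rewrite cE (extendE k (ltW s0) sT) lerD2l lerN2 -(extendE k v0 (le_trans vs sT)) -cE.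
  exact: cumulative_le.
have right s : 0 <= s -> s < T -> 0 < g s ->
    exists2 e, 0 < e & forall v, s <= v -> v < s + e -> v <= T -> k v = k s.
  move=> s0 sT gs; have gs2 : 0 < g s / 2 by rewrite divr_gt0.
  have [d d0 h] := rg s s0 sT _ gs2.
  pose e := Num.min d (T - s).
  have e0 : 0 < e by rewrite lt_min d0 subr_gt0.
  have ed : e <= d by rewrite ge_min lexx.
  have eT : e <= T - s by rewrite ge_min lexx orbT.
  have m0 : lebesgue_stieltjes_measure c `[s, s + e[%classic = 0%E.
    apply: (@integral_zero_null _ c _ `[s, s + e[%classic g (g s / 2) gD I0) => //.
    - move=> x /=; rewrite !in_itv/= => /andP[sx xe]; rewrite (le_trans s0)//=; lra.
    - move=> x /=; rewrite in_itv/= => /andP[sx xe].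
      have xT : x <= T by lra.
      have := h x sx (lt_le_trans xe _) xT; rewrite lerD2l => /(_ ed).
      by rewrite ltr_distl => /andP[/ltW + _]; lra.
  exists e => // v sv ve vT; have v0 := le_trans s0 sv.
  have : lebesgue_stieltjes_measure c `]s, v]%classic = 0%E.
    apply/eqP; rewrite -measure_le0 -[leRHS]m0; apply: le_measure; rewrite ?inE.
    - exact: measurable_itv.
    - exact: measurable_itv.
    - move=> x /=; rewrite !in_itv/= => /andP[/ltW -> xv]; exact: le_lt_trans ve.
  rewrite stieltjes_itvoc// !cE !extendE// ?(ltW sT)// => -[/eqP].
  by rewrite subr_eq0 => /eqP.
apply/eqP; rewrite eq_le; apply/andP; split; last first.
  apply: reflection_le => //; first by rewrite -k0 km.
  move=> r /andP[r0 rt]; apply: (@le_trans _ _ (k r)); last exact: km.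
  by rewrite -subr_ge0 -gE ?g0// (le_trans rt).
rewrite leNgt; apply/negP; set m := reflection l t => mk.
have m0 : 0 <= m by exact: reflection_ge0 bl _ _ _.
have gpos r : 0 <= r -> r <= t -> m < k r -> 0 < g r.
  move=> r0 rt mr; rewrite gE ?(le_trans rt)// subr_gt0; apply: le_lt_trans mr.
  exact: (reflection_ge bl).
have flat u : 0 <= u -> u <= t -> m < k u -> k u = k t.
  move=> u0 ut mu; pose S := [set v | u <= v <= t /\ k v = k u].
  have Su : S u by split => //; rewrite lexx.
  have hS : has_sup S by split; [exists u|exists t => v [/andP[]]].
  have ub : u <= sup S by exact: (ub_le_sup hS.2).
  have st : sup S <= t by apply: (ge_sup hS.1) => v [/andP[]].
  have s0 := le_trans u0 ub; have sT := le_trans st tT.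
  have ks : k (sup S) = k u.
    move: ub; rewrite le_eqVlt => /predU1P[<-//|ub].
    have ms : m < k (sup S) by apply: lt_le_trans mu _; apply: km => //; exact: ltW.
    apply/eqP; rewrite eq_le; apply/andP; split; last by apply: km => //; exact: ltW.
    apply/ler_addgt0Pr => eta eta0.
    have [w [w0 ws] hw] := atom _ eta (le_lt_trans u0 ub) sT (gpos _ s0 st ms) eta0.
    have sw : 0 < sup S - w by rewrite subr_gt0.
    have [v [/andP[uv vt] kv]] := sup_adherent sw hS; rewrite subKr => wv.
    have vs : v <= sup S by apply: (ub_le_sup hS.2); split => //; rewrite uv.
    by have := hw v (ltW wv) vs; rewrite kv; lra.
  move: st; rewrite le_eqVlt => /predU1P[<-//|st].
  have ms : m < k (sup S) by rewrite ks.
  have [e e0 he] := right _ s0 (lt_le_trans st tT) (gpos _ s0 (ltW st) ms).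
  pose v := Num.min t (sup S + e / 2).
  have vt : v <= t by rewrite ge_min lexx.
  have sv : sup S < v by rewrite lt_min st ltrDl divr_gt0.
  have ve : v < sup S + e by rewrite gt_min; apply/orP; right; rewrite ltrD2l; lra.
  have Sv : S v.
    split; first by rewrite vt (le_trans ub)// ltW.
    by rewrite (he v (ltW sv) ve)// (le_trans vt).
  by have := ub_le_sup hS.2 Sv; rewrite leNgt sv.
pose E := [set r | 0 <= r <= t /\ m < k r].
have Et : E t by split => //; rewrite t0 lexx.
have hE : has_inf E by split; [exists t|exists 0 => r [/andP[]]].
have bt : inf E <= t by exact: (ge_inf hE.2).
have b0 : 0 <= inf E by apply: (lb_le_inf hE.1) => r [/andP[]].
have below r : 0 <= r -> r < inf E -> k r <= m.
  move=> r0 rb; rewrite leNgt; apply/negP => mr.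
  have Er : E r by split => //; rewrite r0 (le_trans (ltW rb)).
  by have := ge_inf hE.2 Er; rewrite leNgt rb.
have [kb|kb] := leP (k (inf E)) m.
  have bt' : inf E < t.
    by rewrite lt_neqAle bt andbT; apply/eqP => bE; move: kb; rewrite bE leNgt mk.
  have bT := lt_le_trans bt' tT.
  have ktm : 0 < k t - m by rewrite subr_gt0.
  have [d d0 hd] := rk _ b0 bT _ ktm.
  have [r Er rd] := inf_adherent d0 hE.
  have [/andP[r0 rt] mr] := Er.
  have br := ge_inf hE.2 Er.
  have := hd r br rd (le_trans rt tT); rewrite (flat r r0 rt mr).
  by move=> /(le_lt_trans (ler_norm _)); lra.
have b0' : 0 < inf E.
  by rewrite lt_neqAle b0 andbT eq_sym; apply/eqP => bE; move: kb; rewrite bE k0 ltNge m0.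
have kbm : 0 < (k (inf E) - m) / 2 by rewrite divr_gt0// subr_gt0.
have [u [u0 us] hu] := atom _ _ b0' (le_trans bt tT) (gpos _ b0 bt kb) kbm.
by have := hu u (lexx u) (ltW us); have := below u u0 us; lra.
Qed.

End Minimality.

(** * Back to the Euclidean p-variation norm *)

Section Conversion.
Variables (R : realType) (m : nat) (T r : R).
Hypotheses (T0 : 0 <= T) (r1 : 1 <= r).
Implicit Types (Z : R -> 'cV[R]_m) (s t u x : R) (P C : seq R).

Let r0 : 0 < r. Proof. exact: lt_le_trans r1. Qed.

Lemma eucl_norm_ge (v : 'cV[R]_m) : `|v| <= eucl_norm v.
Proof.
apply: mx_norm_le => [|i j]; first exact: sqrtr_ge0.
rewrite -sqrtr_sqr ler_sqrt; last by apply: sumr_ge0 => k _; exact: sqr_ge0.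
by rewrite ord1 (bigD1 i)//= lerDl; apply: sumr_ge0 => k _; exact: sqr_ge0.
Qed.

Lemma eucl_norm_le (v : 'cV[R]_m) : eucl_norm v <= m%:R * `|v|.
Proof.
have h0 : 0 <= m%:R * `|v| by exact: mulr_ge0.
rewrite -[leRHS]ger0_norm// -sqrtr_sqr ler_wsqrtr//.
have h : \sum_(i < m) v i ord0 ^+ 2 <= \sum_(i < m) `|v| ^+ 2.
  by apply: ler_sum => i _; rewrite -normr_id -real_normK ?num_real// lerXn2r ?nnegrE// normr_id mx_entry_le.
apply: le_trans h _; rewrite sumr_const card_ord -[leLHS]mulr_natl exprMn.
apply: ler_wpM2r; first exact: sqr_ge0.
by rewrite -natrX ler_nat; case: m => // k; rewrite leq_pmulr.
Qed.

Lemma pvariation_sum_cons Z s t y P :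
  pvariation_sum r Z s t (y :: P) =
  eucl_norm (Z y - Z s) `^ r + pvariation_sum r Z y t P.
Proof. by rewrite /pvariation_sum /= big_nat_recl. Qed.

Lemma vsum_le_pvariation_sum Z s t P : vsum r Z s P <= pvariation_sum r Z s t P.
Proof.
elim: P s => [|y P ih] s; first by rewrite /pvariation_sum big_geq.
rewrite pvariation_sum_cons /=; apply: lerD (ih y).
by apply: powR_le; [exact: ltW| |exact: eucl_norm_ge].
Qed.

Lemma pvariation_sum_le_vsum Z s t P :
  pvariation_sum r Z s t P <= m%:R `^ r * vsum r Z s P.
Proof.
elim: P s => [|y P ih] s; first by rewrite /pvariation_sum big_geq//= mulr0.
rewrite pvariation_sum_cons /= mulrDr; apply: lerD (ih y).
rewrite -powRM//; apply: powR_le; [exact: ltW|exact: sqrtr_ge0|exact: eucl_norm_le].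
Qed.

(** The missing end points 0 and T are added by joining trivial chains. *)
Lemma chain_to_partition Z x C : 0 <= x -> path <%R x C -> last x C <= T ->
  exists2 P, itv_partition 0 T P & vsum r Z x C <= vsum r Z 0 P.
Proof.
move=> x0 pC lT.
have [P1 [p1 l1 h1]] := @vsum_join _ _ r Z x C T [::] pC lT isT.
have [P2 [p2 l2 h2]] := @vsum_join _ _ r Z 0 [::] x P1 isT x0 p1.
exists P2; first by split => //; rewrite l2 l1.
by move: h1 h2; rewrite /= addr0 add0r; exact: le_trans.
Qed.

Lemma Dspace_Dpath Z : Dspace r T Z -> Dpath T r Z.
Proof.
move=> [[rZ lZ] vZ]; split.
  move=> t t0 tT e e0; have := rZ t; rewrite t0 tT => /(_ isT)/cvgrPdist_lt/(_ e e0).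
  rewrite near_withinE => /nbhs_ballP[d /= d0 h]; exists d => // u tu ud _.
  move: tu; rewrite le_eqVlt => /predU1P[<-|tu]; first by rewrite subrr normr0.
  by rewrite distrC; apply: h => //; rewrite /ball/= ltr_distlC; lra.
move: vZ; rewrite /pvariation; set S := [set _ | _ in _].
have SM M : ereal_sup S = M%:E -> finvar r Z 0 T.
  move=> SE; exists M => x s x0 ps lT.
  have [P hP h] := chain_to_partition Z x0 ps lT.
  apply: (le_trans h); apply: le_trans (vsum_le_pvariation_sum Z 0 T P) _.
  by rewrite -lee_fin -SE; apply: ereal_sup_ubound; exists P.
case SE : (ereal_sup S) => [M| |]; first by move=> _; exact: SM SE.
  by rewrite poweRyr ?ltxx// invr_eq0 gt_eqF.
move=> _.
have [P hP _] := chain_to_partition Z (lexx 0) (isT : path <%R 0 [::]) T0.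
have : ((pvariation_sum r Z 0 T P)%:E <= ereal_sup S)%E by apply: ereal_sup_ubound; exists P.
by rewrite SE leeNy_eq.
Qed.

Lemma Dpath_Dspace Z : Dpath T r Z -> Dspace r T Z.
Proof.
move=> [rZ fZ]; split; first split.
- move=> t /andP[t0 tT]; apply/cvgrPdist_lt => e e0.
  have [d d0 h] := rZ t t0 tT e e0; near=> u; rewrite distrC; apply: h.
  + by near: u; exact: nbhs_right_ge.
  + by near: u; apply: nbhs_right_lt; rewrite ltrDl.
  + by near: u; exact: nbhs_right_le.
- move=> t /andP[t0 tT]; have [l hl] := llim_ex (finvar_llim r0 fZ) t0 tT.
  apply/cvg_ex; exists l; apply/cvgrPdist_lt => e e0.
  have [w [w0 wt h]] := hl e e0; near=> u; rewrite distrC; apply: h.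
  + by near: u; exact: nbhs_left_ge.
  + by near: u; exact: nbhs_left_lt.
have [M hM] := fZ; rewrite /pvariation; set S := [set _ | _ in _].
have : (ereal_sup S <= (m%:R `^ r * M)%:E)%E.
  apply: ge_ereal_sup => _ [P [pP /eqP lP] <-]; rewrite lee_fin.
  apply: le_trans (pvariation_sum_le_vsum Z 0 T P) _.
  by apply: ler_wpM2l; [exact: powR_ge0|apply: hM => //; rewrite lP].
by move=> h; apply/poweR_lty/(le_lt_trans h); rewrite ltry.
Unshelve. all: by end_near. Qed.

End Conversion.

Lemma stieltjes_integral_vanishes_eq (R : realType) (T : R) (g g' k k' : R -> R) :
  0 <= T -> (forall s, 0 <= s -> s <= T -> g s = g' s) ->
  (forall s, 0 <= s -> s <= T -> k s = k' s) ->
  stieltjes_integral_vanishes T g k -> stieltjes_integral_vanishes T g' k'.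
Proof.
move=> T0 gg kk [c cE cI]; exists c => [t|t /andP[t0 tT]].
  rewrite cE /extend kk//; first by rewrite le_max lexx.
  by rewrite ge_max T0 ge_min lexx orbT.
rewrite -(cI t); last by rewrite t0.
apply: eq_integral => s; rewrite inE /= in_itv/= => /andP[s0 st].
by rewrite gg// (le_trans st).
Qed.

Theorem theorem2p7 (R : realType) (n d : nat) (T p q : R)
  (f : 'cV[R]_n -> 'M[R]_(n, d)) (y : 'cV[R]_n) (A : R -> 'cV[R]_d)
  (X L : R -> 'cV[R]_n)
  (hT : 0 < T) (hn : (1 <= n)%N) (hd : (1 <= d)%N)
  (hf : Cb 2 f)
  (hq : 1 <= q < 2) (hp : q <= p) (hpq : 1 < p^-1 + q^-1)
  (hA : Dspace q T A) (hX : Dspace p T X) (hL : Dspace p T L)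
  (hy : forall i, L 0 i ord0 <= y i ord0)
  (* the equation at time 0 reads Y 0 = y + X 0, and X 0 = 0 is not assumed *)
  (hX0 : forall i, L 0 i ord0 <= y i ord0 + X 0 i ord0) :
  exists Y K : R -> 'cV[R]_n,
    reflected_solution T p f y A X L Y K /\
    forall Y' K' : R -> 'cV[R]_n,
      reflected_solution T p f y A X L Y' K' ->
      forall t : R, 0 <= t <= T -> Y' t = Y t /\ K' t = K t.
Proof.
have T0 := ltW hT; have /andP[q1 _] := hq; have p1 : 1 <= p := le_trans q1 hp.
have p0 : 0 < p by exact: lt_le_trans p1.
have dA := Dspace_Dpath T0 q1 hA; have dX := Dspace_Dpath T0 p1 hX.
have dL := Dspace_Dpath T0 p1 hL.
have [Y dY fixY] := fixed_point_ex y T0 q1 hp hpq hf dX dL dA.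
pose z := unreflected f y X A; pose K := reflection_path f y X L A.
have YE t : 0 <= t -> t <= T -> Y t = z Y t + K Y t by move=> t0 tT; exact: esym (fixY t t0 tT).
have bl W i : Dpath T p W -> ubounded T (obstacle f y X L A W i).
  exact: (obstacle_bounded y T0 q1 hp hpq hf dX dL i dA).
have l0 W i : obstacle f y X L A W i 0 <= 0.
  by rewrite /obstacle /unreflected yint0 !mxE; have := hX0 i; lra.
have rl W i : Dpath T p W -> rcont T (obstacle f y X L A W i).
  by move=> dW; case: (obstacle_Dpath y T0 q1 hp hpq hf dX dL i dA dW).
exists Y, (K Y); split.
  split.
  - exact: Dpath_Dspace.
  - apply: Dpath_Dspace => //.
    exact: (reflection_path_Dpath y T0 q1 hp hpq hf dX dL dA dY).
  - move=> t /andP[t0 tT]; exists (yint (f \o Y) A t); last exact: YE.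
    have dfY := comp_Dpath q1 hp hf dY.
    exact: (yint_integral p1 q1 hpq T0 dfY dA t0 tT).
  - move=> i t /andP[t0 tT]; rewrite YE// mxE -lerBlDl.
    by rewrite /K reflection_pathE; exact: (reflection_ge (bl Y i dY) t0 (lexx t) tT).
  - move=> i s t s0 st tT.
    exact: (reflection_path_mono y T0 q1 hp hpq hf dX dL i dA dY s0 st tT).
  - by move=> i; rewrite /K reflection_pathE; exact: (reflection0 (bl Y i dY) (l0 Y i) T0).
  - move=> i; have := reflection_minimal T0 (bl Y i dY) (rl Y i dY) (l0 Y i).
    apply: stieltjes_integral_vanishes_eq => // s s0 sT; last by rewrite /K reflection_pathE.
    by rewrite YE// mxE /K reflection_pathE /obstacle /z; ring.
move=> Y' K' [dY' dK' eqY' bar mono K0 mini].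
have {}dY' := Dspace_Dpath T0 p1 dY'; have {}dK' := Dspace_Dpath T0 p1 dK'.
have Y'E t : 0 <= t -> t <= T -> Y' t = z Y' t + K' t.
  move=> t0 tT; have [|I hI ->] := eqY' t; first by rewrite t0.
  by rewrite /z /unreflected (yint_unique t0 hI).
have K'E t : 0 <= t -> t <= T -> K' t = K Y' t.
  move=> t0 tT; apply/colP => i; rewrite [RHS]reflection_pathE.
  apply: (@minimal_reflection R T T0 (fun s => Y' s i ord0 - L s i ord0)
    (fun s => K' s i ord0) (obstacle f y X L A Y' i)) => //.
  - exact: bl.
  - by apply: rcont_entry; case: dK'.
  - have [rY' _] := dY'; have [rL _] := dL.
    apply: rcontD; first exact: rcont_entry.
    apply: (@rcont_lip _ _ _ _ _ (fun s => L s i ord0) 1) => //; last exact: rcont_entry.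
    by move=> u v _ _ _; rewrite -opprD normrN mul1r.
  - by move=> s t' ? ? ?; exact: mono.
  - by move=> s s0 sT; rewrite subr_ge0 bar// s0.
  - by move=> s s0 sT; rewrite Y'E// mxE /obstacle /z; ring.
have fixY' u : 0 <= u -> u <= T -> solution_map f y X L A Y' u = Y' u.
  by move=> u0 uT; rewrite [RHS]Y'E// K'E.
have YY' := fixed_point_unique T0 q1 hp hpq hf dX dL dA dY' dY fixY' fixY.
move=> t /andP[t0 tT]; split; first exact: YY'.
have zE : z Y' t = z Y t.
  by apply: unreflected_eq => // u u0 ut; apply: YY' => //; exact: le_trans (ltW ut) tT.
by apply: (addrI (z Y t)); rewrite -[RHS]YE// -(YY' t)// -zE -Y'E.
Qed.
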